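(* Let $R=\prod_{i\in\mathbb{N}}\mathbb{Z}_2$ be the product ring (with $\mathbb{Z}_2=\mathbb{Z}/2\mathbb{Z}$), let $R_j=\{(x_i)_{i\in\mathbb{N}}\in R\mid x_i=0\ \forall i\neq j\}$ for $j\in\mathbb{N}$, and let $I=\bigoplus_{i\in\mathbb{N}}R_i$, an idempotent ideal of $R$. Let $\mathcal{C}_I=\{M\in\mathrm{Mod}(R)\mid IM=M\}$ and $\mathcal{T}_I=\{M\in\mathrm{Mod}(R)\mid IM=0\}$. In the derived category $\mathcal{D}(R)$ of $\mathrm{Mod}(R)$, with shift $\Sigma$ and canonical $t$-structure $(\mathcal{D}^{\leq0},\mathcal{D}^{\geq0})$, consider the $t$-structure $\mathbf{x}=(\mathcal{U},\mathcal{W})$ with $$\mathcal{U}=\{X\in\mathcal{D}^{\leq0}\mid H^0(X)\in\mathcal{C}_I\},\qquad\mathcal{W}=\{X\in\Sigma\mathcal{D}^{\geq0}\mid H^{-1}(X)\in\mathcal{T}_I\},$$ and its heart $\mathcal{H}_{\mathbf{x}}=\mathcal{U}\cap\mathcal{W}$. Then $\mathcal{H}_{\mathbf{x}}$ is AET4* but $\mathbf{x}$ is not co-smashing.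
   Context: $(\mathcal{C}_I,\mathcal{T}_I)$ is a torsion pair in $\mathrm{Mod}(R)$, and $\mathbf{x}$ is the $t$-structure obtained from it by Happel–Reiten–Smalø tilting. $\mathbf{x}$ is co-smashing if $\mathcal{U}$ is closed under products in $\mathcal{D}(R)$. $\mathcal{H}_{\mathbf{x}}$ is an extension-closed full subcategory of $\mathcal{D}(R)$ (an abelian category) and is extriangulated (in the sense of Nakaoka–Palu) with $\mathbb{E}(X,Y)=\mathrm{Hom}_{\mathcal{D}(R)}(X,\Sigma Y)$, where $h\in\mathbb{E}(X,Y)$ is realized by $Y\to Z\to X$ for any distinguished triangle $Y\to Z\to X\xrightarrow{h}\Sigma Y$. For $\eta\in\mathbb{E}(X,Y)$, $a:Y\to Y'$, $c:X'\to X$, write $a\cdot\eta=\mathbb{E}(X,a)(\eta)$ and $\eta\cdot c=\mathbb{E}(c,Y)(\eta)$. **AET4*.** An extriangulated category $(\mathcal{C},\mathbb{E},\mathfrak{s})$ is AET4* if $\mathcal{C}^{op}$ is AET4; explicitly, if every family of objects indexed by a non-empty set has a product in $\mathcal{C}$ (projections $\pi_i$; $A^J$ is the product of $J$ copies of $A$), and for each non-empty set $J$ there is a natural transformation of $\mathrm{Ab}$-valued functors (natural in $A$ and $\{B_i\}_{i\in J}$) $\Gamma:\prod_{i\in J}\mathbb{E}(A,B_i)\to\mathbb{E}(A^J,\prod_{i\in J}B_i)$ such that (1) if $\eta_i$ is realized by $B_i\xrightarrow{f_i}E_i\xrightarrow{g_i}A$ for all $i$, then $\Gamma(\eta_i)_{i\in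 J}$ is realized by $\prod B_i\xrightarrow{\prod f_i}\prod E_i\xrightarrow{\prod g_i}A^J$; (2) $\pi_j^B\cdot\Gamma(\eta_i)_{i\in J}=\eta_j\cdot\pi_j^A$ for all $j\in J$. *)

(* Defs.v *)
From HB Require Import structures.
From mathcomp Require Import all_boot all_order all_algebra.
From mathcomp Require Import all_classical.

Set Implicit Arguments.
Unset Strict Implicit.
Unset Printing Implicit Defensive.

Import Order.TTheory GRing.Theory Num.Theory.

Local Open Scope ring_scope.
Local Open Scope quotient_scope.

(* The quotient of T by the equivalence relation E, as the type of its
   classes; T may be too large for generic_quotient. *)
Section ClassQuotient.
Variables (T : Type) (E : T -> T -> Prop).

Definition class_quot : Type := {A : T -> Prop | exists x, A = E x}.

Definition class_of (x : T) : class_quot :=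
  exist _ (E x) (ex_intro _ x erefl).

Definition class_repr (q : class_quot) : T := sval (cid (svalP q)).

Hypothesis Erefl : forall x, E x x.
Hypothesis Esym : forall x y, E x y -> E y x.
Hypothesis Etrans : forall y x z, E x y -> E y z -> E x z.

Lemma class_reprK q : class_of (class_repr q) = q.
Proof.
case: q => A pA; apply: eq_exist; rewrite /class_repr /=.
by case: (cid _) => x /= e; rewrite e.
Qed.

Lemma class_of_eq x y : E x y -> class_of x = class_of y.
Proof.
move=> xy; apply: eq_exist; apply/funext => z; apply/propext; split.
  by apply: Etrans; apply: Esym.
by apply: Etrans.
Qed.

Lemma class_of_inj x y : class_of x = class_of y -> E x y.
Proof. by move=> /(congr1 sval) /= ->. Qed.

Lemma class_repr_of x : E (class_repr (class_of x)) x.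
Proof. by apply: class_of_inj; rewrite class_reprK. Qed.

End ClassQuotient.

(* MathComp's zmodType cannot be used for the Hom-groups of a derived
   category: they live one universe above the carriers of modules. *)
Record abgroup := Abgroup {
  ab_sort :> Type;
  ab0 : ab_sort;
  abN : ab_sort -> ab_sort;
  abD : ab_sort -> ab_sort -> ab_sort;
  abDA : associative abD;
  abDC : commutative abD;
  ab0D : left_id ab0 abD;
  abND : left_inverse ab0 abN abD }.

Arguments ab0 {_}.

Definition ab_additive (A B : abgroup) (f : A -> B) :=
  {morph f : x y / abD x y}.

Record preadditive := Preadditive {
  obj :> Type;
  hom : obj -> obj -> abgroup;
  idm : forall X, hom X X;
  compm : forall X Y Z, hom Y Z -> hom X Y -> hom X Z;
  compA : forall X Y Z W (h : hom Z W) (g : hom Y Z) (f : hom X Y),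
    compm h (compm g f) = compm (compm h g) f;
  comp1m : forall X Y (f : hom X Y), compm (idm Y) f = f;
  compm1 : forall X Y (f : hom X Y), compm f (idm X) = f;
  compDl : forall X Y Z (f : hom X Y),
    ab_additive (fun g : hom Y Z => compm g f);
  compDr : forall X Y Z (g : hom Y Z),
    ab_additive (fun f : hom X Y => compm g f) }.

Arguments idm {_} _.
Arguments hom {_} _ _.

Definition isomorphism (C : preadditive) (X Y : C) (f : hom X Y) :=
  exists g : hom Y X, compm g f = idm X /\ compm f g = idm Y.

Definition isomorphic (C : preadditive) (X Y : C) :=
  exists f : hom X Y, isomorphism f.

Record product (C : preadditive) (J : Type) (B : J -> C) := Product {
  prod_obj :> C;
  proj : forall j, hom prod_obj (B j);
  tuple_hom : forall X, (forall j, hom X (B j)) -> hom X prod_obj;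
  proj_tuple : forall X (f : forall j, hom X (B j)) j,
    compm (proj j) (tuple_hom f) = f j;
  tuple_hom_uniq : forall X (h h' : hom X prod_obj),
    (forall j, compm (proj j) h = compm (proj j) h') -> h = h' }.

Definition prod_map (C : preadditive) (J : Type) (B B' : J -> C)
    (P : product B) (P' : product B') (f : forall j, hom (B j) (B' j)) :
    hom P P' :=
  tuple_hom P' (fun j => compm (f j) (proj P j)).

(* The data (C, E, s) underlying an extriangulated category: a preadditive
   category C, a biadditive functor E : C^op x C -> Ab, and the realization s,
   given as the relation "eta : E A B is realized by B --f--> Z --g--> A". *)
Record extri := Extri {
  ecat :> preadditive;
  Ext : ecat -> ecat -> abgroup;
  push : forall A B B', hom B B' -> Ext A B -> Ext A B';
  pull : forall A A' B, Ext A B -> hom A' A -> Ext A' B;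
  push1 : forall A B (eta : Ext A B), push (idm B) eta = eta;
  pushM : forall A B B' B'' (b' : hom B' B'') (b : hom B B') (eta : Ext A B),
    push (compm b' b) eta = push b' (push b eta);
  pull1 : forall A B (eta : Ext A B), pull eta (idm A) = eta;
  pullM : forall A A' A'' B (eta : Ext A B) (a : hom A' A) (a' : hom A'' A'),
    pull eta (compm a a') = pull (pull eta a) a';
  push_pull : forall A A' B B' (b : hom B B') (a : hom A' A) (eta : Ext A B),
    pull (push b eta) a = push b (pull eta a);
  pushDl : forall A B B' (eta : Ext A B),
    ab_additive (fun b : hom B B' => push b eta);
  pushDr : forall A B B' (b : hom B B'),
    ab_additive (fun eta : Ext A B => push b eta);
  pullDl : forall A A' B (a : hom A' A),
    ab_additive (fun eta : Ext A B => pull eta a);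
  pullDr : forall A A' B (eta : Ext A B),
    ab_additive (fun a : hom A' A => pull eta a);
  realizes : forall A B Z, Ext A B -> hom B Z -> hom Z A -> Prop }.

Section AET4star.
Variable C : extri.

Definition AET4star_for (J : Type) (P : forall B : J -> C, product B)
    (Gamma : forall (A : C) (B : J -> C),
      (forall i, Ext A (B i)) -> Ext (P (fun=> A)) (P B)) : Prop :=
  [/\ forall A B (eta eta' : forall i, Ext A (B i)),
        Gamma A B (fun i => abD (eta i) (eta' i)) =
        abD (Gamma A B eta) (Gamma A B eta'),
      forall A A' (a : hom A' A) B (eta : forall i, Ext A (B i)),
        Gamma A' B (fun i => pull (eta i) a) =
        pull (Gamma A B eta) (prod_map (P (fun=> A')) (P (fun=> A)) (fun=> a)),
      forall A B B' (b : forall i, hom (B i) (B' i))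
          (eta : forall i, Ext A (B i)),
        Gamma A B' (fun i => push (b i) (eta i)) =
        push (prod_map (P B) (P B') b) (Gamma A B eta),
      forall A B (eta : forall i, Ext A (B i)) (Z : J -> C)
          (f : forall i, hom (B i) (Z i)) (g : forall i, hom (Z i) A),
        (forall i, realizes (eta i) (f i) (g i)) ->
        realizes (Gamma A B eta) (prod_map (P B) (P Z) f)
                                 (prod_map (P Z) (P (fun=> A)) g)
    & forall A B (eta : forall i, Ext A (B i)) j,
        push (proj (P B) j) (Gamma A B eta) =
        pull (eta j) (proj (P (fun=> A)) j)].

Definition AET4star : Prop :=
  (forall J : Type, inhabited J ->
     forall B : J -> C, inhabited (product B)) /\
  (forall J : Type, inhabited J ->
     forall P : (forall B : J -> C, product B),
     exists Gamma, @AET4star_for J P Gamma).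

End AET4star.

Section Complexes.
Variable R : pzRingType.

Definition mklin (U V : lmodType R) (f : U -> V) (lf : linear f) :
    {linear U -> V} :=
  HB.pack_for {linear U -> V} f (GRing.isLinear.Build R U V *:%R f lf).

Record complex := Complex {
  cx_obj :> int -> lmodType R;
  cx_d : forall n, {linear cx_obj n -> cx_obj (n + 1)};
  cx_dd : forall n x, cx_d (n + 1) (cx_d n x) = 0 }.

Arguments cx_d : clear implicits.

Section Cohomology.
Variables (X : complex) (n : int).

Definition ker_d : {pred X n} := fun x => cx_d X n x == 0.

Lemma ker_d_submod_closed : submod_closed ker_d.
Proof.
split=> [|a u v]; rewrite !unfold_in ?linear0 // => /eqP u0 /eqP v0.
by rewrite linearP /= u0 v0 scaler0 addr0.
Qed.

HB.instance Definition _ :=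
  GRing.isSubmodClosed.Build R (X n) ker_d
    (GRing.submod_closed_semi ker_d_submod_closed).

Record cocycle := Cocycle { cocycle_val : X n; _ : cocycle_val \in ker_d }.

HB.instance Definition _ := [isSub for cocycle_val].
HB.instance Definition _ := [Choice of cocycle by <:].
HB.instance Definition _ := [SubChoice_isSubLmodule of cocycle by <:].

End Cohomology.

Lemma cocycle_valP X n a (x y : cocycle X n) :
  cocycle_val (a *: x + y) = a *: cocycle_val x + cocycle_val y.
Proof. by []. Qed.

Lemma cocycle_valB X n (x y : cocycle X n) :
  cocycle_val (x - y) = cocycle_val x - cocycle_val y.
Proof. by []. Qed.

(* Being inductive in the degree avoids a transport along n - 1 + 1 = n. *)
Inductive is_boundary (X : complex) : forall n, X n -> Prop :=
  IsBoundary m (y : X m) : is_boundary (cx_d X m y).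

Lemma int_succP (P : int -> Prop) : (forall n, P (n + 1)) -> forall n, P n.
Proof. by move=> Ps n; rewrite -[n](subrK 1); apply: Ps. Qed.

Lemma is_boundaryS (X : complex) (n : int) (x : X (n + 1)) :
  is_boundary x -> exists y, x = cx_d X n y.
Proof.
move=> bx.
suff: forall k (z : X k), is_boundary z -> forall e : n + 1 = k,
    exists y, eq_rect _ (fun i => X i : Type) (cx_d X n y) k e = z.
  by move=> /(_ _ x bx erefl)[y /= <-]; exists y.
move=> k z [m y] e; have /addIr e' := e; case: _ / e' in y e *.
by rewrite (eq_irrelevance e erefl); exists y.
Qed.

Lemma is_boundary_P (X : complex) n (a : R) (x y : X n) :
  is_boundary x -> is_boundary y -> is_boundary (a *: x + y).
Proof.
move: n x y; apply: int_succP => n x y.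
move=> /is_boundaryS[x' ->] /is_boundaryS[y' ->]; rewrite -linearP; constructor.
Qed.

Lemma is_boundary0 (X : complex) n : is_boundary (0 : X n).
Proof. by move: n; apply: int_succP => n; rewrite -(linear0 (cx_d X n)). Qed.

Section Cohomology2.
Variables (X : complex) (n : int).

Definition coboundaries : {pred cocycle X n} :=
  fun x => `[< is_boundary (cocycle_val x) >].

Lemma coboundaries_submod_closed : submod_closed coboundaries.
Proof.
split=> [|a u v]; rewrite !unfold_in.
  by apply/asboolP; exact: is_boundary0.
by move=> /asboolP bu /asboolP bv; apply/asboolP; exact: is_boundary_P.
Qed.

HB.instance Definition _ := GRing.isSubmodClosed.Build R (cocycle X n)
  coboundaries
    (GRing.submod_closed_semi coboundaries_submod_closed).

Definition cohomology : Type := Quotient.quot coboundaries.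
HB.instance Definition _ := GRing.Zmodule.on cohomology.

Definition coh_class (x : cocycle X n) : cohomology :=
  \pi_(Quotient.quot coboundaries) x.

Definition coh_repr (c : cohomology) : cocycle X n :=
  repr (c : Quotient.quot coboundaries).

Lemma coh_reprK c : coh_class (coh_repr c) = c. Proof. exact: reprK. Qed.

Lemma coh_classP x y :
  coh_class x = coh_class y <-> is_boundary (cocycle_val x - cocycle_val y).
Proof.
rewrite -cocycle_valB; split=> [/eqP|b]; last apply/eqP.
  by rewrite -Quotient.idealrBE => /asboolP.
by rewrite -Quotient.idealrBE; apply/asboolP.
Qed.

Lemma coh_classD x y : coh_class (x + y) = coh_class x + coh_class y.
Proof. exact: (raddfD \pi_(Quotient.quot coboundaries)). Qed.

Definition coh_scale (a : R) (c : cohomology) : cohomology :=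
  coh_class (a *: coh_repr c).

Lemma coh_scale_class a x : coh_scale a (coh_class x) = coh_class (a *: x).
Proof.
apply/coh_classP; rewrite -cocycle_valB -scalerBr -[_ *: _]addr0 cocycle_valP.
apply: is_boundary_P; last exact: is_boundary0.
by rewrite cocycle_valB; apply/coh_classP; rewrite coh_reprK.
Qed.

Lemma coh_scaleA a b c : coh_scale a (coh_scale b c) = coh_scale (a * b) c.
Proof. by rewrite -[c]coh_reprK !coh_scale_class scalerA. Qed.

Lemma coh_scale1 : left_id 1 coh_scale.
Proof. by move=> c; rewrite -[c]coh_reprK coh_scale_class scale1r. Qed.

Lemma coh_scaleDr : right_distributive coh_scale +%R.
Proof.
move=> a c c'; rewrite -[c]coh_reprK -[c']coh_reprK -coh_classD.
by rewrite !coh_scale_class scalerDr coh_classD.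
Qed.

Lemma coh_scaleDl c : {morph coh_scale^~ c : a b / a + b}.
Proof.
move=> a b; rewrite -[c]coh_reprK !coh_scale_class scalerDl.
by rewrite coh_classD.
Qed.

HB.instance Definition _ := GRing.Zmodule_isLmodule.Build R cohomology
  coh_scaleA coh_scale1 coh_scaleDr coh_scaleDl.

End Cohomology2.

Implicit Types X Y Z W : complex.

Record chmap X Y := Chmap {
  cmap :> forall n, {linear X n -> Y n};
  cmap_d : forall n x, cmap (n + 1) (cx_d X n x) = cx_d Y n (cmap n x) }.

Definition ch_id X : chmap X X :=
  @Chmap X X (fun n => idfun : {linear X n -> X n}) (fun n x => erefl).

Lemma ch_comp_d X Y Z (g : chmap Y Z) (f : chmap X Y) n x :
  g (n + 1) (f (n + 1) (cx_d X n x)) = cx_d Z n (g n (f n x)).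
Proof. by rewrite !cmap_d. Qed.

Definition ch_comp X Y Z (g : chmap Y Z) (f : chmap X Y) : chmap X Z :=
  @Chmap X Z (fun n => (g n \o f n)%FUN : {linear X n -> Z n}) (ch_comp_d g f).

Lemma ch_zero_d X Y n (x : X n) : 0 = cx_d Y n 0.
Proof. by rewrite linear0. Qed.

Definition ch_zero X Y : chmap X Y :=
  @Chmap X Y (fun n => \0 : {linear X n -> Y n}) (@ch_zero_d X Y).

Lemma ch_opp_d X Y (f : chmap X Y) n x :
  - f (n + 1) (cx_d X n x) = cx_d Y n (- f n x).
Proof. by rewrite cmap_d linearN. Qed.

Definition ch_opp X Y (f : chmap X Y) : chmap X Y :=
  @Chmap X Y (fun n => \- f n : {linear X n -> Y n}) (ch_opp_d f).

Lemma ch_add_d X Y (f g : chmap X Y) n x :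
  f (n + 1) (cx_d X n x) + g (n + 1) (cx_d X n x) = cx_d Y n (f n x + g n x).
Proof. by rewrite !cmap_d linearD. Qed.

Definition ch_add X Y (f g : chmap X Y) : chmap X Y :=
  @Chmap X Y (fun n => f n \+ g n : {linear X n -> Y n}) (ch_add_d f g).

(* The homotopy is indexed so that its component X^(n+1) -> Y^n needs no
   transport; the equation at n + 1 for all n covers every degree. *)
Definition homotopic X Y (f g : chmap X Y) : Prop :=
  exists h : forall n, {linear X (n + 1) -> Y n}, forall n x,
    f (n + 1) x - g (n + 1) x = cx_d Y n (h n x) + h (n + 1) (cx_d X (n + 1) x).

Definition cocycle_map X Y (f : chmap X Y) n (x : cocycle X n) : cocycle Y n.
Proof.
apply: (@Cocycle Y n (f n (cocycle_val x))); case: x => x /=.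
by rewrite !unfold_in -cmap_d => /eqP ->; rewrite linear0.
Defined.

Definition coh_map X Y (f : chmap X Y) n (c : cohomology X n) :
    cohomology Y n :=
  coh_class (cocycle_map f (coh_repr c)).

Definition qis X Y (f : chmap X Y) : Prop := forall n, bijective (@coh_map X Y f n).

Lemma is_boundaryD X n (x y : X n) :
  is_boundary x -> is_boundary y -> is_boundary (x + y).
Proof. by move=> bx by_; rewrite -[x]scale1r; exact: is_boundary_P. Qed.

Lemma is_boundaryN X n (x : X n) : is_boundary x -> is_boundary (- x).
Proof.
by move=> bx; rewrite -scaleN1r -[_ *: _]addr0; apply: is_boundary_P => //;
   exact: is_boundary0.
Qed.

Lemma is_boundaryB X n (x y : X n) :
  is_boundary x -> is_boundary y -> is_boundary (x - y).
Proof. by move=> bx /is_boundaryN; exact: is_boundaryD. Qed.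

Lemma is_boundary_cmap X Y (f : chmap X Y) n (x : X n) :
  is_boundary x -> is_boundary (f n x).
Proof. by case=> m y; rewrite cmap_d. Qed.

Lemma cocycleP X n (x : cocycle X n) : cx_d X n (cocycle_val x) = 0.
Proof. by case: x => x /=; rewrite unfold_in => /eqP. Qed.

Definition mkcocycle X n (x : X n) (dx : cx_d X n x = 0) : cocycle X n :=
  @Cocycle X n x (introT eqP dx).

Lemma coh_map_class X Y (f : chmap X Y) n (x : cocycle X n) :
  coh_map f (coh_class x) = coh_class (cocycle_map f x).
Proof.
apply/coh_classP; rewrite /= -raddfB; apply: is_boundary_cmap.
by apply/coh_classP; rewrite coh_reprK.
Qed.

Lemma qisP X Y (f : chmap X Y) : qis f <-> forall n,
  (forall x, cx_d X n x = 0 -> is_boundary (f n x) -> is_boundary x) /\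
  (forall y, cx_d Y n y = 0 ->
     exists x, cx_d X n x = 0 /\ is_boundary (y - f n x)).
Proof.
split=> [qf n|qf n].
  have [g fK gK] := qf n; split=> [x dx bfx|y dy].
    have e : coh_class (mkcocycle dx) = coh_class 0.
      apply: (can_inj fK); rewrite !coh_map_class; apply/coh_classP => /=.
      by rewrite linear0 subr0.
    by move/coh_classP: e; rewrite /= subr0.
  exists (cocycle_val (coh_repr (g (coh_class (mkcocycle dy))))).
  split; first exact: cocycleP.
  by have /esym/coh_classP := gK (coh_class (mkcocycle dy)).
have inj : injective (@coh_map X Y f n).
  move=> c c'; rewrite -[c]coh_reprK -[c']coh_reprK !coh_map_class.
  move=> /coh_classP b; apply/coh_classP; apply: (qf n).1.
    by rewrite linearB /= !cocycleP subr0.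
  by rewrite linearB.
have surj (c : cohomology Y n) : exists b, coh_map f b = c.
  have [x [dx bx]] := (qf n).2 _ (cocycleP (coh_repr c)).
  exists (coh_class (mkcocycle dx)).
  by rewrite coh_map_class -[c]coh_reprK; apply/esym/coh_classP.
have [g gK] := choice surj; exists g => // c.
by apply: inj; rewrite gK.
Qed.

Lemma homotopic_refl X Y (f : chmap X Y) : homotopic f f.
Proof.
by exists (fun=> \0) => n x; rewrite /= subrr linear0 addr0.
Qed.

Lemma homotopic_sym X Y (f g : chmap X Y) : homotopic f g -> homotopic g f.
Proof.
case=> h hP; exists (fun n => \- h n : {linear _ -> _}) => n x /=.
by rewrite -opprB hP linearN opprD.
Qed.

Lemma homotopic_add X Y (f f' g g' : chmap X Y) :
  homotopic f f' -> homotopic g g' -> homotopic (ch_add f g) (ch_add f' g').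
Proof.
move=> [h hP] [k kP]; exists (fun n => h n \+ k n : {linear _ -> _}) => n x /=.
by rewrite opprD addrACA hP kP linearD addrACA.
Qed.

Lemma homotopic_opp X Y (f f' : chmap X Y) :
  homotopic f f' -> homotopic (ch_opp f) (ch_opp f').
Proof.
move=> [h hP]; exists (fun n => \- h n : {linear _ -> _}) => n x /=.
by rewrite -opprD hP linearN opprD.
Qed.

Lemma homotopic_trans X Y (g f h : chmap X Y) :
  homotopic f g -> homotopic g h -> homotopic f h.
Proof.
move=> [u uP] [v vP]; exists (fun n => u n \+ v n : {linear _ -> _}) => n x /=.
by rewrite linearD addrACA -uP -vP addrA subrK.
Qed.

Lemma homotopic_compl X Y Z (f : chmap X Y) (g g' : chmap Y Z) :
  homotopic g g' -> homotopic (ch_comp g f) (ch_comp g' f).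
Proof.
move=> [h hP]; exists (fun n => (h n \o f (n + 1))%FUN : {linear _ -> _}) => n x /=.
by rewrite hP cmap_d.
Qed.

Lemma homotopic_compr X Y Z (f f' : chmap X Y) (g : chmap Y Z) :
  homotopic f f' -> homotopic (ch_comp g f) (ch_comp g f').
Proof.
move=> [h hP]; exists (fun n => (g n \o h n)%FUN : {linear _ -> _}) => n x /=.
by rewrite -linearB hP linearD cmap_d.
Qed.

Lemma homotopic_eq X Y (f g : chmap X Y) :
  (forall n x, f n x = g n x) -> homotopic f g.
Proof.
by move=> e; exists (fun=> \0) => n x; rewrite /= e subrr linear0 addr0.
Qed.

Lemma homotopic_boundary X Y (f g : chmap X Y) n (x : X n) :
  homotopic f g -> cx_d X n x = 0 -> is_boundary (f n x - g n x).
Proof.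
move=> [h hP]; move: n x; apply: int_succP => n x dx.
by rewrite hP dx linear0 addr0.
Qed.

Lemma cx_d_cmap X Y (f : chmap X Y) n (x : X n) :
  cx_d X n x = 0 -> cx_d Y n (f n x) = 0.
Proof. by move=> dx; rewrite -cmap_d dx linear0. Qed.

Lemma qis_homotopic X Y (f g : chmap X Y) : homotopic f g -> qis f -> qis g.
Proof.
move=> fg /qisP qf; apply/qisP => n; have [inj surj] := qf n.
split=> [x dx bgx|y dy].
  apply: inj => //; rewrite -[f n x](subrK (g n x)).
  by apply: is_boundaryD => //; exact: homotopic_boundary.
have [x [dx b]] := surj y dy; exists x; split=> //.
rewrite -[y](subrK (f n x)) -addrA; apply: is_boundaryD => //.
exact: homotopic_boundary.
Qed.

Lemma qis_id X : qis (ch_id X).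
Proof.
apply/qisP => n; split=> // y dy; exists y; split=> //.
by rewrite /= subrr; exact: is_boundary0.
Qed.

Lemma qis_comp X Y Z (g : chmap Y Z) (f : chmap X Y) :
  qis g -> qis f -> qis (ch_comp g f).
Proof.
move=> /qisP qg /qisP qf; apply/qisP => n; split=> [x dx b|z dz].
  by apply: (qf n).1 => //; apply: (qg n).1 => //; exact: cx_d_cmap.
have [y [dy bz]] := (qg n).2 z dz; have [x [dx b]] := (qf n).2 y dy.
exists x; split=> //=.
rewrite -[z](subrK (g n y)) -addrA -linearB; apply: is_boundaryD => //.
exact: is_boundary_cmap.
Qed.

Lemma qis_cancel X Y Z (g : chmap Y Z) (f : chmap X Y) :
  qis (ch_comp g f) -> qis f -> qis g.
Proof.
move=> /qisP qgf /qisP qf; apply/qisP => n; split=> [y dy b|z dz].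
  have [x [dx bx]] := (qf n).2 y dy.
  rewrite -[y](subrK (f n x)); apply: is_boundaryD => //.
  apply: is_boundary_cmap; apply: (qgf n).1 => //=.
  rewrite -[g n (f n x)](subrK (g n y)); apply: is_boundaryD => //.
  by rewrite -linearB -opprB linearN; apply/is_boundaryN/is_boundary_cmap.
have [x [dx bx]] := (qgf n).2 z dz; exists (f n x); split=> //.
exact: cx_d_cmap.
Qed.

(* Sign convention: d(x, y) = (- d x, f x + d y), and - d on the shift. *)
Section Cone.
Variables (X Y : complex) (f : chmap X Y).

Definition cone_obj (n : int) : lmodType R := (X (n + 1)%R * Y n)%type.

Definition cone_df (n : int) (p : cone_obj n) : cone_obj (n + 1) :=
  (- cx_d X (n + 1) p.1, f (n + 1) p.1 + cx_d Y n p.2).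

Lemma cone_df_linear n : linear (@cone_df n).
Proof.
move=> a u v; congr pair; rewrite /= !linearP //=.
by rewrite scalerDr addrACA.
Qed.

Definition cone_d n := mklin (@cone_df_linear n).

Lemma cone_dd n x : cone_d (n + 1) (cone_d n x) = 0.
Proof.
congr pair => /=; first by rewrite linearN cx_dd !oppr0.
by rewrite linearN linearD /= cx_dd addr0 cmap_d addNr.
Qed.

Definition cone : complex := Complex cone_dd.

Lemma cone_in_linear n : linear (fun y : Y n => (0, y) : cone n).
Proof. by move=> a u v; congr pair; rewrite /= scaler0 addr0. Qed.

Lemma cone_in_d n (y : Y n) :
  ((0, cx_d Y n y) : cone (n + 1)) = cx_d cone n (0, y).
Proof. by congr pair; rewrite /= linear0 ?oppr0 ?add0r. Qed.

Definition cone_in : chmap Y cone :=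
  @Chmap Y cone (fun n => mklin (@cone_in_linear n)) cone_in_d.

End Cone.

Definition acyclic X := forall n (x : X n), cx_d X n x = 0 -> is_boundary x.

Lemma zmod_shuffle (V : zmodType) (a b y : V) : y = b - a + (a + y - b).
Proof. by rewrite !addrA subrK addrAC subrr add0r. Qed.

Lemma cone_acyclic X Y (f : chmap X Y) : qis f -> acyclic (cone f).
Proof.
move=> /qisP qf; apply: int_succP => n [x y] [/= dx dy].
have {}dx : cx_d X _ x = 0 by rewrite -[LHS]opprK dx oppr0.
have bfx : is_boundary (f _ x).
  suff -> : f _ x = cx_d Y _ (- y) by [].
  by rewrite linearN; apply/eqP; rewrite -addr_eq0 dy.
have /is_boundaryS[a xa] := (qf _).1 x dx bfx.
have dz : cx_d Y _ (f _ a + y) = 0 by rewrite linearD -cmap_d -xa dy.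
have [b [db]] := (qf _).2 _ dz.
move=> /is_boundaryS[c cP].
suff -> : (x, y) = cx_d (cone f) n (b - a, c) by [].
congr pair; rewrite /=; first by rewrite linearB /= db sub0r opprK.
by rewrite -cP linearB; exact: zmod_shuffle.
Qed.

Lemma cone_in_qis X Y (f : chmap X Y) : acyclic X -> qis (cone_in f).
Proof.
move=> aX; apply/qisP; apply: int_succP => n; split=> [y dy|[x y] [/= dx dy]].
  move=> /is_boundaryS[[a b]] [/= da ->].
  have {}da : cx_d X _ a = 0 by rewrite -[LHS]opprK -da oppr0.
  have /is_boundaryS[a' ->] := aX _ _ da.
  by rewrite cmap_d -linearD.
have {}dx : cx_d X _ x = 0 by rewrite -[LHS]opprK dx oppr0.
have /is_boundaryS[a xa] := aX _ _ dx.
exists (f _ a + y); split; first by rewrite linearD -cmap_d -xa dy.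
suff -> : (x, y) - (0, f _ a + y) = cx_d (cone f) n (- a, 0) by [].
congr pair; rewrite /=; first by rewrite subr0 linearN opprK.
by rewrite linearN linear0 addr0 opprD addrCA subrr addr0.
Qed.

Section DirectSum.
Variables X Y : complex.

Definition dsum_obj (n : int) : lmodType R := (X n * Y n)%type.

Definition dsum_df n (p : dsum_obj n) : dsum_obj (n + 1) :=
  (cx_d X n p.1, cx_d Y n p.2).

Lemma dsum_df_linear n : linear (@dsum_df n).
Proof. by move=> a u v; congr pair; rewrite /= linearP. Qed.

Definition dsum_d n := mklin (@dsum_df_linear n).

Lemma dsum_dd n x : dsum_d (n + 1) (dsum_d n x) = 0.
Proof. by congr pair; rewrite /= cx_dd. Qed.

Definition dsum : complex := Complex dsum_dd.

Lemma dsum_in1_linear n : linear (fun x : X n => (x, 0) : dsum n).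
Proof. by move=> a u v; congr pair; rewrite /= scaler0 addr0. Qed.

Lemma dsum_in1_d n (x : X n) :
  ((cx_d X n x, 0) : dsum (n + 1)) = cx_d dsum n (x, 0).
Proof. by congr pair; rewrite /= linear0. Qed.

Definition dsum_in1 : chmap X dsum :=
  @Chmap X dsum (fun n => mklin (@dsum_in1_linear n)) dsum_in1_d.

Lemma dsum_in2_linear n : linear (fun y : Y n => (0, y) : dsum n).
Proof. by move=> a u v; congr pair; rewrite /= scaler0 addr0. Qed.

Lemma dsum_in2_d n (y : Y n) :
  ((0, cx_d Y n y) : dsum (n + 1)) = cx_d dsum n (0, y).
Proof. by congr pair; rewrite /= linear0. Qed.

Definition dsum_in2 : chmap Y dsum :=
  @Chmap Y dsum (fun n => mklin (@dsum_in2_linear n)) dsum_in2_d.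

Lemma dsum_pair_linear Z (f : chmap Z X) (g : chmap Z Y) n :
  linear (fun z : Z n => (f n z, g n z) : dsum n).
Proof. by move=> a u v; congr pair; rewrite /= linearP. Qed.

Lemma dsum_pair_d Z (f : chmap Z X) (g : chmap Z Y) n (z : Z n) :
  ((f _ (cx_d Z n z), g _ (cx_d Z n z)) : dsum (n + 1)) =
  cx_d dsum n (f n z, g n z).
Proof. by congr pair; rewrite /= cmap_d. Qed.

Definition dsum_pair Z (f : chmap Z X) (g : chmap Z Y) : chmap Z dsum :=
  @Chmap Z dsum (fun n => mklin (@dsum_pair_linear Z f g n)) (dsum_pair_d f g).

End DirectSum.

(* Completing a span Z <-s- Y -g-> V to a square commuting up to homotopy *)

Section HomotopyPushout.
Variables (Y Z V : complex) (s : chmap Y Z) (g : chmap Y V).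

Definition hpush : complex := cone (dsum_pair s (ch_opp g)).

Definition hpush1 : chmap Z hpush := ch_comp (cone_in _) (dsum_in1 Z V).
Definition hpush2 : chmap V hpush := ch_comp (cone_in _) (dsum_in2 Z V).

Lemma hpush_linear n : linear (fun y : Y (n + 1) => (y, 0) : hpush n).
Proof. by move=> a u v; congr pair; rewrite /= scaler0 addr0. Qed.

Lemma hpush_homotopic : homotopic (ch_comp hpush1 s) (ch_comp hpush2 g).
Proof.
exists (fun n => mklin (@hpush_linear n)) => n y /=.
congr pair; first by rewrite /= subr0 addNr.
congr pair; rewrite /= ?linear0 ?addr0 ?add0r ?subr0 //.
Qed.

Lemma hpush2_qis : qis s -> qis hpush2.
Proof.
move=> /qisP qs; apply/qisP; apply: int_succP => n; split.
  move=> v dv /is_boundaryS[[a [b c]]] [/= da db ->].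
  have {}da : cx_d Y _ a = 0 by rewrite -[LHS]opprK -da oppr0.
  have bsa : is_boundary (s _ a).
    suff -> : s _ a = cx_d Z _ (- b) by [].
    by rewrite linearN; apply/eqP; rewrite -addr_eq0 -db.
  have /is_boundaryS[a' ->] := (qs _).1 a da bsa.
  by rewrite cmap_d -linearN -linearD.
move=> [y [z v]] [/= dy dz dv].
have {}dy : cx_d Y _ y = 0 by rewrite -[LHS]opprK dy oppr0.
have bsy : is_boundary (s _ y).
  suff -> : s _ y = cx_d Z _ (- z) by [].
  by rewrite linearN; apply/eqP; rewrite -addr_eq0 dz.
have /is_boundaryS[a ya] := (qs _).1 y dy bsy.
have dz' : cx_d Z _ (s _ a + z) = 0 by rewrite linearD -cmap_d -ya dz.
have [b [db]] := (qs _).2 _ dz'.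
move=> /is_boundaryS[c cP].
exists (v + g _ (b - a)); split.
  rewrite [LHS](linearD (cx_d V _)) -cmap_d linearB /= db sub0r -ya linearN [LHS]addrC.
  by rewrite dv.
suff -> : (y, (z, v)) - hpush2 _ (v + g _ (b - a)) =
          cx_d hpush n (b - a, (c, 0)) by [].
congr pair => /=; first by rewrite subr0 linearB /= db sub0r opprK.
congr pair => /=.
  by rewrite subr0 -cP linearB; exact: zmod_shuffle.
by rewrite linear0 addr0 opprD addrA subrr add0r.
Qed.

End HomotopyPushout.

Definition hcomm Y Z V W (s : chmap Y Z) (g : chmap Y V)
    (a : chmap Z W) (b : chmap V W) :=
  homotopic (ch_comp a s) (ch_comp b g).

(* A map killed by precomposition with a quasi-isomorphism is killed by
   postcomposition with one. *)
Lemma qis_kill Y Z V (s : chmap Y Z) (f g : chmap Z V) :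
  qis s -> homotopic (ch_comp f s) (ch_comp g s) ->
  exists W (k : chmap V W), qis k /\ homotopic (ch_comp k f) (ch_comp k g).
Proof.
move=> qs [h hP].
pose ef n (p : cone s n) : V n := f n p.2 - g n p.2 + h n p.1.
have ef_linear n : linear (@ef n).
  move=> a [x y] [x' y']; rewrite /ef /= !linearP /=.
  by rewrite !scalerDr (addrACA (a *: f n y)) [LHS]addrACA.
have ef_d n (p : cone s n) : ef (n + 1) (cx_d (cone s) n p) = cx_d V n (ef n p).
  case: p => y z; rewrite /ef /= (linearN (h _)) !linearD /= (addrACA (f _ (s _ y))) hP.
  by rewrite [X in X - _]addrAC addrK linearN -!cmap_d [LHS]addrC.
pose e : chmap (cone s) V := Chmap (cmap := fun n => mklin (@ef_linear n)) ef_d.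
exists (cone e), (cone_in e); split.
  by apply: cone_in_qis; exact: cone_acyclic.
have k_linear n : linear (fun z : Z (n + 1) => ((0, z), 0) : cone e n).
  by move=> a u v; congr pair; rewrite /= ?scaler0 ?addr0 //; congr pair;
    rewrite /= ?scaler0 ?addr0.
exists (fun n => mklin (@k_linear n)) => n z; congr pair => /=.
  by rewrite subr0; congr pair; rewrite /= ?linear0 ?oppr0 ?add0r ?addNr ?addr0.
by rewrite /ef /= !linear0 !addr0.
Qed.

Lemma homotopy_square Y Z V (s : chmap Y Z) (g : chmap Y V) : qis s ->
  exists W (a : chmap Z W) (b : chmap V W), hcomm s g a b /\ qis b.
Proof.
by move=> qs; exists (hpush s g), (hpush1 s g), (hpush2 s g);
   split; [exact: hpush_homotopic | exact: hpush2_qis].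
Qed.

Lemma qis_compA X Y Z W (h : chmap Z W) (g : chmap Y Z) (f : chmap X Y) :
  qis (ch_comp (ch_comp h g) f) <-> qis (ch_comp h (ch_comp g f)).
Proof. by split; apply: qis_homotopic; exact: homotopic_eq. Qed.

Lemma square_unique Y Z V (s : chmap Y Z) (g : chmap Y V)
    W (a : chmap Z W) (b : chmap V W) W' (a' : chmap Z W') (b' : chmap V W') :
  qis s -> hcomm s g a b -> hcomm s g a' b' -> qis b -> qis b' ->
  exists Q (j : chmap W Q) (j' : chmap W' Q),
    [/\ homotopic (ch_comp j a) (ch_comp j' a'),
        homotopic (ch_comp j b) (ch_comp j' b') & qis (ch_comp j b)].
Proof.
move=> qs c c' qb qb'.
have [Q [j [j' [jb qj']]]] := homotopy_square b' qb.
have : homotopic (ch_comp (ch_comp j a) s) (ch_comp (ch_comp j' a') s).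
  apply: (homotopic_trans (homotopic_compr j c)).
  apply: (homotopic_trans (homotopic_compl g jb)).
  exact: (homotopic_compr j' (homotopic_sym c')).
move=> /(qis_kill qs)[Q' [k [qk kP]]].
have jb' := homotopic_compr k jb.
exists Q', (ch_comp k j), (ch_comp k j'); split=> //.
apply/qis_compA/(qis_homotopic (homotopic_sym jb')).
by apply: (qis_comp qk); exact: qis_comp.
Qed.

(* D(R) is the category of fractions of the homotopy category of complexes
   with respect to quasi-isomorphisms: a morphism X -> Y is a class of
   fractions den^-1 * num with den : Y -> apex a quasi-isomorphism, and two
   fractions are identified when they have a common refinement up to
   homotopy. *)
Record roof X Y := Roof {
  apex : complex;
  num : chmap X apex;
  den : chmap Y apex;
  den_qis : qis den }.

Definition roof_eqv X Y (r r' : roof X Y) : Prop :=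
  exists W (u : chmap (apex r) W) (u' : chmap (apex r') W),
    [/\ homotopic (ch_comp u (num r)) (ch_comp u' (num r')),
        homotopic (ch_comp u (den r)) (ch_comp u' (den r'))
      & qis (ch_comp u (den r))].

Lemma roof_eqv_refl X Y (r : roof X Y) : roof_eqv r r.
Proof.
exists (apex r), (ch_id _), (ch_id _); split; try exact: homotopic_refl.
exact: (qis_comp (qis_id _) (den_qis r)).
Qed.

Lemma roof_eqv_sym X Y (r r' : roof X Y) : roof_eqv r r' -> roof_eqv r' r.
Proof.
move=> [W [u [u' [hn hd q]]]]; exists W, u', u; split; try exact: homotopic_sym.
exact: qis_homotopic hd q.
Qed.

Lemma roof_eqv_trans X Y (r' r r'' : roof X Y) :
  roof_eqv r r' -> roof_eqv r' r'' -> roof_eqv r r''.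
Proof.
move=> [V [u [u' [un ud uq]]]] [V' [v [v' [vn vd vq]]]].
have qu' : qis u' by apply: qis_cancel (den_qis r'); exact: qis_homotopic ud uq.
have [W [a [b [c qb]]]] := homotopy_square v qu'.
exists W, (ch_comp a u), (ch_comp b v').
have step n n' n'' : homotopic (ch_comp u n) (ch_comp u' n') ->
    homotopic (ch_comp v n') (ch_comp v' n'') ->
    homotopic (ch_comp (ch_comp a u) n) (ch_comp (ch_comp b v') n'').
  move=> h1 h2; apply: (homotopic_trans (homotopic_compr a h1)).
  apply: (homotopic_trans (homotopic_compl n' c)).
  exact: (homotopic_compr b h2).
split.
- apply: (homotopic_trans (homotopic_compr a un)).
  apply: (homotopic_trans (homotopic_compl (num r') c)).
  exact: (homotopic_compr b vn).
- apply: (homotopic_trans (homotopic_compr a ud)).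
  apply: (homotopic_trans (homotopic_compl (den r') c)).
  exact: (homotopic_compr b vd).
have: qis (ch_comp b (ch_comp v (den r'))) by exact: qis_comp.
apply: qis_homotopic; apply: homotopic_sym.
apply: (homotopic_trans (homotopic_compr a ud)).
exact: (homotopic_compl (den r') c).
Qed.

Definition dhom X Y : Type := class_quot (@roof_eqv X Y).

Definition frac X Y Z (f : chmap X Z) (s : chmap Y Z) (qs : qis s) : dhom X Y :=
  class_of (@roof_eqv X Y) (Roof f qs).

Definition roof_class X Y (r : roof X Y) : dhom X Y := class_of (@roof_eqv X Y) r.
Definition dhom_repr X Y (h : dhom X Y) : roof X Y := class_repr h.

Lemma roof_class_eq X Y (r r' : roof X Y) :
  roof_eqv r r' -> roof_class r = roof_class r'.
Proof.
exact: (class_of_eq (@roof_eqv_sym X Y) (@roof_eqv_trans X Y)).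
Qed.

Lemma roof_class_repr X Y (r : roof X Y) : roof_eqv (dhom_repr (roof_class r)) r.
Proof. by apply: class_repr_of; exact: roof_eqv_refl. Qed.

Lemma dhom_reprK X Y (h : dhom X Y) : roof_class (dhom_repr h) = h.
Proof. exact: class_reprK. Qed.

Lemma fracP X Y (h : dhom X Y) :
  exists Z (f : chmap X Z) (s : chmap Y Z) (qs : qis s), h = frac f qs.
Proof.
rewrite -[h]dhom_reprK; case: (dhom_repr h) => Z f s qs.
by exists Z, f, s, qs.
Qed.

Lemma frac_eq X Y Z (f : chmap X Z) (s : chmap Y Z) (qs : qis s)
    Z' (f' : chmap X Z') (s' : chmap Y Z') (qs' : qis s')
    W (u : chmap Z W) (u' : chmap Z' W) :
  homotopic (ch_comp u f) (ch_comp u' f') ->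
  homotopic (ch_comp u s) (ch_comp u' s') -> qis (ch_comp u s) ->
  frac f qs = frac f' qs'.
Proof. by move=> h1 h2 h3; apply: roof_class_eq; exists W, u, u'. Qed.

Lemma frac_homotopic X Y Z (f f' : chmap X Z) (s s' : chmap Y Z)
    (qs : qis s) (qs' : qis s') :
  homotopic f f' -> homotopic s s' -> frac f qs = frac f' qs'.
Proof.
move=> hf hs; apply: (@frac_eq _ _ _ _ _ _ _ _ _ _ _ (ch_id Z) (ch_id Z)) => //.
exact: (qis_comp (qis_id Z) qs).
Qed.

Lemma frac_refine X Y Z (f : chmap X Z) (s : chmap Y Z) (qs : qis s)
    W (u : chmap Z W) (q : qis (ch_comp u s)) :
  frac f qs = frac (ch_comp u f) q.
Proof.
by apply: (@frac_eq _ _ _ _ _ _ _ _ _ _ _ u (ch_id W)) => //;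
  exact: homotopic_refl.
Qed.

Definition roof_comp X Y Z (q : roof Y Z) (r : roof X Y) : roof X Z :=
  Roof (ch_comp (hpush1 (den r) (num q)) (num r))
       (qis_comp (hpush2_qis (num q) (den_qis r)) (den_qis q)).

Definition dcomp X Y Z (q : dhom Y Z) (r : dhom X Y) : dhom X Z :=
  roof_class (roof_comp (dhom_repr q) (dhom_repr r)).

Lemma roof_compE X Y Z (q : roof Y Z) (r : roof X Y)
    W (a : chmap (apex r) W) (b : chmap (apex q) W)
    (qbt : qis (ch_comp b (den q))) :
  hcomm (den r) (num q) a b -> qis b ->
  roof_eqv (roof_comp q r) (Roof (ch_comp a (num r)) qbt).
Proof.
move=> c qb.
have [Q [j [j' [ja jb qj]]]] := square_unique (den_qis r)
  (hpush_homotopic (den r) (num q)) c (hpush2_qis (num q) (den_qis r)) qb.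
exists Q, j, j'; split.
- exact: (homotopic_compl (num r) ja).
- exact: (homotopic_compl (den q) jb).
exact/qis_compA/(qis_comp qj (den_qis q)).
Qed.

Lemma roof_eqv_homotopic X Y Z (f f' : chmap X Z) (s s' : chmap Y Z)
    (qs : qis s) (qs' : qis s') :
  homotopic f f' -> homotopic s s' -> roof_eqv (Roof f qs) (Roof f' qs').
Proof.
move=> hf hs; exists Z, (ch_id Z), (ch_id Z); split=> //.
exact: (qis_comp (qis_id Z) qs).
Qed.

Lemma roof_comp_eqvr X Y Z (q : roof Y Z) (r r' : roof X Y) :
  roof_eqv r r' -> roof_eqv (roof_comp q r) (roof_comp q r').
Proof.
move=> [V [u [u' [un ud uq]]]].
have [W [a [b [c qb]]]] := homotopy_square (num q) uq.
have qbt := qis_comp qb (den_qis q).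
apply: (@roof_eqv_trans _ _ (Roof (ch_comp (ch_comp a u) (num r)) qbt)).
  exact: roof_compE.
apply: (@roof_eqv_trans _ _ (Roof (ch_comp (ch_comp a u') (num r')) qbt)).
  by apply: roof_eqv_homotopic; [exact: (homotopic_compr a un)
                                | exact: homotopic_refl].
apply: roof_eqv_sym; apply: roof_compE => //.
exact: (homotopic_trans (homotopic_compr a (homotopic_sym ud)) c).
Qed.

Lemma roof_comp_eqvl X Y Z (q q' : roof Y Z) (r : roof X Y) :
  roof_eqv q q' -> roof_eqv (roof_comp q r) (roof_comp q' r).
Proof.
move=> [V [v [v' [vn vd vq]]]].
have qv := qis_cancel vq (den_qis q).
have vq' := qis_homotopic vd vq; have qv' := qis_cancel vq' (den_qis q').
have [W [a [b [c qb]]]] := homotopy_square (ch_comp v (num q)) (den_qis r).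
have /qis_compA q1 := qis_comp qb vq; have /qis_compA q2 := qis_comp qb vq'.
apply: (@roof_eqv_trans _ _
    (@Roof _ _ _ (ch_comp a (num r)) (ch_comp (ch_comp b v) (den q)) q1)).
  by apply: roof_compE => //; exact: qis_comp.
apply: (@roof_eqv_trans _ _
    (@Roof _ _ _ (ch_comp a (num r)) (ch_comp (ch_comp b v') (den q')) q2)).
  apply: roof_eqv_homotopic; first exact: homotopic_refl.
  exact: (homotopic_compr b vd).
apply: roof_eqv_sym; apply: roof_compE; last exact: qis_comp.
exact: (homotopic_trans c (homotopic_compr b vn)).
Qed.

Lemma frac_comp X Y Z V V' (f : chmap X V) (s : chmap Y V) (qs : qis s)
    (g : chmap Y V') (t : chmap Z V') (qt : qis t)
    W (a : chmap V W) (b : chmap V' W) (qbt : qis (ch_comp b t)) :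
  hcomm s g a b -> qis b ->
  dcomp (frac g qt) (frac f qs) = frac (ch_comp a f) qbt.
Proof.
move=> c qb; apply: roof_class_eq.
apply: (roof_eqv_trans (roof_comp_eqvr _ (roof_class_repr _))).
apply: (roof_eqv_trans (roof_comp_eqvl _ (roof_class_repr _))).
exact: (@roof_compE _ _ _ (Roof g qt) (Roof f qs)).
Qed.

Definition dmap X Y (f : chmap X Y) : dhom X Y := frac f (qis_id Y).

Definition did X : dhom X X := dmap (ch_id X).

Lemma dcomp1m X Y (f : dhom X Y) : dcomp (did Y) f = f.
Proof.
have [Z [n [s [qs ->]]]] := fracP f.
rewrite (@frac_comp _ _ _ _ _ _ _ _ _ _ _ _ (ch_id Z) s
  (qis_comp qs (qis_id Y))) //; last exact: homotopic_eq.
by apply: frac_homotopic; exact: homotopic_eq.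
Qed.

Lemma dcompm1 X Y (f : dhom X Y) : dcomp f (did X) = f.
Proof.
have [Z [n [s [qs ->]]]] := fracP f.
rewrite (@frac_comp _ _ _ _ _ _ _ _ _ _ _ _ n (ch_id Z)
  (qis_comp (qis_id Z) qs)); last 2 first.
- exact: homotopic_eq.
- exact: qis_id.
by apply: frac_homotopic; exact: homotopic_eq.
Qed.

Lemma dcompA X Y Z W (h : dhom Z W) (g : dhom Y Z) (f : dhom X Y) :
  dcomp h (dcomp g f) = dcomp (dcomp h g) f.
Proof.
have [U1 [n1 [d1 [q1 ->]]]] := fracP f.
have [U2 [n2 [d2 [q2 ->]]]] := fracP g.
have [U3 [n3 [d3 [q3 ->]]]] := fracP h.
have [V [a [b [ab qb]]]] := homotopy_square n2 q1.
have qbd2 := qis_comp qb q2.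
have [V' [c [e [ce qe]]]] := homotopy_square n3 qbd2.
have qed3 := qis_comp qe q3.
rewrite (@frac_comp _ _ _ _ _ _ _ _ _ _ _ _ a b qbd2) //.
rewrite (@frac_comp _ _ _ _ _ _ _ _ _ _ _ _ c e qed3) //.
rewrite (@frac_comp _ _ _ _ _ _ _ _ _ _ _ _ (ch_comp c b) e qed3) //.
rewrite (@frac_comp _ _ _ _ _ _ _ _ _ _ _ _ (ch_comp c a) (ch_id V')
  (qis_comp (qis_id V') qed3)); last 2 first.
- exact: (homotopic_compr c ab).
- exact: qis_id.
by apply: frac_homotopic; exact: homotopic_eq.
Qed.

Definition roof_add X Y (r r' : roof X Y) : roof X Y :=
  Roof (ch_add (ch_comp (hpush1 (den r) (den r')) (num r))
               (ch_comp (hpush2 (den r) (den r')) (num r')))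
       (qis_comp (hpush2_qis (den r') (den_qis r)) (den_qis r')).

Definition dadd X Y (h h' : dhom X Y) : dhom X Y :=
  roof_class (roof_add (dhom_repr h) (dhom_repr h')).

Lemma roof_addE X Y (r r' : roof X Y)
    W (a : chmap (apex r) W) (b : chmap (apex r') W)
    (qbt : qis (ch_comp b (den r'))) :
  hcomm (den r) (den r') a b -> qis b ->
  roof_eqv (roof_add r r')
    (Roof (ch_add (ch_comp a (num r)) (ch_comp b (num r'))) qbt).
Proof.
move=> c qb.
have [Q [j [j' [ja jb qj]]]] := square_unique (den_qis r)
  (hpush_homotopic (den r) (den r')) c (hpush2_qis (den r') (den_qis r)) qb.
have distr A B (k : chmap A Q) (u v : chmap B A) :
    homotopic (ch_comp k (ch_add u v)) (ch_add (ch_comp k u) (ch_comp k v)).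
  by apply: homotopic_eq => n x /=; rewrite linearD.
exists Q, j, j'; split.
- apply: (homotopic_trans (distr _ _ j _ _)).
  apply: (homotopic_trans _ (homotopic_sym (distr _ _ j' _ _))).
  by apply: homotopic_add; [exact: (homotopic_compl (num r) ja)
                           |exact: (homotopic_compl (num r') jb)].
- exact: (homotopic_compl (den r') jb).
exact/qis_compA/(qis_comp qj (den_qis r')).
Qed.

Lemma roof_add_eqvl X Y (r r' q : roof X Y) :
  roof_eqv r r' -> roof_eqv (roof_add r q) (roof_add r' q).
Proof.
move=> [V [u [u' [un ud uq]]]].
have [W [a [b [c qb]]]] := homotopy_square (den q) uq.
have qbt := qis_comp qb (den_qis q).
apply: (@roof_eqv_trans _ _ (Roof (ch_add (ch_comp (ch_comp a u) (num r))
                                          (ch_comp b (num q))) qbt)).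
  exact: roof_addE.
apply: (@roof_eqv_trans _ _ (Roof (ch_add (ch_comp (ch_comp a u') (num r'))
                                          (ch_comp b (num q))) qbt)).
  apply: roof_eqv_homotopic; last exact: homotopic_refl.
  apply: homotopic_add; last exact: homotopic_refl.
  exact: (homotopic_compr a un).
apply: roof_eqv_sym; apply: roof_addE => //.
exact: (homotopic_trans (homotopic_compr a (homotopic_sym ud)) c).
Qed.

Lemma roof_add_eqvr X Y (r q q' : roof X Y) :
  roof_eqv q q' -> roof_eqv (roof_add r q) (roof_add r q').
Proof.
move=> [V [v [v' [vn vd vq]]]].
have qv := qis_cancel vq (den_qis q).
have vq' := qis_homotopic vd vq; have qv' := qis_cancel vq' (den_qis q').
have [W [a [b [c qb]]]] := homotopy_square (ch_comp v (den q)) (den_qis r).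
have /qis_compA q1 := qis_comp qb vq; have /qis_compA q2 := qis_comp qb vq'.
apply: (@roof_eqv_trans _ _
    (@Roof _ _ _ (ch_add (ch_comp a (num r)) (ch_comp (ch_comp b v) (num q)))
      (ch_comp (ch_comp b v) (den q)) q1)).
  by apply: roof_addE => //; exact: qis_comp.
apply: (@roof_eqv_trans _ _
    (@Roof _ _ _ (ch_add (ch_comp a (num r)) (ch_comp (ch_comp b v') (num q')))
      (ch_comp (ch_comp b v') (den q')) q2)).
  apply: roof_eqv_homotopic; last exact: (homotopic_compr b vd).
  apply: homotopic_add; first exact: homotopic_refl.
  exact: (homotopic_compr b vn).
apply: roof_eqv_sym; apply: roof_addE; last exact: qis_comp.
exact: (homotopic_trans c (homotopic_compr b vd)).
Qed.

Lemma frac_add X Y Z (f g : chmap X Z) (s : chmap Y Z) (qs : qis s) :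
  dadd (frac f qs) (frac g qs) = frac (ch_add f g) qs.
Proof.
apply: roof_class_eq.
apply: (roof_eqv_trans (roof_add_eqvr _ (roof_class_repr _))).
apply: (roof_eqv_trans (roof_add_eqvl _ (roof_class_repr _))).
apply: (roof_eqv_trans (@roof_addE _ _ (Roof f qs) (Roof g qs) _
  (ch_id Z) (ch_id Z) (qis_comp (qis_id Z) qs) (homotopic_refl _) (qis_id Z))).
by apply: roof_eqv_homotopic; exact: homotopic_eq.
Qed.

Lemma frac_common2 X X' Y (h : dhom X Y) (k : dhom X' Y) :
  exists Z (f : chmap X Z) (g : chmap X' Z) (s : chmap Y Z) (qs : qis s),
    h = frac f qs /\ k = frac g qs.
Proof.
have [V [f [s [qs ->]]]] := fracP h; have [V' [g [t [qt ->]]]] := fracP k.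
have [W [a [b [c qb]]]] := homotopy_square t qs.
have qbt := qis_comp qb qt.
have qas := qis_homotopic (homotopic_sym c) qbt.
exists W, (ch_comp a f), (ch_comp b g), (ch_comp b t), qbt; split.
  rewrite (@frac_refine _ _ _ _ _ _ _ a qas).
  by apply: frac_homotopic => //; exact: homotopic_refl.
exact: frac_refine.
Qed.

Lemma frac_common3 X Y (h k l : dhom X Y) :
  exists Z (f g e : chmap X Z) (s : chmap Y Z) (qs : qis s),
    [/\ h = frac f qs, k = frac g qs & l = frac e qs].
Proof.
have [V [f [g [s [qs [-> ->]]]]]] := frac_common2 h k.
have [V' [e [t [qt ->]]]] := fracP l.
have [W [a [b [c qb]]]] := homotopy_square t qs.
have qbt := qis_comp qb qt.
have qas := qis_homotopic (homotopic_sym c) qbt.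
exists W, (ch_comp a f), (ch_comp a g), (ch_comp b e), (ch_comp b t), qbt.
split; last exact: frac_refine.
  rewrite (@frac_refine _ _ _ _ _ _ _ a qas).
  by apply: frac_homotopic => //; exact: homotopic_refl.
rewrite (@frac_refine _ _ _ _ _ _ _ a qas).
by apply: frac_homotopic => //; exact: homotopic_refl.
Qed.

Definition dzero X Y : dhom X Y := dmap (ch_zero X Y).

Lemma frac_zero X Y Z (s : chmap Y Z) (qs : qis s) :
  frac (ch_zero X Z) qs = dzero X Y.
Proof.
rewrite /dzero /dmap (@frac_refine _ _ _ _ _ _ _ s (qis_comp qs (qis_id Y))).
apply: frac_homotopic; last exact: homotopic_eq.
by apply: homotopic_eq => n x /=; rewrite linear0.
Qed.

Definition dopp X Y (h : dhom X Y) : dhom X Y :=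
  frac (ch_opp (num (dhom_repr h))) (den_qis (dhom_repr h)).

Lemma frac_opp X Y Z (f : chmap X Z) (s : chmap Y Z) (qs : qis s) :
  dopp (frac f qs) = frac (ch_opp f) qs.
Proof.
rewrite /dopp; have := roof_class_repr (Roof f qs); rewrite -/(frac f qs).
case: (dhom_repr _) => Z' f' s' qs' [W [u [u' [/= un ud uq]]]].
apply: (frac_eq _ _ _ ud uq) => //.
have op A B (k : chmap B W) (v : chmap A B) :
    homotopic (ch_comp k (ch_opp v)) (ch_opp (ch_comp k v)).
  by apply: homotopic_eq => n x /=; rewrite linearN.
apply: (homotopic_trans (op _ _ u _)).
apply: (homotopic_trans _ (homotopic_sym (op _ _ u' _))).
exact: homotopic_opp.
Qed.

Lemma daddA X Y : associative (@dadd X Y).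
Proof.
move=> h k l; have [Z [f [g [e [s [qs [-> -> ->]]]]]]] := frac_common3 h k l.
rewrite !frac_add; apply: frac_homotopic; last exact: homotopic_refl.
by apply: homotopic_eq => n x /=; rewrite addrA.
Qed.

Lemma daddC X Y : commutative (@dadd X Y).
Proof.
move=> h k; have [Z [f [g [s [qs [-> ->]]]]]] := frac_common2 h k.
rewrite !frac_add; apply: frac_homotopic; last exact: homotopic_refl.
by apply: homotopic_eq => n x /=; rewrite addrC.
Qed.

Lemma dadd0 X Y : left_id (dzero X Y) (@dadd X Y).
Proof.
move=> h; have [Z [f [s [qs ->]]]] := fracP h; rewrite -(frac_zero _ qs).
rewrite !frac_add; apply: frac_homotopic; last exact: homotopic_refl.
by apply: homotopic_eq => n x /=; rewrite add0r.
Qed.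

Lemma daddN X Y : left_inverse (dzero X Y) (@dopp X Y) (@dadd X Y).
Proof.
move=> h; have [Z [f [s [qs ->]]]] := fracP h; rewrite -(frac_zero _ qs).
rewrite frac_opp frac_add; apply: frac_homotopic; last exact: homotopic_refl.
by apply: homotopic_eq => n x /=; rewrite addNr.
Qed.

Definition dhom_ab X Y : abgroup :=
  Abgroup (@daddA X Y) (@daddC X Y) (@dadd0 X Y) (@daddN X Y).

Lemma dcompDr X Y Z (q : dhom Y Z) (h h' : dhom X Y) :
  dcomp q (dadd h h') = dadd (dcomp q h) (dcomp q h').
Proof.
have [V [f [f' [s [qs [-> ->]]]]]] := frac_common2 h h'.
have [V' [g [t [qt ->]]]] := fracP q.
have [W [a [b [c qb]]]] := homotopy_square g qs.
have qbt := qis_comp qb qt.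
rewrite frac_add !(@frac_comp _ _ _ _ _ _ _ _ _ _ _ _ a b qbt) // frac_add.
apply: frac_homotopic; last exact: homotopic_refl.
by apply: homotopic_eq => n x /=; rewrite linearD.
Qed.

Lemma dcompDl X Y Z (q q' : dhom Y Z) (h : dhom X Y) :
  dcomp (dadd q q') h = dadd (dcomp q h) (dcomp q' h).
Proof.
have [V [f [s [qs ->]]]] := fracP h.
have [V' [g [g' [t [qt [-> ->]]]]]] := frac_common2 q q'.
have [U [a [b [c qb]]]] := homotopy_square g qs.
have [W [a' [b' [c' qb']]]] := homotopy_square (ch_comp b g') qs.
have qbb := qis_comp qb' qb; have qbt := qis_comp qbb qt.
have cg : hcomm s g (ch_comp b' a) (ch_comp b' b) by exact: (homotopic_compr b' c).
have cgg : hcomm s (ch_add g g') (ch_add (ch_comp b' a) a') (ch_comp b' b).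
  apply: (@homotopic_trans _ _ _
    (ch_add (ch_comp (ch_comp b' a) s) (ch_comp a' s))).
    exact: homotopic_eq.
  apply: (homotopic_trans (homotopic_add cg c')).
  by apply: homotopic_eq => n x /=; rewrite !linearD.
rewrite frac_add (frac_comp f qs qt qbt cg qbb).
rewrite (@frac_comp _ _ _ _ _ f _ qs g' _ qt _ a' _ qbt c' qbb).
rewrite (frac_comp f qs qt qbt cgg qbb) frac_add.
apply: frac_homotopic; last exact: homotopic_refl.
exact: homotopic_eq.
Qed.

Definition derived : preadditive :=
  @Preadditive complex dhom_ab did dcomp dcompA dcomp1m dcompm1
    (fun X Y Z f g g' => dcompDl g g' f) (fun X Y Z g f f' => dcompDr g f f').

Lemma shift_dd X n (x : X (n + 1)) :
  - cx_d X (n + 1 + 1) (- cx_d X (n + 1) x) = 0.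
Proof. by rewrite linearN opprK cx_dd. Qed.

Definition shift X : complex :=
  @Complex (fun n => X (n + 1))
    (fun n => \- cx_d X (n + 1) : {linear X (n + 1) -> X (n + 1 + 1)})
    (@shift_dd X).

Lemma ch_shift_d X Y (f : chmap X Y) n (x : X (n + 1)) :
  f (n + 1 + 1) (- cx_d X (n + 1) x) = - cx_d Y (n + 1) (f (n + 1) x).
Proof. by rewrite linearN cmap_d. Qed.

Definition ch_shift X Y (f : chmap X Y) : chmap (shift X) (shift Y) :=
  @Chmap (shift X) (shift Y) (fun n => f (n + 1)) (ch_shift_d f).

Lemma is_boundary_shift X n (x : X (n + 1)) :
  @is_boundary (shift X) n x <-> is_boundary x.
Proof.
split.
  move=> b; case: b => m y /=; apply: is_boundaryN; constructor.
move: n x; apply: int_succP => n x /is_boundaryS[y ->].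
have -> : cx_d X (n + 1) y = cx_d (shift X) n (- y) by rewrite /= linearN opprK.
exact: (@IsBoundary (shift X) n (- y)).
Qed.

Lemma qis_shift X Y (f : chmap X Y) : qis f -> qis (ch_shift f).
Proof.
move=> /qisP qf; apply/qisP => n; split=> [x dx /is_boundary_shift b|y dy].
  apply/is_boundary_shift; apply: (qf _).1 => //.
  by rewrite -[LHS]opprK [X in - X]dx oppr0.
have [x [dx b]] := (qf (n + 1)).2 y (etrans (esym (opprK _)) (etrans (congr1 -%R dy) (oppr0 _))).
exists x; split; first by rewrite /= dx oppr0.
exact/is_boundary_shift.
Qed.

Lemma homotopic_shift X Y (f g : chmap X Y) :
  homotopic f g -> homotopic (ch_shift f) (ch_shift g).
Proof.
move=> [h hP]; exists (fun n => \- h (n + 1) : {linear _ -> _}) => n x /=.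
by rewrite hP !linearN !opprK.
Qed.

Definition dshift X Y (h : dhom X Y) : dhom (shift X) (shift Y) :=
  frac (ch_shift (num (dhom_repr h))) (qis_shift (den_qis (dhom_repr h))).

Lemma frac_shift X Y Z (f : chmap X Z) (s : chmap Y Z) (qs : qis s) :
  dshift (frac f qs) = frac (ch_shift f) (qis_shift qs).
Proof.
rewrite /dshift; have := roof_class_repr (Roof f qs); rewrite -/(frac f qs).
case: (dhom_repr _) => Z' f' s' qs' [W [u [u' [/= un ud uq]]]].
apply: (@frac_eq _ _ _ _ _ _ _ _ _ _ _ (ch_shift u) (ch_shift u')).
- exact: (homotopic_shift un).
- exact: (homotopic_shift ud).
by apply: (qis_homotopic _ (qis_shift uq)); exact: homotopic_eq.
Qed.

Lemma dshift1 X : dshift (did X) = did (shift X).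
Proof.
by rewrite frac_shift; apply: frac_homotopic; exact: homotopic_eq.
Qed.

Lemma dshift_comp X Y Z (g : dhom Y Z) (f : dhom X Y) :
  dshift (dcomp g f) = dcomp (dshift g) (dshift f).
Proof.
have [U1 [n1 [d1 [q1 ->]]]] := fracP f.
have [U2 [n2 [d2 [q2 ->]]]] := fracP g.
have [V [a [b [ab qb]]]] := homotopy_square n2 q1.
have qbd2 := qis_comp qb q2.
rewrite (@frac_comp _ _ _ _ _ _ _ _ _ _ _ _ a b qbd2) // !frac_shift.
rewrite (@frac_comp _ _ _ _ _ _ _ _ _ _ _ _ (ch_shift a) (ch_shift b)
  (qis_comp (qis_shift qb) (qis_shift q2))); last 2 first.
- exact: (homotopic_shift ab).
- exact: qis_shift.
by apply: frac_homotopic; exact: homotopic_eq.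
Qed.

Lemma dshiftD X Y (h k : dhom X Y) :
  dshift (dadd h k) = dadd (dshift h) (dshift k).
Proof.
have [V [f [f' [s [qs [-> ->]]]]]] := frac_common2 h k.
by rewrite frac_add !frac_shift frac_add; apply: frac_homotopic;
  exact: homotopic_eq.
Qed.

Lemma cone_out_linear X Y (f : chmap X Y) n :
  linear (fun p : cone f n => p.1 : shift X n).
Proof. by []. Qed.

Definition cone_out X Y (f : chmap X Y) : chmap (cone f) (shift X) :=
  @Chmap (cone f) (shift X) (fun n => mklin (@cone_out_linear X Y f n))
    (fun n x => erefl).

(* The triangles isomorphic in D(R) to A --f--> B --> cone f --> shift A for
   some map of complexes f *)
Definition distinguished (X Y Z : derived)
    (u : hom X Y) (v : hom Y Z) (w : hom Z (shift X)) : Prop :=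
  exists (A B : complex) (f : chmap A B)
    (a : hom X (A : derived)) (b : hom Y (B : derived))
    (c : hom Z (cone f : derived)),
    [/\ isomorphism a, isomorphism b & isomorphism c] /\
    [/\ compm b u = compm (dmap f : hom (A : derived) B) a,
        compm c v = compm (dmap (cone_in f) : hom (B : derived) (cone f)) b &
        compm (dshift a : hom (shift X : derived) (shift A)) w =
        compm (dmap (cone_out f) : hom (cone f : derived) (shift A)) c].

End Complexes.

Local Open Scope classical_set_scope.

Section FullSubcategory.
Variables (C : preadditive) (P : C -> Prop).

Definition full_sub : preadditive :=
  @Preadditive {X : C | P X} (fun X Y => hom (sval X) (sval Y))
    (fun X => idm (sval X)) (fun X Y Z g f => compm g f)
    (fun X Y Z W h g f => compA h g f) (fun X Y f => comp1m f)
    (fun X Y f => compm1 f) (fun X Y Z f => @compDl C _ _ (sval Z) f)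
    (fun X Y Z g => @compDr C (sval X) _ _ g).

End FullSubcategory.

Section DerivedSubcategories.
Variable R : pzRingType.
Local Notation D := (derived R).

(* The data (P, E, s) carried by a full subcategory P of D(R), meant for
   extension-closed P: E(X, Y) = Hom_D(R)(X, Sigma Y), and eta is realized by
   Y -> Z -> X when Y -> Z -> X --eta--> Sigma Y is distinguished. *)
Definition full_extri (P : D -> Prop) : extri :=
  @Extri (full_sub P)
    (fun A B => hom (sval A) (shift (sval B) : D))
    (fun A B B' b eta => dcomp (dshift b) eta)
    (fun A A' B eta a => dcomp eta a)
    (fun A B eta => etrans (congr1 (@dcomp _ _ _ _ ^~ eta) (dshift1 _))
                           (dcomp1m eta))
    (fun A B B' B'' b' b eta =>
       etrans (congr1 (@dcomp _ _ _ _ ^~ eta) (dshift_comp b' b))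
              (esym (dcompA _ _ _)))
    (fun A B eta => dcompm1 eta)
    (fun A A' A'' B eta a a' => dcompA eta a a')
    (fun A A' B B' b a eta => esym (dcompA _ _ _))
    (fun A B B' eta b b' =>
       etrans (congr1 (@dcomp _ _ _ _ ^~ eta) (dshiftD b b'))
              (dcompDl _ _ _))
    (fun A B B' b eta eta' => dcompDr _ eta eta')
    (fun A A' B a eta eta' => dcompDl eta eta' a)
    (fun A A' B eta a a' => dcompDr eta a a')
    (fun A B Z eta f g => distinguished f g eta).

Definition Dle (n : int) (X : D) : Prop :=
  forall m, n < m -> forall c : cohomology X m, c = 0.

Definition Dge (n : int) (X : D) : Prop :=
  forall m, m < n -> forall c : cohomology X m, c = 0.

Definition shift_class (P : D -> Prop) (X : D) : Prop :=
  exists Y : D, P Y /\ isomorphic X (shift Y : D).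

(* The pair of subcategories (U, W) of a t-structure *)
Record tstr := Tstr { aisle : D -> Prop; coaisle : D -> Prop }.

Definition heart (x : tstr) : extri :=
  full_extri (fun X => aisle x X /\ coaisle x X).

Definition co_smashing (x : tstr) : Prop :=
  forall (J : Type) (X : J -> D) (P : product X),
    (forall j, aisle x (X j)) -> aisle x P.

Section IdealTorsionPair.
Variable I : set R.

Definition ideal_mul (M : lmodType R) : set M :=
  [set x | exists (n : nat) (a : 'I_n -> R) (m : 'I_n -> M),
     (forall k, I (a k)) /\ x = \sum_(k < n) a k *: m k].
Arguments ideal_mul : clear implicits.

Definition torsion_class (M : lmodType R) : Prop := ideal_mul M = setT.
Definition torsionfree_class (M : lmodType R) : Prop := ideal_mul M = [set 0].

Definition HRS_tilt : tstr := {|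
  aisle := fun X => Dle 0 X /\ torsion_class (cohomology X 0);
  coaisle := fun X => shift_class (Dge 0) X /\
                      torsionfree_class (cohomology X (-1)) |}.

End IdealTorsionPair.
End DerivedSubcategories.

Definition prodZ2 : pzRingType := (nat -> 'Z_2)%type.

Definition prodZ2_factor (j : nat) : set prodZ2 :=
  [set x | forall i, i != j -> x i = 0].

Definition sumZ2 : set prodZ2 :=
  [set x | exists (n : nat) (r : nat -> prodZ2),
     (forall j, prodZ2_factor j (r j)) /\ x = \sum_(j < n) r j].

Lemma prodZ2_sumE n (r : nat -> prodZ2) i :
  (\sum_(j < n) r j) i = \sum_(j < n) r j i.
Proof. by elim/big_ind2: _ => // _ a _ b <- <-. Qed.

Lemma sumZ2P x : sumZ2 x <-> exists n, forall i, (n <= i)%N -> x i = 0.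
Proof.
split=> [[n [r [rj ->]]]|[n x0]].
  exists n => i ni; rewrite prodZ2_sumE big1 // => j _; apply: rj.
  by rewrite gtn_eqF // (leq_trans _ ni).
pose r j : prodZ2 := fun i => if i == j then x i else 0.
exists n, r; split; first by move=> j i /negPf ij; rewrite /r ij.
apply/funext => i; rewrite (prodZ2_sumE n r) {}/r.
have [ni|i_n] := leqP n i.
  rewrite x0 // big1 // => j _.
  by rewrite gtn_eqF // (leq_trans _ ni).
rewrite (bigD1 (Ordinal i_n)) //= eqxx big1 ?addr0 // => j.
by rewrite -val_eqE eq_sym /= => /negPf ->.
Qed.

(* Main.v *)
(* Every module C with IC = C is a direct sum of copies of the R_i, hence
   projective and semisimple. So an object X of the heart, with IH^0(X) = H^0(X)
   and IH^-1(X) = 0, splits as IX + X/IX, the two kinds of summands are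
   orthogonal (up to one shift in the relevant directions), and E(X, Y) is an
   Ext^1 between the torsion-free parts. Consequently F(Y_j) = I prod_j Y_j +
   prod_j Y_j/IY_j is a product in the heart and
   E(A, F(Y_j)) = prod_j E(A, Y_j), so condition (2) determines Gamma and forces
   its naturality. As F is an exact functor on families of complexes commuting
   with cones, the F-image of a family of triangles is a triangle, which gives
   (1). On the other hand, products in D(R) are computed termwise, and
   I (prod_j I) is different from prod_j I. *)
From HB Require Import structures.
From mathcomp Require Import all_boot all_order all_algebra.
From mathcomp Require Import zify all_classical.
Require Import Defs.

Set Implicit Arguments.
Unset Strict Implicit.
Unset Printing Implicit Defensive.

Import Order.TTheory GRing.Theory Num.Theory.

Local Open Scope ring_scope.

(** * Products and subcomplexes *)


(** Morphisms of D(R) are fractions and no resolutions are used, so a Hom-group is shown to vanish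
    by working on numerators, in one of two ways. If every term of the source is fixed by I, a
    numerator that is zero on cohomology is null-homotopic. If source and target have cohomology
    only in degrees <= -1 and >= -1 respectively, truncating the source makes the numerator factor
    through an acyclic complex. The first way handles maps out of IX, the second maps out of X/IX.
    Orthogonality holds in both directions because idempotents generate I: they act as local units
    on modules in C_I and as zero on those in T_I. The termwise product can leave the heart only
    through H^0. Replacing its I part by the coreflection M -> IM repairs this, and no extension
    group changes, since objects of the heart have no nonzero map to Sigma IY. The projections of F
    use splittings that are merely chosen; it is again orthogonality that makes them natural. *)

Section Dprod.
Variables (R : pzRingType) (J : Type) (M : J -> lmodType R).

Definition dprod := forall j, M j.

HB.instance Definition _ := Choice.on dprod.

Implicit Types x y z : dprod.

Definition dprod_zero : dprod := fun=> 0.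
Definition dprod_opp x : dprod := fun j => - x j.
Definition dprod_add x y : dprod := fun j => x j + y j.

Lemma dprod_addA : associative dprod_add.
Proof. by move=> x y z; apply/functional_extensionality_dep => j; exact: addrA. Qed.
Lemma dprod_addC : commutative dprod_add.
Proof. by move=> x y; apply/functional_extensionality_dep => j; exact: addrC. Qed.
Lemma dprod_add0 : left_id dprod_zero dprod_add.
Proof. by move=> x; apply/functional_extensionality_dep => j; exact: add0r. Qed.
Lemma dprod_addN : left_inverse dprod_zero dprod_opp dprod_add.
Proof. by move=> x; apply/functional_extensionality_dep => j; exact: addNr. Qed.

HB.instance Definition _ := GRing.isZmodule.Build dprod
  dprod_addA dprod_addC dprod_add0 dprod_addN.

Definition dprod_scale (a : R) x : dprod := fun j => a *: x j.

Lemma dprod_scaleA a b x : dprod_scale a (dprod_scale b x) = dprod_scale (a * b) x.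
Proof. by apply/functional_extensionality_dep => j; rewrite /dprod_scale scalerA. Qed.
Lemma dprod_scale1 : left_id 1 dprod_scale.
Proof. by move=> x; apply/functional_extensionality_dep => j; rewrite /dprod_scale scale1r. Qed.
Lemma dprod_scaleDr : right_distributive dprod_scale +%R.
Proof.
by move=> a x y; apply/functional_extensionality_dep => j; rewrite /dprod_scale scalerDr.
Qed.
Lemma dprod_scaleDl x : {morph dprod_scale^~ x : a b / a + b}.
Proof. by move=> a b; apply/functional_extensionality_dep => j; rewrite /dprod_scale scalerDl. Qed.

HB.instance Definition _ := GRing.Zmodule_isLmodule.Build R dprod
  dprod_scaleA dprod_scale1 dprod_scaleDr dprod_scaleDl.

End Dprod.

Section Constructions.
Variable R : pzRingType.
Implicit Types X Y Z : complex R.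

Lemma homotopicP X Y (f g : chmap X Y) (h : forall n, X (n + 1) -> Y n) :
  (forall n, linear (h n)) ->
  (forall n x, f (n + 1) x - g (n + 1) x =
     cx_d Y n (h n x) + h (n + 1) (cx_d X (n + 1) x)) ->
  homotopic f g.
Proof. by move=> lh hP; exists (fun n => mklin (lh n)). Qed.

Lemma boundaryS X n (x : X (n + 1)) y : x = cx_d X n y -> is_boundary x.
Proof. by move=> ->; constructor. Qed.

(** Makes a termwise isomorphism invertible in D(R) without building the inverse chain map. *)
Lemma bijective_qis X Y (f : chmap X Y) :
  (forall n, injective (f n)) -> (forall n y, exists x, f n x = y) -> qis f.
Proof.
move=> fI fS; apply/qisP; apply: int_succP => n; split=> [x dx|y dy].
  move=> /is_boundaryS[y]; have [y' <-] := fS _ y; rewrite -cmap_d => /fI ->.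
  by constructor.
have [x xy] := fS _ y; exists x; rewrite xy subrr; split; last exact: is_boundary0.
by apply: fI; rewrite cmap_d xy dy linear0.
Qed.

Section DirectSumProjections.
Variables X Y : complex R.

Lemma dsum_pr1_linear n : linear (fun p : dsum X Y n => p.1).
Proof. by []. Qed.

Lemma dsum_pr2_linear n : linear (fun p : dsum X Y n => p.2).
Proof. by []. Qed.

Definition dsum_pr1 : chmap (dsum X Y) X :=
  @Chmap _ (dsum X Y) X (fun n => mklin (@dsum_pr1_linear n)) (fun n x => erefl).

Definition dsum_pr2 : chmap (dsum X Y) Y :=
  @Chmap _ (dsum X Y) Y (fun n => mklin (@dsum_pr2_linear n)) (fun n x => erefl).

End DirectSumProjections.

Section ProductComplex.
Variables (J : Type) (X : J -> complex R).

Definition pc_obj n : lmodType R := dprod (fun j => X j n).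

Lemma pc_d_linear n :
  linear (fun x : pc_obj n => (fun j => cx_d (X j) n (x j)) : pc_obj (n + 1)).
Proof. by move=> a u v; apply/functional_extensionality_dep => j; rewrite linearP. Qed.

Lemma pc_dd n x : mklin (@pc_d_linear (n + 1)) (mklin (@pc_d_linear n) x) = 0.
Proof. by apply/functional_extensionality_dep => j; rewrite /= cx_dd. Qed.

Definition prodc : complex R := Complex pc_dd.

Lemma pc_proj_linear j n : linear (fun x : prodc n => x j : X j n).
Proof. by []. Qed.

Definition pc_proj j : chmap prodc (X j) :=
  @Chmap _ prodc (X j) (fun n => mklin (@pc_proj_linear j n)) (fun n x => erefl).

Variables (Y : complex R) (f : forall j, chmap Y (X j)).

Lemma pc_tuple_linear n : linear (fun y : Y n => (fun j => f j n y) : prodc n).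
Proof. by move=> a u v; apply/functional_extensionality_dep => j; rewrite linearP. Qed.

Lemma pc_tuple_d n (y : Y n) :
  mklin (@pc_tuple_linear (n + 1)) (cx_d Y n y) =
  cx_d prodc n (mklin (@pc_tuple_linear n) y).
Proof. by apply/functional_extensionality_dep => j; rewrite /= cmap_d. Qed.

Definition pc_tuple : chmap Y prodc := Chmap pc_tuple_d.

End ProductComplex.

Definition pc_map J (X Y : J -> complex R) (f : forall j, chmap (X j) (Y j)) :
  chmap (prodc X) (prodc Y) := pc_tuple (fun j => ch_comp (f j) (pc_proj X j)).

(** Exactness of products of modules: preimages are chosen factor by factor. It makes products of
    quasi-isomorphisms quasi-isomorphisms, so that products in D(R) are termwise. *)
Lemma pc_boundary J (X : J -> complex R) n (x : prodc X n) :
  is_boundary x <-> forall j, is_boundary (x j).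
Proof.
split=> [bx j|]; first exact: (is_boundary_cmap (pc_proj X j)).
move: n x; apply: int_succP => n x bx.
pose s j := sval (cid (is_boundaryS (bx j))).
apply: (@boundaryS _ _ _ (s : prodc X n)).
by apply/functional_extensionality_dep => j; exact: (svalP (cid (is_boundaryS (bx j)))).
Qed.

Lemma pc_map_qis J (X Y : J -> complex R) (f : forall j, chmap (X j) (Y j)) :
  (forall j, qis (f j)) -> qis (pc_map f).
Proof.
move=> qf; apply/qisP => n; split=> [x dx /pc_boundary bfx|y dy].
  apply/pc_boundary => j; apply: ((qisP (f j)).1 (qf j) n).1 => //.
  by rewrite -[LHS]/(cx_d (prodc X) n x j) dx.
have E j : exists x, cx_d (X j) n x = 0 /\ is_boundary (y j - f j n x).
  apply: ((qisP (f j)).1 (qf j) n).2; by rewrite -[LHS]/(cx_d (prodc Y) n y j) dy.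
exists ((fun j => sval (cid (E j))) : prodc X n); split.
  by apply/functional_extensionality_dep => j; exact: (svalP (cid (E j))).1.
by apply/pc_boundary => j; exact: (svalP (cid (E j))).2.
Qed.

(** Common form of the subcomplex IX, of the two truncations, and of the object that refutes
    co-smashing. *)
Record subcx X := Subcx {
  sub_pred :> forall n, X n -> Prop;
  sub0 : forall n, sub_pred (0 : X n);
  subP : forall n (a : R) (u v : X n),
    sub_pred u -> sub_pred v -> sub_pred (a *: u + v);
  sub_d : forall n (x : X n), sub_pred x -> sub_pred (cx_d X n x) }.

Section Subcomplex.
Variables (X : complex R) (S : subcx X).

Section Degree.
Variable n : int.

Definition sub_mem : {pred X n} := fun x => `[< S n x >].

Lemma sub_submod_closed : submod_closed sub_mem.
Proof.
split=> [|a u v]; rewrite !unfold_in; first by apply/asboolP; exact: sub0.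
by move=> /asboolP Su /asboolP Sv; apply/asboolP; exact: subP.
Qed.

HB.instance Definition _ := GRing.isSubmodClosed.Build R (X n) sub_mem
  (GRing.submod_closed_semi sub_submod_closed).

Record sub_elt := SubElt { sub_val : X n; _ : sub_val \in sub_mem }.

HB.instance Definition _ := [isSub for sub_val].
HB.instance Definition _ := [Choice of sub_elt by <:].
HB.instance Definition _ := [SubChoice_isSubLmodule of sub_elt by <:].

Lemma sub_eltP (x : sub_elt) : S n (sub_val x).
Proof. by case: x => x /= /asboolP. Qed.

Definition mksub (x : X n) (Sx : S n x) : sub_elt := SubElt (introT (asboolP _) Sx).

Lemma sub_val_inj (x y : sub_elt) : sub_val x = sub_val y -> x = y.
Proof. exact: val_inj. Qed.

End Degree.

Definition sub_obj n : lmodType R := sub_elt n.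

Lemma sub_val_linear n : linear (fun x : sub_obj n => sub_val x).
Proof. by []. Qed.

Definition sub_df n (x : sub_obj n) : sub_obj (n + 1) := mksub (sub_d (sub_eltP x)).

Lemma sub_df_linear n : linear (@sub_df n).
Proof. by move=> a u v; apply: sub_val_inj; rewrite /= linearP. Qed.

Lemma sub_dd n x : mklin (@sub_df_linear (n + 1)) (mklin (@sub_df_linear n) x) = 0.
Proof. by apply: sub_val_inj; rewrite /= cx_dd. Qed.

Definition subc : complex R := Complex sub_dd.

Definition sub_in : chmap subc X :=
  @Chmap _ subc X (fun n => mklin (@sub_val_linear n)) (fun n x => erefl).

Lemma sub_boundaryS n (x : subc (n + 1)) :
  is_boundary x <-> exists2 y, S n y & sub_val x = cx_d X n y.
Proof.
split=> [/is_boundaryS[y ->]|[y Sy xy]]; first by exists (sub_val y) => //; exact: sub_eltP.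
by apply: (@boundaryS _ _ _ (mksub Sy : subc n)); apply: sub_val_inj.
Qed.

Lemma sub_cocycle n (x : subc n) : cx_d subc n x = 0 <-> cx_d X n (sub_val x) = 0.
Proof.
split=> [dx|dx]; last exact: sub_val_inj.
by rewrite -[LHS]/(sub_val (cx_d subc n x)) dx.
Qed.

Section Corestriction.
Variables (Y : complex R) (f : chmap Y X) (fS : forall n y, S n (f n y)).

Lemma sub_core_linear n : linear (fun y : Y n => mksub (fS y) : subc n).
Proof. by move=> a u v; apply: sub_val_inj; rewrite /= linearP. Qed.

Lemma sub_core_d n (y : Y n) :
  mklin (@sub_core_linear (n + 1)) (cx_d Y n y) =
  cx_d subc n (mklin (@sub_core_linear n) y).
Proof. by apply: sub_val_inj; rewrite /= cmap_d. Qed.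

Definition sub_core : chmap Y subc := Chmap sub_core_d.

End Corestriction.
End Subcomplex.

(* An acyclic complex is a zero object of the derived category. *)
Lemma acyclic_dmap0 X Y (f : chmap X Y) : acyclic X -> dmap f = dzero X Y.
Proof.
move=> aX; rewrite /dmap.
rewrite (@frac_refine _ _ _ _ _ _ _ _ (cone_in f)
  (qis_comp (cone_in_qis f aX) (qis_id Y))).
rewrite -(@frac_zero _ X Y _ _ (qis_comp (cone_in_qis f aX) (qis_id Y))).
apply: frac_homotopic; last exact: homotopic_refl.
have lh n : linear (fun x : X (n + 1) => (x, 0) : cone f n).
  by move=> a u v; congr pair; rewrite /= scaler0 addr0.
apply: (homotopicP lh) => n x; congr pair; rewrite /= ?subr0 ?addNr //.
by rewrite linear0 !addr0.
Qed.

End Constructions.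

(** * Calculus in the derived category *)

Local Notation "g \c f" := (dcomp g f) (at level 40, left associativity).
Local Notation "f \p g" := (dadd f g) (at level 50, left associativity).

Section DerivedCategory.
Variable R : pzRingType.
Implicit Types X Y Z W A B : complex R.

Lemma dmap_homotopic X Y (f g : chmap X Y) : homotopic f g -> dmap f = dmap g.
Proof. by move=> fg; apply: frac_homotopic => //; exact: homotopic_refl. Qed.

Lemma dmap_eq X Y (f g : chmap X Y) : (forall n x, f n x = g n x) -> dmap f = dmap g.
Proof. by move=> fg; apply/dmap_homotopic/homotopic_eq. Qed.

Lemma frac_comp_dmap X Y Z (f : chmap X Y) V (g : chmap Y V) (t : chmap Z V) (qt : qis t) :
  frac g qt \c dmap f = frac (ch_comp g f) qt.
Proof.
rewrite (@frac_comp _ _ _ _ _ _ f _ (qis_id Y) g _ qt _ g (ch_id V)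
  (qis_comp (qis_id V) qt)); last 2 first.
- exact: homotopic_eq.
- exact: qis_id.
by apply: frac_homotopic; exact: homotopic_eq.
Qed.

Lemma dmap_comp X Y Z (g : chmap Y Z) (f : chmap X Y) :
  dmap (ch_comp g f) = dmap g \c dmap f.
Proof. by rewrite frac_comp_dmap. Qed.

Lemma dmap_add X Y (f g : chmap X Y) : dmap (ch_add f g) = dmap f \p dmap g.
Proof. by rewrite frac_add. Qed.

Definition dinv X Y (s : chmap X Y) (qs : qis s) : dhom Y X := frac (ch_id Y) qs.

Lemma fracE X Y Z (f : chmap X Z) (s : chmap Y Z) (qs : qis s) :
  frac f qs = dinv qs \c dmap f.
Proof. by rewrite frac_comp_dmap; apply: frac_homotopic; exact: homotopic_eq. Qed.

Lemma dinvK X Y (s : chmap X Y) (qs : qis s) : dinv qs \c dmap s = did X.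
Proof.
rewrite -fracE /did /dmap (@frac_refine _ _ _ _ _ _ (qis_id X) _ s (qis_comp qs (qis_id X))).
by apply: frac_homotopic; exact: homotopic_eq.
Qed.

Lemma dmapK X Y (s : chmap X Y) (qs : qis s) : dmap s \c dinv qs = did Y.
Proof.
rewrite (@frac_comp _ _ _ _ _ _ (ch_id Y) _ qs s _ (qis_id Y) _ (ch_id Y) (ch_id Y)
  (qis_comp (qis_id Y) (qis_id Y))); last 2 first.
- exact: homotopic_eq.
- exact: qis_id.
by apply: frac_homotopic; exact: homotopic_eq.
Qed.

Lemma dcomp0r X Y Z (f : dhom X Y) : dzero Y Z \c f = dzero X Z.
Proof.
have [V [g [s [qs ->]]]] := fracP f.
rewrite (@frac_comp _ _ _ _ _ _ g _ qs (ch_zero Y Z) _ (qis_id Z) _ (ch_zero V Z) (ch_id Z)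
  (qis_comp (qis_id Z) (qis_id Z))); last 2 first.
- exact: homotopic_eq.
- exact: qis_id.
by apply: frac_homotopic; exact: homotopic_eq.
Qed.

Lemma dcompr0 X Y Z (f : dhom Y Z) : f \c dzero X Y = dzero X Z.
Proof.
have [V [g [s [qs ->]]]] := fracP f; rewrite frac_comp_dmap -(frac_zero _ qs).
by apply: frac_homotopic; apply: homotopic_eq => // n x; rewrite /= linear0.
Qed.

Lemma dadd0r X Y (f : dhom X Y) : f \p dzero X Y = f.
Proof. by rewrite daddC dadd0. Qed.

Lemma dinv_inj X Y Z (s : chmap Y Z) (qs : qis s) (f g : dhom X Y) :
  dmap s \c f = dmap s \c g -> f = g.
Proof.
by move=> /(congr1 (fun h => dinv qs \c h)); rewrite !dcompA dinvK !dcomp1m.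
Qed.

Lemma dinv_epi X Y Z (s : chmap X Y) (qs : qis s) (f g : dhom Y Z) :
  f \c dmap s = g \c dmap s -> f = g.
Proof.
by move=> /(congr1 (fun h => h \c dinv qs)); rewrite -!dcompA dmapK !dcompm1.
Qed.

(** The two refinements that identify the fractions agree up to homotopy after composition with the
    quasi-isomorphism [s], so a further quasi-isomorphism ([qis_kill]) merges them into one. *)
Lemma frac_inj X Y Z (f g : chmap X Z) (s : chmap Y Z) (qs : qis s) :
  frac f qs = frac g qs ->
  exists W (k : chmap Z W), qis k /\ homotopic (ch_comp k f) (ch_comp k g).
Proof.
move=> /(class_of_inj (@roof_eqv_refl _ X Y)) [W [u [v [/= uf us q]]]].
have [V [k [qk ku]]] := qis_kill qs us.
exists V, (ch_comp k u); split; first exact: (qis_comp qk (qis_cancel q qs)).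
apply: (homotopic_trans (homotopic_compr k uf)).
exact: (homotopic_compl g (homotopic_sym ku)).
Qed.

Lemma dshift_dmap X Y (f : chmap X Y) : dshift (dmap f) = dmap (ch_shift f).
Proof. by rewrite frac_shift; apply: frac_homotopic; exact: homotopic_eq. Qed.

Lemma pc_homotopic J (X : J -> complex R) Y (f g : chmap Y (prodc X)) :
  (forall j, homotopic (ch_comp (pc_proj X j) f) (ch_comp (pc_proj X j) g)) ->
  homotopic f g.
Proof.
move=> H; pose h j := sval (cid (H j)).
have hP j := svalP (cid (H j)).
have lh n : linear (fun y : Y (n + 1) => (fun j => h j n y) : prodc X n).
  by move=> a u v; apply/functional_extensionality_dep => j; rewrite linearP.
by apply: (homotopicP lh) => n x; apply/functional_extensionality_dep => j; exact: (hP j n x).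
Qed.

Section Products.
Variables (J : Type) (X : J -> complex R).

(** A refinement equating the two fractions is chosen in each factor. Together they give one map
    from the common apex to the product of the new apices; its composite with [s] is homotopic to a
    product of quasi-isomorphisms, so it refines both fractions at once. *)
Lemma pc_dhom_uniq A (x y : dhom A (prodc X)) :
  (forall j, dmap (pc_proj X j) \c x = dmap (pc_proj X j) \c y) -> x = y.
Proof.
have [Z [f [g [s [qs [-> ->]]]]]] := frac_common2 x y => H.
have E j : exists W, exists (k : chmap Z W) (t : chmap (X j) W), [/\ qis t,
    homotopic (ch_comp k s) (ch_comp t (pc_proj X j)) &
    homotopic (ch_comp k f) (ch_comp k g)].
  have [W [a [b [ab qb]]]] := homotopy_square (pc_proj X j) qs.
  have qbi := qis_comp qb (qis_id (X j)).
  have := H j; rewrite !(frac_comp _ qs (qis_id _) qbi ab qb).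
  move=> /frac_inj[V [k [qk kP]]].
  exists V, (ch_comp k a), (ch_comp k b); split=> //; first exact: qis_comp.
  exact: (homotopic_compr k ab).
pose W j := sval (cid (E j)); pose k j := sval (cid (svalP (cid (E j)))).
pose t j := sval (cid (svalP (cid (svalP (cid (E j)))))).
have P j : [/\ qis (t j), homotopic (ch_comp (k j) s) (ch_comp (t j) (pc_proj X j)) &
    homotopic (ch_comp (k j) f) (ch_comp (k j) g)].
  exact: (svalP (cid (svalP (cid (svalP (cid (E j))))))).
pose al : chmap Z (prodc W) := pc_tuple k.
have qt : qis (pc_map t) by apply: pc_map_qis => j; case: (P j).
have als : homotopic (ch_comp al s) (pc_map t).
  apply: pc_homotopic => j; case: (P j) => _ h _.
  by apply: homotopic_trans (homotopic_trans h _); apply: homotopic_eq.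
have qas := qis_homotopic (homotopic_sym als) qt.
rewrite !(@frac_refine _ _ _ _ _ _ _ _ _ qas).
apply: frac_homotopic; last exact: homotopic_refl.
apply: pc_homotopic => j; case: (P j) => _ _ h.
by apply: homotopic_trans (homotopic_trans h _); apply: homotopic_eq.
Qed.

Lemma pc_dhom_tuple A (x : forall j, dhom A (X j)) :
  exists y : dhom A (prodc X), forall j, dmap (pc_proj X j) \c y = x j.
Proof.
pose s j := den (dhom_repr (x j)).
have qs : qis (pc_map s) by apply: pc_map_qis => j; exact: den_qis.
exists (frac (pc_tuple (fun j => num (dhom_repr (x j)))) qs) => j.
rewrite (@frac_comp _ _ _ _ _ _ _ _ qs _ _ _ _ (pc_proj (fun j => apex (dhom_repr (x j))) j) (s j)
  (qis_comp (den_qis (dhom_repr (x j))) (qis_id (X j)))).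
- transitivity (frac (num (dhom_repr (x j))) (den_qis (dhom_repr (x j)))).
    by apply: frac_homotopic; exact: homotopic_eq.
  by rewrite -[RHS]dhom_reprK; case: (dhom_repr (x j)).
- exact: homotopic_eq.
- exact: den_qis.
Qed.

End Products.

Section ShiftedProducts.
Variables (J : Type) (X : J -> complex R).

(** Termwise the identity; it carries the universal property of the termwise product across the
    shift. *)
Definition pc_shift : chmap (shift (prodc X)) (prodc (fun j => shift (X j))) :=
  pc_tuple (fun j => ch_shift (pc_proj X j)).

Lemma pc_shift_qis : qis pc_shift.
Proof. by apply: bijective_qis => [n y y' yy'|n y]; [exact: yy'|exists y]. Qed.

Lemma pc_shift_proj j :
  dmap (pc_proj (fun j => shift (X j)) j) \c dmap pc_shift = dshift (dmap (pc_proj X j)).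
Proof. by rewrite -dmap_comp dshift_dmap; apply: dmap_eq. Qed.

Lemma pc_shift_dhom_uniq A (x y : dhom A (shift (prodc X))) :
  (forall j, dshift (dmap (pc_proj X j)) \c x = dshift (dmap (pc_proj X j)) \c y) ->
  x = y.
Proof.
move=> H; apply: (dinv_inj pc_shift_qis); apply: pc_dhom_uniq => j.
by rewrite !dcompA pc_shift_proj.
Qed.

Lemma pc_shift_dhom_tuple A (x : forall j, dhom A (shift (X j))) :
  exists y : dhom A (shift (prodc X)),
    forall j, dshift (dmap (pc_proj X j)) \c y = x j.
Proof.
pose S j := shift (X j).
have [y yP] : exists y : dhom A (prodc S), forall j, dmap (pc_proj S j) \c y = x j.
  apply: pc_dhom_tuple.
exists (dinv pc_shift_qis \c y) => j.
by rewrite -pc_shift_proj -dcompA [_ \c (_ \c y)]dcompA dmapK dcomp1m yP.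
Qed.

End ShiftedProducts.
End DerivedCategory.

(** * Direct sums in the derived category *)

Section DirectSums.
Variable R : pzRingType.
Implicit Types X Y A : complex R.

Lemma dsum_did X Y : (dmap (dsum_in1 X Y) \c dmap (dsum_pr1 X Y)) \p
  (dmap (dsum_in2 X Y) \c dmap (dsum_pr2 X Y)) = did (dsum X Y).
Proof.
rewrite -!dmap_comp -dmap_add; apply: dmap_eq => n x.
by case: x => u v; congr pair; rewrite /= ?addr0 ?add0r.
Qed.

Lemma dsum_dhom_uniq A X Y (x y : dhom A (dsum X Y)) :
  dmap (dsum_pr1 X Y) \c x = dmap (dsum_pr1 X Y) \c y ->
  dmap (dsum_pr2 X Y) \c x = dmap (dsum_pr2 X Y) \c y -> x = y.
Proof.
move=> h1 h2; rewrite -[x]dcomp1m -[y]dcomp1m -dsum_did !dcompDl -!dcompA.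
by rewrite h1 h2.
Qed.

Lemma dsum_shift_dhom_uniq A X Y (x y : dhom A (shift (dsum X Y))) :
  dshift (dmap (dsum_pr1 X Y)) \c x = dshift (dmap (dsum_pr1 X Y)) \c y ->
  dshift (dmap (dsum_pr2 X Y)) \c x = dshift (dmap (dsum_pr2 X Y)) \c y -> x = y.
Proof.
move=> h1 h2; rewrite -[x]dcomp1m -[y]dcomp1m -dshift1 -dsum_did dshiftD !dshift_comp.
by rewrite !dcompDl -!dcompA h1 h2.
Qed.

Definition dsum_map X Y X' Y' (f : chmap X X') (g : chmap Y Y') :
  chmap (dsum X Y) (dsum X' Y') :=
  dsum_pair (ch_comp f (dsum_pr1 X Y)) (ch_comp g (dsum_pr2 X Y)).

Lemma dsum_boundaryP X Y n (p : dsum X Y n) :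
  is_boundary p <-> is_boundary p.1 /\ is_boundary p.2.
Proof.
split=> [b|[]].
  split; first exact: (is_boundary_cmap (dsum_pr1 X Y) b).
  exact: (is_boundary_cmap (dsum_pr2 X Y) b).
move=> /(is_boundary_cmap (dsum_in1 X Y)) b1 /(is_boundary_cmap (dsum_in2 X Y)) b2.
have -> : p = dsum_in1 X Y n p.1 + dsum_in2 X Y n p.2.
  by case: p {b1 b2} => u v; congr pair; rewrite /= ?addr0 ?add0r.
exact: is_boundaryD.
Qed.

Lemma dsum_map_qis X Y X' Y' (f : chmap X X') (g : chmap Y Y') :
  qis f -> qis g -> qis (dsum_map f g).
Proof.
move=> /qisP qf /qisP qg; apply/qisP => n; split=> [p dp /dsum_boundaryP[bf bg]|p dp].
  apply/dsum_boundaryP; split.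
    by apply: (qf n).1 bf; exact: (cx_d_cmap (dsum_pr1 X Y) dp).
  by apply: (qg n).1 bg; exact: (cx_d_cmap (dsum_pr2 X Y) dp).
have [x [dx bx]] := (qf n).2 _ (cx_d_cmap (dsum_pr1 _ _) dp).
have [y [dy b_y]] := (qg n).2 _ (cx_d_cmap (dsum_pr2 _ _) dp).
exists (x, y); split; first by congr pair.
exact/dsum_boundaryP.
Qed.

End DirectSums.

(** * Modules fixed by the ideal I *)

Local Open Scope classical_set_scope.

(** The identity of R_0 + ... + R_(k-1). These idempotents increase and generate I, so IM is the
    union of the submodules [cutoff k] M and membership needs no finite sums. *)
Definition cutoff (k : nat) : prodZ2 := fun i => if (i < k)%N then 1 else 0.
Definition coord_idem (i : nat) : prodZ2 := fun j => if j == i then 1 else 0.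

Lemma prodZ2_mulE (x y : prodZ2) i : (x * y) i = x i * y i.
Proof. by []. Qed.

Lemma prodZ2_addE (x y : prodZ2) i : (x + y) i = x i + y i.
Proof. by []. Qed.

Lemma cutoffM k l : cutoff k * cutoff l = cutoff (minn k l).
Proof.
apply/funext => i; rewrite prodZ2_mulE /cutoff leq_min.
by case: (i < k)%N; rewrite ?mul1r ?mul0r.
Qed.

Lemma cutoff_sumZ2 k : sumZ2 (cutoff k).
Proof. by apply/sumZ2P; exists k => i; rewrite /cutoff leqNgt => /negbTE ->. Qed.

Lemma sumZ2_cutoff r : sumZ2 r -> exists k, cutoff k * r = r.
Proof.
move=> /sumZ2P[k rk]; exists k; apply/funext => i; rewrite prodZ2_mulE /cutoff.
by case: leqP => [/rk ->|_]; rewrite ?mulr0 ?mul1r.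
Qed.

Lemma Z2P (x : 'Z_2) : x = 0 \/ x = 1.
Proof. by case: x => [[|[|m]] //= mi]; [left|right]; apply: val_inj. Qed.

(** R_i has two elements, so an element of the form [coord_idem i *: x] spans a zero or simple
    module. This is where the field Z_2 matters. *)
Lemma coord_idemM r i : r * coord_idem i = 0 \/ r * coord_idem i = coord_idem i.
Proof.
have [ri|ri] := Z2P (r i); [left|right]; apply/funext => j;
  rewrite prodZ2_mulE /coord_idem; case: eqP => [->|_]; by rewrite ?ri ?mulr0 ?mulr1.
Qed.

Lemma cutoffS k : cutoff k.+1 = cutoff k + coord_idem k.
Proof.
apply/funext => i; rewrite prodZ2_addE /cutoff /coord_idem ltnS leq_eqVlt.
by case: ltngtP; rewrite ?addr0 ?add0r.
Qed.

Lemma cutoff0 : cutoff 0 = 0. Proof. by []. Qed.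

Lemma cutoff_le (M : lmodType prodZ2) (x : M) k l :
  (k <= l)%N -> cutoff k *: x = x -> cutoff l *: x = x.
Proof. by move=> kl kx; rewrite -kx scalerA cutoffM (minn_idPr kl). Qed.

Lemma cutoff_idem (M : lmodType prodZ2) (x : M) k :
  cutoff k *: (cutoff k *: x) = cutoff k *: x.
Proof. by rewrite scalerA cutoffM minnn. Qed.

Definition cutoff_fixed (M : lmodType prodZ2) (x : M) := exists k, cutoff k *: x = x.

Lemma cutoff_fixedP (M : lmodType prodZ2) (a : prodZ2) (x y : M) :
  cutoff_fixed x -> cutoff_fixed y -> cutoff_fixed (a *: x + y).
Proof.
move=> [k kx] [l ly]; exists (maxn k l); rewrite scalerDr scalerA.
rewrite [_ * a]mulrC -scalerA (cutoff_le (leq_maxl k l) kx).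
by rewrite (cutoff_le (leq_maxr k l) ly).
Qed.

(* Modules M with IM = M are semisimple and projective; both facts, in the form
   of an extension property, come from one application of Zorn's lemma. *)
Lemma linear_extension (M Z : lmodType prodZ2) (rel G : set (M * Z)) :
  (forall x : M, cutoff_fixed x) ->
  (forall a u v, rel u -> rel v -> rel (a *: u + v)) ->
  (forall x, exists z, rel (x, z)) ->
  G 0 -> (forall a u v, G u -> G v -> G (a *: u + v)) -> G `<=` rel ->
  (forall z, G (0, z) -> z = 0) ->
  exists h : {linear M -> Z},
    (forall x, rel (x, h x)) /\ (forall x z, G (x, z) -> h x = z).
Proof.
move=> IM relP relT G0 GP Grel Gfun.
(* Partial linear maps are encoded by their graphs. The containment of [G] is required only of
   nonempty [A], because the union of the empty chain must satisfy [P] too. *)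
pose P : set (set (M * Z)) := fun A =>
  [/\ forall a u v, A u -> A v -> A (a *: u + v), A `<=` rel,
      forall z, A (0, z) -> z = 0 & forall p, A p -> G `<=` A].
have PG : P G by split=> // p Gp q.
have [F FP Ftot|A [[AP Arel Afun AG] Amax]] := @Zorn_bigcup _ P.
  split.
  - move=> a u v [A FA Au] [B FB Bv].
    have [AB|BA] := Ftot A B FA FB.
      by exists B => //; have [BP _ _ _] := FP B FB; apply: BP => //; exact: AB.
    by exists A => //; have [AP _ _ _] := FP A FA; apply: AP => //; exact: BA.
  - by move=> p [A FA Ap]; have [_ AR _ _] := FP A FA; exact: AR.
  - by move=> z [A FA Az]; have [_ _ AF _] := FP A FA; exact: AF.
  - by move=> p [A FA Ap] q Gq; exists A => //; have [_ _ _ AG] := FP A FA; exact: (AG p).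
(* If [G] were not contained in [A], then [A] would be empty and [G] would be a larger member of
   [P]. *)
have GA : G `<=` A.
  apply: contrapT => nGA; apply: (Amax G) => //; split=> // p Ap.
  by case: nGA; exact: AG Ap.
have A0 := GA _ G0.
have dom0 a b u v : (exists z, A (u, z)) -> (exists z, A (v, z)) ->
    exists z, A (a *: u + b *: v, z).
  move=> [z uz] [w vw]; exists (a *: z + b *: w).
  by apply: (AP a (u, z) (b *: v, b *: w)) => //; have := AP b _ _ vw A0; rewrite addr0.
have Atot x : exists z, A (x, z).
  apply: contrapT => nx.
  (* [x] is a finite sum of its components [coord_idem i *: x], so if all of them were in the
     domain, [x] would be too. *)
  have [i ni] : exists i, ~ exists z, A (coord_idem i *: x, z).
    apply: contrapT => /forallNP H; apply: nx; have [k <-] := IM x.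
    elim: k => [|k IH]; first by exists 0; rewrite cutoff0 scale0r.
    have [z Az] := contrapT (H k).
    rewrite cutoffS scalerDl -[X in X + _]scale1r -[X in _ + X]scale1r.
    by apply: dom0 => //; exists z.
  have [w' Rw'] := relT x.
  (* The graph is enlarged by the line through ([y], [w]). Cutting [w'] by the same idempotent
     ensures that r y = 0 forces r w = 0; otherwise r y = y, which lies outside the domain, so the
     enlarged relation stays functional. *)
  set y := coord_idem i *: x in ni; pose w := coord_idem i *: w'.
  have Ryw : rel (y, w) by have := relP (coord_idem i) _ _ Rw' (Grel _ G0); rewrite addr0.
  pose B : set (M * Z) := fun p => exists q r, A q /\ p = r *: (y, w) + q.
  have AB : A `<=` B by move=> q Aq; exists q, 0; rewrite scale0r add0r.
  have Byw : B (y, w) by exists 0, 1; rewrite scale1r addr0.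
  apply: (Amax B); first by split=> // BA; apply: ni; exists w; exact: BA.
  split.
  - move=> a _ _ [p [r [Ap ->]]] [q [s [Aq ->]]].
    exists (a *: p + q), (a * r + s); split; first exact: AP.
    by rewrite scalerDr scalerDl scalerA addrACA.
  - by move=> _ [p [r [Ap ->]]]; apply: relP => //; exact: Arel.
  - move=> z [[u v] [r [Au [/esym]]]] + ->.
    have [r0|r1] := coord_idemM r i.
      have -> : r *: w = 0 by rewrite /w scalerA r0 scale0r.
      rewrite /y scalerA r0 scale0r !add0r => u0.
      by apply: Afun; rewrite -u0.
    rewrite /y scalerA r1 -/y => /eqP; rewrite addr_eq0 => /eqP yu.
    case: ni; exists (- v); rewrite yu.
    by have := AP (-1) _ _ Au A0; rewrite addr0 scaleN1r.
  by move=> p _; apply: subset_trans GA AB.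
have [h hP] := boolp.choice Atot.
have Auniq x z z' : A (x, z) -> A (x, z') -> z = z'.
  move=> xz xz'; apply/eqP; rewrite -subr_eq0; apply/eqP/Afun.
  have -> : (0, z - z') = (x, z) - (x, z') :> M * Z by congr pair; rewrite /= subrr.
  by have := AP (-1) _ _ xz' xz; rewrite scaleN1r addrC.
have lh : linear h.
  by move=> a u v; apply: Auniq (hP _) _; exact: (AP a (u, h u) (v, h v)).
exists (mklin lh); split=> [x|x z Gxz]; first exact: Arel.
exact: Auniq (hP _) (GA _ Gxz).
Qed.

(** Reindexes a family of data given in degrees n + 1 to all degrees; the transport is confined
    here. *)
Definition int_succ_rect (P : int -> Type) (H : forall n, P (n + 1)) n : P n :=
  eq_rect (n - 1 + 1) P (H (n - 1)) n (subrK 1 n).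

Lemma int_succ_rectE (P : int -> Type) (H : forall n, P (n + 1)) n :
  int_succ_rect H (n + 1) = H n.
Proof.
rewrite /int_succ_rect; move: (n + 1 - 1) (subrK _ _) => m e.
have mn := addIr _ e; case: _ / mn in e *.
by rewrite (eq_irrelevance e erefl).
Qed.

Local Notation cx := (complex prodZ2).

(** * Null-homotopies out of complexes fixed by I *)

Section NullHomotopy.
Variables (X Z : cx) (f : chmap X Z).
Hypothesis IX : forall n (x : X n), cutoff_fixed x.
Hypothesis fbd : forall n (c : X n), cx_d X n c = 0 -> is_boundary (f n c).

(** Projectivity of the module of cocycles gives a linear choice of bounding elements;
    semisimplicity then extends it from the cocycles to the whole term. *)
Lemma lift_cocycles n : exists h : {linear X (n + 1) -> Z n},
  forall c, cx_d X (n + 1) c = 0 -> f (n + 1) c = cx_d Z n (h c).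
Proof.
have [|||||||h0 [h0P _]] := @linear_extension (cocycle X (n + 1) : lmodType _) (Z n)
    [set p | f (n + 1) (cocycle_val p.1) = cx_d Z n p.2] [set 0].
- move=> c; have [k kc] := IX (cocycle_val c); exists k.
  exact: (val_inj (kc : cocycle_val (cutoff k *: c) = _)).
- by move=> a u v /= uP vP; rewrite !linearP /= uP vP.
- by move=> c; have /is_boundaryS[z zP] := fbd (cocycleP c); exists z.
- by [].
- by move=> a _ _ -> ->; rewrite /= scaler0 addr0.
- by move=> _ -> /=; rewrite !linear0.
- by move=> z [].
have [|||||||h [_ hP]] := @linear_extension (X (n + 1)) (Z n) setT
    [set p | exists c, p = (cocycle_val c, h0 c)].
- exact: IX.
- by [].
- by move=> x; exists 0.
- by exists 0; rewrite linear0.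
- by move=> a _ _ [c ->] [c' ->]; exists (a *: c + c'); rewrite linearP.
- by [].
- by move=> z [c [/esym c0 ->]]; have -> : c = 0 by [exact: val_inj]; rewrite linear0.
exists h => c dc; rewrite (hP c (h0 (mkcocycle dc))) ?h0P //.
by have /= <- := h0P (mkcocycle dc).
by exists (mkcocycle dc).
Qed.

(** The homotopy is h1 + h2. With h1 bounding f on cocycles, the defect f - d h1 - h1 d vanishes on
    cocycles and takes values in cocycles. Hence it factors as h2 d, where d h2 = 0, and h2 adds
    exactly the missing term. *)
Lemma null_homotopic : homotopic f (ch_zero X Z).
Proof.
pose h1 n := sval (cid (lift_cocycles n)).
have h1P n := svalP (cid (lift_cocycles n)).
have step n : exists h : {linear X (n + 1 + 1) -> Z (n + 1)},
    (forall x, cx_d Z (n + 1) (h x) = 0) /\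
    (forall x, h (cx_d X (n + 1) x) =
       f (n + 1) x - (cx_d Z n (h1 n x) + h1 (n + 1) (cx_d X (n + 1) x))).
  pose phi x := f (n + 1) x - (cx_d Z n (h1 n x) + h1 (n + 1) (cx_d X (n + 1) x)).
  have phiP a u v : phi (a *: u + v) = a *: phi u + phi v.
    by rewrite /phi !linearP /= scalerBr scalerDr (addrACA (a *: _)) opprD addrACA.
  (* The map sending d x to [phi x] is extended from the boundaries to the whole term, keeping its
     values in the cocycles of [Z]. *)
  have [|||||||h [hd hP]] := @linear_extension (X (n + 1 + 1)) (Z (n + 1))
    [set p | cx_d Z (n + 1) p.2 = 0] [set p | exists x, p = (cx_d X (n + 1) x, phi x)].
  - exact: IX.
  - by move=> a u v /= u0 v0; rewrite linearP /= u0 v0 scaler0 addr0.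
  - by move=> x; exists 0; rewrite /= linear0.
  - by exists 0; rewrite /phi !linear0 addr0 subr0.
  - by move=> a _ _ [x ->] [y ->]; exists (a *: x + y); rewrite linearP phiP.
  - move=> _ [x ->] /=; rewrite /phi linearB linearD /= cx_dd add0r -cmap_d.
    by rewrite h1P ?subrr // cx_dd.
  - move=> z [x [/esym x0 ->]]; rewrite /phi x0 linear0 addr0.
    by rewrite h1P // subrr.
  by exists h; split=> // x; apply: hP; exists x.
pose h2' n := sval (cid (step n)); have h2'P n := svalP (cid (step n)).
pose h2 n : {linear X (n + 1) -> Z n} :=
  @int_succ_rect (fun n => {linear X (n + 1) -> Z n}) h2' n.
have h2d n x : cx_d Z n (h2 n x) = 0.
  move: n x; apply: int_succP => n x; rewrite /h2 int_succ_rectE.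
  exact: (h2'P n).1.
exists (fun n => h1 n \+ h2 n : {linear _ -> _}) => n x.
rewrite /= subr0 linearD h2d addr0 /h2 int_succ_rectE.
by rewrite (h2'P n).2 addrA addrC subrK.
Qed.

End NullHomotopy.

(** * Cohomological conditions and orthogonality *)

(** This and the next two definitions say, on cocycles, that H^n lies in C_I, lies in T_I, or is
    zero; [coh_torsP], [coh_tfreeP] and [coh_zeroP] give the translation. Working on cocycles avoids
    quotient modules. *)
Definition coh_tors (n : int) (X : cx) := forall c : X n,
  cx_d X n c = 0 -> exists k, is_boundary (c - cutoff k *: c).
Definition coh_tfree (n : int) (X : cx) := forall c : X n,
  cx_d X n c = 0 -> forall k, is_boundary (cutoff k *: c).
Definition coh_zero (n : int) (X : cx) := forall c : X n,
  cx_d X n c = 0 -> is_boundary c.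
Definition coh_orth n X Y :=
  coh_tors n X /\ coh_tfree n Y \/ coh_tfree n X /\ coh_tors n Y.

Section Predicates.
Implicit Types X Y Z : cx.

Lemma is_boundaryZ X n (a : prodZ2) (x : X n) : is_boundary x -> is_boundary (a *: x).
Proof.
by move=> bx; rewrite -[_ *: _]addr0; apply: is_boundary_P => //; exact: is_boundary0.
Qed.

Lemma boundary_cocycle X n (x : X n) : is_boundary x -> cx_d X n x = 0.
Proof. by case=> m y; rewrite cx_dd. Qed.

Lemma coh_zero_tors X n : coh_zero n X -> coh_tors n X.
Proof.
move=> zX c dc; exists 0; rewrite cutoff0 scale0r subr0; exact: zX.
Qed.

Lemma coh_zero_tfree X n : coh_zero n X -> coh_tfree n X.
Proof. by move=> zX c dc k; apply/is_boundaryZ/zX. Qed.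

Section Transfer.
Variables (X Y : cx) (f : chmap X Y).

Lemma coh_tors_inj n : (forall c, cx_d X n c = 0 -> is_boundary (f n c) -> is_boundary c) ->
  coh_tors n Y -> coh_tors n X.
Proof.
move=> fI tY c dc; have [k bk] := tY (f n c) (cx_d_cmap f dc).
exists k; apply: fI; first by rewrite linearB linearZ /= dc scaler0 subr0.
by rewrite linearB linearZ.
Qed.

Lemma coh_tfree_inj n : (forall c, cx_d X n c = 0 -> is_boundary (f n c) -> is_boundary c) ->
  coh_tfree n Y -> coh_tfree n X.
Proof.
move=> fI tY c dc k; apply: fI; first by rewrite linearZ /= dc scaler0.
by rewrite linearZ; apply: (tY _ (cx_d_cmap f dc)).
Qed.

Lemma coh_zero_inj n : (forall c, cx_d X n c = 0 -> is_boundary (f n c) -> is_boundary c) ->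
  coh_zero n Y -> coh_zero n X.
Proof. by move=> fI tY c dc; apply: fI => //; exact: (tY _ (cx_d_cmap f dc)). Qed.

Hypothesis qf : qis f.

Lemma coh_tors_qis n : coh_tors n X -> coh_tors n Y.
Proof.
move=> tX y dy; have [x [dx b]] := ((qisP f).1 qf n).2 y dy.
have [k bk] := tX x dx; exists k.
have -> : y - cutoff k *: y = (y - f n x) - cutoff k *: (y - f n x) +
    f n (x - cutoff k *: x).
  rewrite (linearB (f n)) (linearZ_LR (f n)) /= scalerBr opprB addrAC.
  by rewrite !addrA !subrK.
apply: is_boundaryD; last exact: is_boundary_cmap.
by apply: is_boundaryB => //; exact: is_boundaryZ.
Qed.

Lemma coh_tfree_qis n : coh_tfree n X -> coh_tfree n Y.
Proof.
move=> tX y dy k; have [x [dx b]] := ((qisP f).1 qf n).2 y dy.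
rewrite -[y](subrK (f n x)) scalerDr -linearZ; apply: is_boundaryD.
  exact: is_boundaryZ.
exact: is_boundary_cmap (tX x dx k).
Qed.

Lemma coh_zero_qis n : coh_zero n X -> coh_zero n Y.
Proof.
move=> tX y dy; have [x [dx b]] := ((qisP f).1 qf n).2 y dy.
rewrite -[y](subrK (f n x)); apply: is_boundaryD => //.
exact: is_boundary_cmap (tX x dx).
Qed.

End Transfer.

(** The class of [f n c] is fixed by some cutoff and killed by every cutoff, one property coming
    from [X], the other from [Y] through [s]. *)
Lemma orth_boundary X Y Z n (f : chmap X Z) (s : chmap Y Z) : qis s ->
  coh_orth n X Y -> forall c, cx_d X n c = 0 -> is_boundary (f n c).
Proof.
move=> qs [[tX fY]|[fX tY]] c dc; have dfc := cx_d_cmap f dc.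
  have [k bk] := tX c dc; rewrite -[c](subrK (cutoff k *: c)) linearD.
  apply: is_boundaryD; first exact: is_boundary_cmap.
  by rewrite linearZ; exact: (coh_tfree_qis qs fY dfc).
have [k bk] := coh_tors_qis qs tY dfc.
rewrite -[f n c](subrK (cutoff k *: f n c)); apply: is_boundaryD => //.
by rewrite -linearZ; apply: is_boundary_cmap; exact: fX.
Qed.

Lemma dhom_trivial X Y : (forall x : dhom X Y, x = dzero X Y) -> forall x y : dhom X Y, x = y.
Proof. by move=> H x y; rewrite (H x) (H y). Qed.

Lemma cutoff_fixed_vanish X Y : (forall n (x : X n), cutoff_fixed x) ->
  (forall n, coh_orth n X Y) -> forall x y : dhom X Y, x = y.
Proof.
move=> IX oXY; apply: dhom_trivial => x; have [Z [f [s [qs ->]]]] := fracP x.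
rewrite -(frac_zero X qs); apply: frac_homotopic; last exact: homotopic_refl.
apply: null_homotopic => // n c; exact: (orth_boundary f qs).
Qed.

Lemma shift_cocycle X n (c : X (n + 1)) : cx_d (shift X) n c = 0 <-> cx_d X (n + 1) c = 0.
Proof.
split=> dc; last by rewrite /= dc oppr0.
by rewrite -[LHS]opprK -[- cx_d _ _ _]/(cx_d (shift X) n c) dc oppr0.
Qed.

Lemma coh_tors_shift X n : coh_tors (n + 1) X -> coh_tors n (shift X).
Proof.
by move=> H c /shift_cocycle/H[k bk]; exists k; apply/is_boundary_shift.
Qed.

Lemma coh_zero_shift X n : coh_zero (n + 1) X <-> coh_zero n (shift X).
Proof.
split=> H c; first by move=> /shift_cocycle dc; apply/is_boundary_shift; exact: H.
by move=> dc; apply/is_boundary_shift/H/shift_cocycle.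
Qed.

(** * The functor I on complexes *)

Section IdealPart.
Variable X : cx.

Lemma cutoff_fixed0 n : cutoff_fixed (0 : X n).
Proof. by exists 0; rewrite scaler0. Qed.

Lemma cutoff_fixed_linear (M N : lmodType prodZ2) (f : {linear M -> N}) x :
  cutoff_fixed x -> cutoff_fixed (f x).
Proof. by case=> k kx; exists k; rewrite -linearZ kx. Qed.

Definition ideal_sub : subcx X :=
  @Subcx _ X (fun n x => cutoff_fixed x) cutoff_fixed0
    (fun n a u v => @cutoff_fixedP _ a u v)
    (fun n x => @cutoff_fixed_linear _ _ (cx_d X n) x).

Definition idl : cx := subc ideal_sub.
Definition idl_in : chmap idl X := sub_in ideal_sub.

Lemma idl_fixed n (x : idl n) : cutoff_fixed x.
Proof.
have [k kx] := sub_eltP x; exists k.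
exact: (@sub_val_inj _ _ ideal_sub n (cutoff k *: x) x kx).
Qed.

(** Multiplying a primitive of [x] by a cutoff that fixes [x] moves the primitive into IX; hence IX
    -> X is injective on cohomology. *)
Lemma idl_boundary n (x : idl n) : is_boundary (idl_in n x) -> is_boundary x.
Proof.
move: n x; apply: int_succP => n x /is_boundaryS[y xy].
have [k kx] := idl_fixed x; apply/sub_boundaryS; exists (cutoff k *: y).
  by exists k; rewrite cutoff_idem.
by rewrite linearZ /= -[cx_d _ _ _]xy -[in LHS]kx.
Qed.

Lemma idl_tors n : coh_tors n idl.
Proof.
move=> c dc; have [k kc] := idl_fixed c; exists k; rewrite kc subrr; exact: is_boundary0.
Qed.

Lemma idl_zero n : coh_tfree n X -> coh_zero n idl.
Proof.
move=> fX c dc; apply: idl_boundary; have [k <-] := idl_fixed c.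
by rewrite linearZ; apply: fX; exact: (cx_d_cmap idl_in dc).
Qed.

End IdealPart.

Lemma idl_map_fixed X Y (f : chmap X Y) n (x : idl X n) :
  ideal_sub Y n (ch_comp f (idl_in X) n x).
Proof. exact: (cutoff_fixed_linear (f n) (sub_eltP x)). Qed.

Definition idl_map X Y (f : chmap X Y) : chmap (idl X) (idl Y) :=
  sub_core (idl_map_fixed f).

(** A preimage of a class fixed by [cutoff k] may be multiplied by [cutoff k], which puts it in
    IX. *)
Lemma idl_qis X Y (f : chmap X Y) : qis f -> qis (idl_map f).
Proof.
move=> /qisP qf; apply/qisP => n; split=> [x dx b|y dy].
  apply: idl_boundary; apply: (qf n).1; first exact: (cx_d_cmap (idl_in X) dx).
  exact: (is_boundary_cmap (idl_in Y) b).
have [x [dx b]] := (qf n).2 _ (cx_d_cmap (idl_in Y) dy); have [k ky] := idl_fixed y.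
have fx : cutoff_fixed (cutoff k *: x) by exists k; rewrite cutoff_idem.
exists (@mksub _ _ (ideal_sub X) n _ fx : idl X n); split.
  by apply/sub_cocycle; rewrite /= linearZ /= dx scaler0.
apply: idl_boundary; rewrite -ky !linearB linearZ /= linearZ -scalerBr.
exact: is_boundaryZ.
Qed.

(** The numerator of a fraction out of an I-fixed complex lands in IZ, and the denominator restricts
    to a quasi-isomorphism IY -> IZ. With [idl_uniq], I is a coreflection in D(R). *)
Lemma idl_lift X Y (x : dhom X Y) : (forall n (x : X n), cutoff_fixed x) ->
  exists z : dhom X (idl Y), dmap (idl_in Y) \c z = x.
Proof.
move=> IX; have [Z [f [s [qs ->]]]] := fracP x.
have fZ n (c : X n) : ideal_sub Z n (f n c) by exact: cutoff_fixed_linear.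
exists (dinv (idl_qis qs) \c dmap (sub_core fZ)).
apply: (dinv_inj qs); rewrite fracE !dcompA dmapK dcomp1m -dmap_comp.
have -> : dmap (ch_comp s (idl_in Y)) = dmap (ch_comp (idl_in Z) (idl_map s)).
  exact: dmap_eq.
rewrite dmap_comp.
by rewrite -[_ \c dinv _]dcompA dmapK dcompm1 -dmap_comp; apply: dmap_eq.
Qed.

(** Since IY -> Y is injective on cohomology, the difference of the numerators is zero on
    cohomology, and [null_homotopic] applies to it. *)
Lemma idl_uniq X Y (x y : dhom X (idl Y)) : (forall n (x : X n), cutoff_fixed x) ->
  dmap (idl_in Y) \c x = dmap (idl_in Y) \c y -> x = y.
Proof.
move=> IX; have [Z [f [g [s [qs [-> ->]]]]]] := frac_common2 x y.
have [W [a [b [ab qb]]]] := homotopy_square (idl_in Y) qs.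
have qbi := qis_comp qb (qis_id Y).
rewrite !(frac_comp _ qs (qis_id _) qbi ab qb) => /frac_inj[V [k [qk kP]]].
apply: frac_homotopic; last exact: homotopic_refl.
have fg : homotopic (ch_add f (ch_opp g)) (ch_zero X Z).
  apply: null_homotopic => // n c dc /=; have := homotopic_boundary kP dc.
  rewrite /= -!linearB => bk.
  have dz : cx_d Z n (f n c - g n c) = 0.
    by rewrite linearB /= -!cmap_d dc !linear0 addr0.
  have {}bk : is_boundary (a n (f n c - g n c)).
    by apply: ((qisP k).1 qk n).1 bk; exact: cx_d_cmap.
  (* [e] represents in IY the class of the difference; it suffices that [e] bounds, which is tested
     in [W] through the quasi-isomorphism [b]. *)
  have [e [de be]] := ((qisP s).1 qs n).2 _ dz.
  rewrite -[_ - _](subrK (s n e)); apply: is_boundaryD => //; apply: is_boundary_cmap.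
  apply: idl_boundary; apply: ((qisP b).1 qb n).1; first exact: (cx_d_cmap (idl_in Y) de).
  have bab := homotopic_boundary ab de.
  rewrite -[b n _](subrK (a n (s n e))); apply: is_boundaryD.
    by rewrite -opprB; apply: is_boundaryN.
  rewrite -[a n _](subrK (a n (f n c - g n c))); apply: is_boundaryD => //.
  by rewrite -linearB -opprB linearN; apply/is_boundaryN/is_boundary_cmap.
by case: fg => h hP; exists h => n c; rewrite -hP /= subr0.
Qed.

End Predicates.

(** * Splitting objects of the heart *)

Section Truncation.
Variable X : cx.

(** The canonical truncation to degrees <= -1: everything below -1, cocycles in degree -1.
    Implications on [n] replace a definition of the terms by cases. *)
Definition tau_pred n (x : X n) := (-1 <= n -> cx_d X n x = 0) /\ (-1 < n -> x = 0).

Lemma tau_pred0 n : tau_pred (0 : X n).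
Proof. by split=> // _; rewrite linear0. Qed.

Lemma tau_predP n (a : prodZ2) (u v : X n) :
  tau_pred u -> tau_pred v -> tau_pred (a *: u + v).
Proof.
move=> [du u0] [dv v0]; split=> hn; first by rewrite linearP /= du // dv // scaler0 addr0.
by rewrite u0 // v0 // scaler0 addr0.
Qed.

Lemma tau_pred_d n (x : X n) : tau_pred x -> tau_pred (cx_d X n x).
Proof. by move=> [dx x0]; split=> hn; [exact: cx_dd|apply: dx; lia]. Qed.

Definition tau_sub : subcx X := Subcx tau_pred0 tau_predP tau_pred_d.
Definition tau : cx := subc tau_sub.
Definition tau_in : chmap tau X := sub_in tau_sub.

Lemma tau_boundary n (x : tau n) : is_boundary (tau_in n x) -> is_boundary x.
Proof.
move: n x; apply: int_succP => n x /is_boundaryS[y xy].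
apply/sub_boundaryS; have [nl|nl] := leP (-1) n.
  by exists 0; [exact: tau_pred0|rewrite linear0; apply: (sub_eltP x).2; lia].
by exists y => //; split=> hn; lia.
Qed.

Lemma tau_surj n (c : X n) : (0 <= n -> coh_zero n X) -> cx_d X n c = 0 ->
  exists x, cx_d tau n x = 0 /\ is_boundary (c - tau_in n x).
Proof.
move=> zX dc; have [nl|nl] := leP 0 n.
  exists 0; rewrite !linear0 addr0; split=> //; exact: zX.
have tc : tau_sub n c by split=> hn //; lia.
exists (mksub tc); split; first exact/sub_cocycle.
by rewrite subrr; exact: is_boundary0.
Qed.

Lemma tau_qis : (forall n, 0 <= n -> coh_zero n X) -> qis tau_in.
Proof.
move=> zX; apply/qisP => n; split=> [x _|c]; first exact: tau_boundary.
by apply: tau_surj; exact: zX.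
Qed.

(** The kernel of the canonical truncation to degrees >= -1: everything below -1, boundaries in
    degree -1. Using this subcomplex avoids the quotient complex. *)
Definition low_pred n (x : X n) := (-1 <= n -> is_boundary x) /\ (-1 < n -> x = 0).

Lemma low_pred0 n : low_pred (0 : X n).
Proof. by split=> // _; exact: is_boundary0. Qed.

Lemma low_predP n (a : prodZ2) (u v : X n) :
  low_pred u -> low_pred v -> low_pred (a *: u + v).
Proof.
move=> [bu u0] [bv v0]; split=> hn; first by apply: is_boundary_P; [exact: bu|exact: bv].
by rewrite u0 // v0 // scaler0 addr0.
Qed.

Lemma low_pred_d n (x : X n) : low_pred x -> low_pred (cx_d X n x).
Proof.
move=> [bx x0]; split=> hn; first by constructor.
by apply: boundary_cocycle; apply: bx; lia.
Qed.

Definition low_sub : subcx X := Subcx low_pred0 low_predP low_pred_d.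

Lemma low_acyclic : (forall n, n < -1 -> coh_zero n X) -> acyclic (subc low_sub).
Proof.
move=> zX; apply: int_succP => n x /sub_cocycle dx; apply/sub_boundaryS.
have [bx x0] := sub_eltP x; have [nl|nl] := leP (-1) n.
  by exists 0; [exact: low_pred0|rewrite linear0; apply: x0; lia].
have /is_boundaryS[y xy] : is_boundary (sub_val x).
  have [nl'|nl'] := leP (-1) (n + 1); first exact: bx.
  by apply: zX.
by exists y => //; split=> hn; lia.
Qed.

End Truncation.

(* A morphism between objects concentrated in degrees <= -1 and >= -1 is
   determined by its effect on H^-1. *)
Lemma truncation_vanish (X Y : cx) :
  (forall n, 0 <= n -> coh_zero n X) -> (forall n, n < -1 -> coh_zero n Y) ->
  coh_orth (-1) X Y -> forall x y : dhom X Y, x = y.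
Proof.
move=> zX zY oXY; apply: dhom_trivial => x; have [Z [f [s [qs ->]]]] := fracP x.
apply: (dinv_epi (tau_qis zX)); rewrite dcomp0r fracE -dcompA -dmap_comp.
(* In degree -1 orthogonality makes [f] send cocycles to boundaries, so the restriction to [tau X]
   factors through a subcomplex that is acyclic. *)
have fl n (c : tau X n) : low_sub Z n (ch_comp f (tau_in X) n c).
  have [dc c0] := sub_eltP c; split=> hn; last by rewrite /= c0 // linear0.
  have [n1|n1] := eqVneq n (-1); last first.
    by rewrite /= c0; [rewrite linear0; exact: is_boundary0|lia].
  apply: (orth_boundary f qs); first by rewrite n1.
  exact: dc.
have -> : dmap (ch_comp f (tau_in X)) = dmap (sub_in (low_sub Z)) \c dmap (sub_core fl).
  by rewrite -dmap_comp; exact: dmap_eq.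
rewrite (@acyclic_dmap0 _ _ _ (sub_in (low_sub Z))) ?dcomp0r ?dcompr0 //.
by apply: low_acyclic => n /zY; exact: coh_zero_qis.
Qed.

(** * The quotient by the I part *)

Section QuotientPart.
Variable X : cx.

(* A model of X/IX that needs no quotient modules: I is exact on complexes, so
   cone (IX -> X) is quasi-isomorphic to X/IX. *)
Definition quo : cx := cone (idl_in X).
Definition quo_in : chmap X quo := cone_in (idl_in X).

Lemma quo_in0 : dmap quo_in \c dmap (idl_in X) = dzero (idl X) quo.
Proof.
rewrite -dmap_comp; apply: dmap_homotopic.
have lh n : linear (fun x : idl X (n + 1) => (x, 0) : quo n).
  by move=> a u v; congr pair; rewrite /= scaler0 addr0.
apply: (homotopicP lh) => n x; congr pair; rewrite /= ?subr0 ?addNr //.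
by rewrite linear0 !addr0.
Qed.

(** A cocycle (y, x) has d x = -y. If [cutoff k] fixes y, then x minus [cutoff k *: x] is a cocycle
    of [X] in the same class. *)
Lemma quo_class n (q : quo n) : cx_d quo n q = 0 ->
  exists c, cx_d X n c = 0 /\ is_boundary (q - quo_in n c).
Proof.
move: n q; apply: int_succP => n [y x] [_ yx].
have [k ky] := idl_fixed y.
have kyv : cutoff k *: sub_val y = sub_val y by rewrite -[in RHS]ky.
have dx : cx_d X _ x = - sub_val y.
  by apply/eqP; rewrite -addr_eq0; apply/eqP; exact: etrans (addrC _ _) yx.
exists (x - cutoff k *: x); split.
  by rewrite linearB linearZ /= dx scalerN kyv subrr.
have fx : ideal_sub X _ (cutoff k *: x) by exists k; rewrite cutoff_idem.
apply: (@boundaryS _ quo n _ (mksub fx, 0)); congr pair.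
  rewrite /= subr0; apply: sub_val_inj.
  by rewrite /= linearZ /= dx scalerN kyv opprK.
by rewrite /= linear0 addr0 subKr.
Qed.

(** With [quo_class] and [boundary_quo], this identifies H^n([quo X]) with H^n(X)/IH^n(X). *)
Lemma quo_boundary n (c : X n) : is_boundary (quo_in n c) ->
  exists k, is_boundary (c - cutoff k *: c).
Proof.
move: n c; apply: int_succP => n c /is_boundaryS[[y z] [/= dy ->]].
have [k ky] := idl_fixed y; exists k.
have kyv : cutoff k *: sub_val y = sub_val y by rewrite -[in RHS]ky.
rewrite scalerDr kyv opprD addrACA subrr add0r -linearZ -linearB; constructor.
Qed.

Lemma boundary_quo n (c : X n) k : cx_d X n c = 0 -> is_boundary (c - cutoff k *: c) ->
  is_boundary (quo_in n c).
Proof.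
move: n c; apply: int_succP => n c dc /is_boundaryS[z zc].
have fc : ideal_sub X _ (cutoff k *: c) by exists k; rewrite cutoff_idem.
apply: (@boundaryS _ quo n _ (mksub fc, z)); congr pair; rewrite /=.
  by rewrite -[LHS]oppr0; congr (- _); apply: sub_val_inj; rewrite /= linearZ /= dc scaler0.
by rewrite -zc [RHS]addrC subrK.
Qed.

Lemma quo_tfree n : coh_tfree n quo.
Proof.
move=> q dq k; have [c [dc b]] := quo_class dq.
rewrite -[q](subrK (quo_in n c)) scalerDr -linearZ.
apply: is_boundaryD; first exact: is_boundaryZ.
apply: (@boundary_quo _ _ k); first by rewrite linearZ /= dc scaler0.
by rewrite cutoff_idem subrr; exact: is_boundary0.
Qed.

Lemma quo_zero n : coh_tors n X -> coh_zero n quo.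
Proof.
move=> tX q dq; have [c [dc b]] := quo_class dq.
rewrite -[q](subrK (quo_in n c)); apply: is_boundaryD => //.
by have [k bk] := tX c dc; exact: boundary_quo bk.
Qed.

End QuotientPart.

(* pre_heart drops the condition that H^0 be I-torsion, which products do not
   preserve. *)
Definition pre_heart (X : cx) := forall n,
  [/\ 0 < n -> coh_zero n X, n < -1 -> coh_zero n X & n = -1 -> coh_tfree n X].
Definition in_heart (X : cx) := pre_heart X /\ coh_tors 0 X.

(** * Orthogonality and splitting in the heart *)

Section Heart.
Implicit Types A X Y : cx.

Lemma in_heart_tors X n : in_heart X -> n != -1 -> coh_tors n X.
Proof.
move=> [pX tX] n1; have [->|n0] := eqVneq n 0; first exact: tX.
apply: coh_zero_tors; have [zp zn _] := pX n.
by have [n0'|n0'] := ltP 0 n; [exact: zp|apply: zn; lia].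
Qed.

Lemma pre_heart_tfree X n : pre_heart X -> n != 0 -> coh_tfree n X.
Proof.
move=> pX n0; have [zp zn tf] := pX n; have [n1|n1] := eqVneq n (-1); first exact: tf.
apply: coh_zero_tfree.
by have [n0'|n0'] := ltP 0 n; [exact: zp|apply: zn; lia].
Qed.

Lemma quo_heart_zero X n : in_heart X -> n != -1 -> coh_zero n (quo X).
Proof. by move=> hX n1; apply: quo_zero; exact: in_heart_tors. Qed.

Lemma idl_heart_zero X n : pre_heart X -> n != 0 -> coh_zero n (idl X).
Proof. by move=> pX n0; apply: idl_zero; exact: pre_heart_tfree. Qed.

Lemma quo_idl_vanish A X (x y : dhom (quo A) (idl X)) :
  in_heart A -> pre_heart X -> x = y.
Proof.
move=> hA pX; apply: truncation_vanish.
- by move=> n n0; apply: quo_heart_zero => //; lia.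
- by move=> n n0; apply: idl_heart_zero => //; lia.
by right; split; [exact: quo_tfree|exact: idl_tors].
Qed.

(** Both complexes have cohomology only in degree -1, one in T_I and the other in C_I, so
    orthogonality is essential here. *)
Lemma quo_shift_idl_vanish A X (x y : dhom (quo A) (shift (idl X))) :
  in_heart A -> pre_heart X -> x = y.
Proof.
move=> hA pX; apply: truncation_vanish.
- by move=> n n0; apply: quo_heart_zero => //; lia.
- by move=> n n0; apply/coh_zero_shift/idl_heart_zero => //; lia.
by right; split; [exact: quo_tfree|apply/coh_tors_shift/idl_tors].
Qed.

(** An Ext^1 between the H^0 modules; the projectivity behind [null_homotopic] kills it. *)
Lemma idl_shift_idl_vanish A X (x y : dhom (idl A) (shift (idl X))) :
  pre_heart A -> pre_heart X -> x = y.
Proof.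
move=> pA pX; apply: cutoff_fixed_vanish => [n c|n]; first exact: idl_fixed.
have [->|n0] := eqVneq n 0; last first.
  right; split; last exact/coh_tors_shift/idl_tors.
  exact/coh_zero_tfree/idl_heart_zero.
left; split; first exact: idl_tors.
by apply/coh_zero_tfree/coh_zero_shift/idl_heart_zero.
Qed.

Section Splitting.
Variable X : cx.
Hypothesis hX : in_heart X.

Lemma split_linear n :
  linear (fun p : dsum (idl X) (tau X) n => idl_in X n p.1 + tau_in X n p.2).
Proof. by move=> a u v; rewrite /= scalerDr addrACA. Qed.

Lemma split_d n p : mklin (@split_linear (n + 1)) (cx_d (dsum (idl X) (tau X)) n p) =
  cx_d X n (mklin (@split_linear n) p).
Proof. by rewrite /= linearD. Qed.

Definition split_map : chmap (dsum (idl X) (tau X)) X := Chmap split_d.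

(** IX carries exactly H^0, because H^0(X) is in C_I and IX has no other cohomology; [tau X] carries
    the remaining degrees. *)
Lemma split_qis : qis split_map.
Proof.
have [pX tX] := hX; apply/qisP => n; split=> [[x y] dxy b|c dc].
  have dx : cx_d (idl X) n x = 0 by have := congr1 (fun p => p.1 : idl X (n + 1)) dxy.
  have bx : is_boundary x.
    have [n0|n0] := eqVneq n 0; last exact: (idl_heart_zero pX n0 dx).
    have y0 : sub_val y = 0 by have [_ y0] := sub_eltP y; apply: y0; rewrite ?n0; lia.
    by apply: idl_boundary; move: b; rewrite /= y0 addr0.
  apply/dsum_boundaryP; split=> //; apply: tau_boundary.
  have -> : tau_in X n y = split_map n (x, y) - idl_in X n x by rewrite /= addrC addKr.
  by apply: is_boundaryB => //; exact: is_boundary_cmap.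
have [n0|n0] := eqVneq n 0.
  have [k bk] : exists k, is_boundary (c - cutoff k *: c).
    by case: _ / (esym n0) in c dc *; exact: tX.
  have fc : ideal_sub X n (cutoff k *: c) by exists k; rewrite cutoff_idem.
  exists (mksub fc : idl X n, 0); split; last by rewrite /= addr0.
  congr pair; last exact: linear0.
  by apply: sub_val_inj; rewrite /= linearZ /= dc scaler0.
have [|x [dx bx]] := @tau_surj X n c _ dc.
  by move=> n0' ; have [zp _ _] := pX n; apply: zp; lia.
by exists (0, x); split; [congr pair; rewrite // linear0|rewrite /= add0r].
Qed.

(** The complement [tau X] of IX is thus a model of X/IX that maps to [X]; this provides the section
    of X -> X/IX. *)
Lemma quo_tau_qis : qis (ch_comp (quo_in X) (tau_in X)).
Proof.
have [pX tX] := hX; apply/qisP => n; split=> [y dy /quo_boundary[k bk]|q dq].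
  apply: tau_boundary; rewrite -[tau_in X n y](subrK (cutoff k *: tau_in X n y)).
  apply: is_boundaryD => //.
  have [n0|n0] := eqVneq n 0; last first.
    by apply: pre_heart_tfree => //; exact: (cx_d_cmap (tau_in X) dy).
  have y0 : sub_val y = 0 by have [_ y0] := sub_eltP y; apply: y0; rewrite ?n0; lia.
  by rewrite /= y0 scaler0; exact: is_boundary0.
have [c [dc bc]] := quo_class dq.
have [n0|n0] := leP 0 n.
  exists 0; rewrite !linear0 addr0; split=> //.
  by apply: quo_heart_zero => //; lia.
have [|x [dx bx]] := @tau_surj X n c _ dc; first by lia.
exists x; split=> //; rewrite -[q](subrK (quo_in X n c)) -addrA.
by apply: is_boundaryD => //; rewrite -linearB; exact: is_boundary_cmap.
Qed.

Lemma heart_split : exists (r : dhom X (idl X)) (s : dhom (quo X) X),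
  [/\ r \c dmap (idl_in X) = did _, dmap (quo_in X) \c s = did _,
      r \c s = dzero _ _ & (dmap (idl_in X) \c r) \p (s \c dmap (quo_in X)) = did X].
Proof.
pose m := dinv split_qis; pose q := dinv quo_tau_qis.
have i1 : dmap (idl_in X) = dmap split_map \c dmap (dsum_in1 _ _).
  by rewrite -dmap_comp; apply: dmap_eq => n x; rewrite /= addr0.
have i2 : dmap (tau_in X) = dmap split_map \c dmap (dsum_in2 _ _).
  by rewrite -dmap_comp; apply: dmap_eq => n x; rewrite /= add0r.
exists (dmap (dsum_pr1 _ _) \c m), (dmap (tau_in X) \c q); split.
- by rewrite -dcompA i1 [m \c _]dcompA dinvK dcomp1m -dmap_comp; exact: dmap_eq.
- by rewrite dcompA -dmap_comp dmapK.
- rewrite i2 dcompA -[_ \c m \c _]dcompA [m \c _]dcompA dinvK dcomp1m -dmap_comp.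
  rewrite (_ : dmap _ = dzero _ _) ?dcomp0r //; exact: dmap_eq.
apply: (dinv_epi split_qis); rewrite dcomp1m dcompDl.
rewrite -dcompA -[_ \c m \c _]dcompA dinvK dcompm1 -dmap_comp.
have eq : dmap split_map = dmap (ch_comp (idl_in X) (dsum_pr1 _ _)) \p
    dmap (ch_comp (tau_in X) (dsum_pr2 _ _)).
  by rewrite -dmap_add; exact: dmap_eq.
rewrite -[_ \c dmap split_map]dcompA eq dcompDr !dmap_comp [_ \c (_ \c dmap (dsum_pr1 _ _))]dcompA.
rewrite quo_in0 dcomp0r dadd0 [_ \c (_ \c dmap (dsum_pr2 _ _))]dcompA.
rewrite -[dmap (quo_in X) \c _]dmap_comp.
by rewrite -[_ \c q \c _]dcompA [q \c _]dcompA dinvK dcomp1m.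
Qed.

End Splitting.
End Heart.

(** * Products in the heart *)

Section HeartDecomposition.
Variables (X : cx) (hX : in_heart X).

Definition heart_retr : dhom X (idl X) := sval (cid (heart_split hX)).
Definition heart_sect : dhom (quo X) X := sval (cid (svalP (cid (heart_split hX)))).

Lemma heart_splitP :
  [/\ heart_retr \c dmap (idl_in X) = did _, dmap (quo_in X) \c heart_sect = did _,
      heart_retr \c heart_sect = dzero _ _ &
      (dmap (idl_in X) \c heart_retr) \p (heart_sect \c dmap (quo_in X)) = did X].
Proof. exact: (svalP (cid (svalP (cid (heart_split hX))))). Qed.

Lemma heart_epi Y (x y : dhom X Y) : x \c dmap (idl_in X) = y \c dmap (idl_in X) ->
  x \c heart_sect = y \c heart_sect -> x = y.
Proof.
have [_ _ _ e] := heart_splitP => xi xs.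
by rewrite -[x]dcompm1 -[y]dcompm1 -e !dcompDr !dcompA xi xs.
Qed.

Lemma heart_mono A (x y : dhom A X) : heart_retr \c x = heart_retr \c y ->
  dmap (quo_in X) \c x = dmap (quo_in X) \c y -> x = y.
Proof.
have [_ _ _ e] := heart_splitP => xi xs.
by rewrite -[x]dcomp1m -[y]dcomp1m -e !dcompDl -!dcompA xi xs.
Qed.

Lemma heart_shift_mono A (x y : dhom A (shift X)) :
  dshift heart_retr \c x = dshift heart_retr \c y ->
  dshift (dmap (quo_in X)) \c x = dshift (dmap (quo_in X)) \c y -> x = y.
Proof.
have [_ _ _ e] := heart_splitP => xi xs.
rewrite -[x]dcomp1m -[y]dcomp1m -dshift1 -e dshiftD !dshift_comp !dcompDl.
by rewrite -!dcompA xi xs.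
Qed.

(** Neither summand of [X] maps to Sigma IY, so extensions do not see I parts. Asking only
    [pre_heart Y] lets it apply to termwise products. *)
Lemma heart_shift_idl_vanish Y (x y : dhom X (shift (idl Y))) : pre_heart Y -> x = y.
Proof.
move=> pY; apply: heart_epi; last exact: quo_shift_idl_vanish.
by apply: idl_shift_idl_vanish => //; case: hX.
Qed.

End HeartDecomposition.

(** * Cones of sums, products, I parts and quotients *)

Section ChainCones.
Variable R : pzRingType.
Implicit Types X Y : complex R.

Section DsumCone.
Variables (X Y X' Y' : complex R) (f : chmap X X') (g : chmap Y Y').

Lemma dsum_cone_linear n : linear (fun p : dsum (cone f) (cone g) n =>
  ((p.1.1, p.2.1), (p.1.2, p.2.2)) : cone (dsum_map f g) n).
Proof. by []. Qed.

Lemma dsum_cone_d n p :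
  mklin (@dsum_cone_linear (n + 1)) (cx_d (dsum (cone f) (cone g)) n p) =
  cx_d (cone (dsum_map f g)) n (mklin (@dsum_cone_linear n) p).
Proof. by []. Qed.

Definition dsum_cone : chmap (dsum (cone f) (cone g)) (cone (dsum_map f g)) :=
  Chmap dsum_cone_d.

Lemma dsum_cone_qis : qis dsum_cone.
Proof.
apply: bijective_qis => [n [[a b] [c d]] [[a' b'] [c' d']] [-> -> -> ->] //|n].
by move=> [[a c] [b d]]; exists ((a, b), (c, d)).
Qed.

End DsumCone.

Section ProductCone.
Variables (J : Type) (X Y : J -> complex R) (f : forall j, chmap (X j) (Y j)).

Lemma pc_cone_linear n : linear (fun x : prodc (fun j => cone (f j)) n =>
  ((fun j => (x j).1), (fun j => (x j).2)) : cone (pc_map f) n).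
Proof. by []. Qed.

Lemma pc_cone_d n x :
  mklin (@pc_cone_linear (n + 1)) (cx_d (prodc (fun j => cone (f j))) n x) =
  cx_d (cone (pc_map f)) n (mklin (@pc_cone_linear n) x).
Proof. by []. Qed.

Definition pc_cone : chmap (prodc (fun j => cone (f j))) (cone (pc_map f)) :=
  Chmap pc_cone_d.

Lemma pc_cone_qis : qis pc_cone.
Proof.
apply: bijective_qis => [n x y [e1 e2]|n [u v]]; last by exists (fun j => (u j, v j)).
apply/functional_extensionality_dep => j.
have := congr1 (fun h => h j) e1; have := congr1 (fun h => h j) e2.
by case: (x j) (y j) => [? ?] [? ?] /= -> ->.
Qed.

End ProductCone.
End ChainCones.

Section IdealCone.
Variables (X Y : cx) (f : chmap X Y).

Lemma cutoff_fixed_fst (M N : lmodType prodZ2) (p : M * N) : cutoff_fixed p -> cutoff_fixed p.1.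
Proof. by case=> k pk; exists k; rewrite -[in RHS]pk. Qed.

Lemma cutoff_fixed_snd (M N : lmodType prodZ2) (p : M * N) : cutoff_fixed p -> cutoff_fixed p.2.
Proof. by case=> k pk; exists k; rewrite -[in RHS]pk. Qed.

Definition idl_cone_f n (x : idl (cone f) n) : cone (idl_map f) n :=
  (@mksub _ _ (ideal_sub X) (n + 1) _ (cutoff_fixed_fst (sub_eltP x)),
   @mksub _ _ (ideal_sub Y) n _ (cutoff_fixed_snd (sub_eltP x))).

Lemma idl_cone_linear n : linear (@idl_cone_f n).
Proof. by move=> a u v; congr pair; apply: sub_val_inj. Qed.

Lemma idl_cone_d n x :
  mklin (@idl_cone_linear (n + 1)) (cx_d (idl (cone f)) n x) =
  cx_d (cone (idl_map f)) n (mklin (@idl_cone_linear n) x).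
Proof. by congr pair; apply: sub_val_inj. Qed.

Definition idl_cone : chmap (idl (cone f)) (cone (idl_map f)) := Chmap idl_cone_d.

Lemma idl_cone_bij n : injective (idl_cone n) /\ forall y, exists x, idl_cone n x = y.
Proof.
split=> [x y xy|[u v]].
  apply: sub_val_inj; case: x y xy => [[a b] ?] [[a' b'] ?] xy /=.
  have /= -> := congr1 (fun p => sub_val (p.1 : idl X (n + 1))) xy.
  by have /= -> := congr1 (fun p => sub_val (p.2 : idl Y n)) xy.
have fuv : ideal_sub (cone f) n (sub_val u, sub_val v).
  have [k ku] := sub_eltP u; have [l lv] := sub_eltP v; exists (maxn k l).
  congr pair; first exact: cutoff_le (leq_maxl k l) ku.
  exact: cutoff_le (leq_maxr k l) lv.
by exists (mksub fuv); congr pair; apply: sub_val_inj.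
Qed.

Lemma idl_cone_qis : qis idl_cone.
Proof. by apply: bijective_qis => n; case: (idl_cone_bij n). Qed.

Definition quo_map_f n (p : quo X n) : quo Y n := (idl_map f (n + 1) p.1, f n p.2).

Lemma quo_map_linear n : linear (@quo_map_f n).
Proof. by move=> a u v; congr pair; rewrite linearP. Qed.

Lemma quo_map_d n p : mklin (@quo_map_linear (n + 1)) (cx_d (quo X) n p) =
  cx_d (quo Y) n (mklin (@quo_map_linear n) p).
Proof.
congr pair; first by rewrite linearN (cmap_d (idl_map f)).
by rewrite /= linearD cmap_d.
Qed.

Definition quo_map : chmap (quo X) (quo Y) := Chmap quo_map_d.
End IdealCone.

Section QuotientCone.
Variables (X Y : cx) (f : chmap X Y).

(** Interchanges two cone constructions; the component shifted twice carries a sign so that the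
    differentials match. *)
Definition quo_cone_f n (p : quo (cone f) n) : cone (quo_map f) n :=
  ((- (idl_cone f (n + 1) p.1).1, p.2.1), ((idl_cone f (n + 1) p.1).2, p.2.2)).

Lemma quo_cone_linear n : linear (@quo_cone_f n).
Proof.
move=> a u v; congr pair; congr pair; rewrite ?[(a *: u + v).1]/(a *: u.1 + v.1) linearP //=.
by rewrite scalerN opprD.
Qed.

Lemma quo_cone_d n p : mklin (@quo_cone_linear (n + 1)) (cx_d (quo (cone f)) n p) =
  cx_d (cone (quo_map f)) n (mklin (@quo_cone_linear n) p).
Proof.
case: p => p [a b]; congr pair; congr pair => /=.
- by apply: sub_val_inj; rewrite /= (linearN (cx_d X _)).
- by rewrite opprD opprK.
- by apply: sub_val_inj; rewrite /= (linearN (f _)) opprD.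
by rewrite [LHS]addrCA.
Qed.

Definition quo_cone : chmap (quo (cone f)) (cone (quo_map f)) := Chmap quo_cone_d.

Lemma quo_cone_qis : qis quo_cone.
Proof.
apply: bijective_qis => n; have [iI iS] := idl_cone_bij f (n + 1).
  move=> [p [a b]] [p' [a' b']] e.
  have /= -> := congr1 (fun q => (q.1.2 : X (n + 1))) e.
  have /= -> := congr1 (fun q => (q.2.2 : Y n)) e.
  have /= /oppr_inj e1 := congr1 (fun q => (q.1.1 : idl X _)) e.
  have /= e2 := congr1 (fun q => (q.2.1 : idl Y _)) e.
  by congr (_, _); apply: iI; congr pair.
move=> [[a' a] [b' b]]; have [p pP] := iS (- a', b'); exists (p, (a, b)).
have e1 : - (idl_cone f (n + 1) p).1 = a' by rewrite pP opprK.
have e2 : (idl_cone f (n + 1) p).2 = b' by rewrite pP.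
by congr pair; congr pair.
Qed.

End QuotientCone.

(** * The product functor F *)

Section HeartProduct.
Variables (J : Type).
Implicit Types X Y : J -> cx.

Lemma prodc_pre_heart Y : (forall j, in_heart (Y j)) -> pre_heart (prodc Y).
Proof.
move=> hY n; split=> nn c dc; last move=> k; apply/pc_boundary => j;
  have dcj := cx_d_cmap (pc_proj Y j) dc; have [pY _] := hY j; have [zp zn tf] := pY n.
- exact: zp.
- exact: zn.
exact: (tf nn _ dcj k).
Qed.

(* The functor F of the header. *)
Definition hprod Y : cx := dsum (idl (prodc Y)) (prodc (fun j => quo (Y j))).

Lemma hprod_heart Y : (forall j, in_heart (Y j)) -> in_heart (hprod Y).
Proof.
move=> hY; have pY := prodc_pre_heart hY.
have zq n : n != -1 -> coh_zero n (prodc (fun j => quo (Y j))).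
  move=> n1 c dc; apply/pc_boundary => j; apply: quo_heart_zero => //.
  exact: (cx_d_cmap (pc_proj (fun j => quo (Y j)) j) dc).
have zi n : n != 0 -> coh_zero n (idl (prodc Y)) by exact: idl_heart_zero.
have z n : n != 0 -> n != -1 -> coh_zero n (hprod Y).
  move=> n0 n1 c dc; apply/dsum_boundaryP; split.
    by apply: zi => //; exact: (cx_d_cmap (dsum_pr1 _ _) dc).
  by apply: zq => //; exact: (cx_d_cmap (dsum_pr2 _ _) dc).
split=> [n|c dc].
  split=> nn; [by apply: z; lia|by apply: z; lia|].
  move=> c dc k; apply/dsum_boundaryP; split.
    apply/is_boundaryZ/zi; first by lia.
    exact: (cx_d_cmap (dsum_pr1 _ _) dc).
  apply/pc_boundary => j; apply: quo_tfree.
  by rewrite -[LHS]/((cx_d _ n c).2 j) dc.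
have [k bk] := idl_tors (cx_d_cmap (dsum_pr1 _ _) dc).
exists k; apply/dsum_boundaryP; split=> //.
have b2 : is_boundary c.2 by apply: zq => //; exact: (cx_d_cmap (dsum_pr2 _ _) dc).
by apply: is_boundaryB => //; exact: is_boundaryZ.
Qed.

Definition hprod_idl Y j : chmap (hprod Y) (idl (Y j)) :=
  ch_comp (idl_map (pc_proj Y j)) (dsum_pr1 _ _).

Definition hprod_quo Y j : chmap (hprod Y) (quo (Y j)) :=
  ch_comp (pc_proj (fun j => quo (Y j)) j) (dsum_pr2 _ _).

(** The quotient part reaches Y_j only through the section of Y_j -> Y_j/IY_j, so these are
    morphisms of D(R), not chain maps. *)
Definition hprod_proj Y (hY : forall j, in_heart (Y j)) j : dhom (hprod Y) (Y j) :=
  (dmap (idl_in (Y j)) \c dmap (hprod_idl Y j)) \p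
  (heart_sect (hY j) \c dmap (hprod_quo Y j)).

Section Projections.
Variables (Y : J -> cx) (hY : forall j, in_heart (Y j)).
Local Notation p := (hprod_proj hY).
Local Notation rY j := (heart_retr (hY j)).
Local Notation rho X := (dmap (quo_in X)).

Lemma retr_hprod_proj j : rY j \c p j = dmap (hprod_idl Y j).
Proof.
have [ri _ rs _] := heart_splitP (hY j).
by rewrite dcompDr !dcompA ri rs dcomp1m dcomp0r dadd0r.
Qed.

Lemma quo_hprod_proj j : rho (Y j) \c p j = dmap (hprod_quo Y j).
Proof.
have [_ rs _ _] := heart_splitP (hY j).
by rewrite dcompDr !dcompA quo_in0 rs dcomp1m dcomp0r dadd0.
Qed.

Variables (A : cx) (hA : in_heart A).

(** The quotient coordinate is settled by the termwise product. The I coordinate vanishes on A/IA,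
    and on IA it is determined by its composite into the termwise product ([idl_uniq]). *)
Lemma hprod_uniq (x y : dhom A (hprod Y)) : (forall j, p j \c x = p j \c y) -> x = y.
Proof.
move=> pxy; apply: dsum_dhom_uniq; last first.
  apply: pc_dhom_uniq => j; rewrite !dcompA -dmap_comp -/(hprod_quo Y j).
  by rewrite -quo_hprod_proj -!dcompA pxy.
have pY := prodc_pre_heart hY.
apply: (heart_epi (hX := hA)); last exact: quo_idl_vanish.
apply: idl_uniq; first exact: idl_fixed.
apply: pc_dhom_uniq => j.
have e : dmap (pc_proj Y j) \c dmap (idl_in (prodc Y)) \c dmap (dsum_pr1 _ _) =
    dmap (idl_in (Y j)) \c (rY j \c p j).
  by rewrite retr_hprod_proj -!dmap_comp; exact: dmap_eq.
by rewrite !dcompA; congr (_ \c _); rewrite e -!dcompA pxy.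
Qed.

(** The I coordinate is built on IA, where a map to the termwise product lifts to its I part, and is
    extended to [A] by the retraction. *)
Lemma hprod_tuple (y : forall j, dhom A (Y j)) :
  exists x : dhom A (hprod Y), forall j, p j \c x = y j.
Proof.
have [ri rs rs0 re] := heart_splitP hA.
have [u uP] := pc_dhom_tuple (fun j => y j \c dmap (idl_in A)).
have [z zu] : exists z, dmap (idl_in (prodc Y)) \c z = u.
  by apply: idl_lift; exact: idl_fixed.
have [v vP] := pc_dhom_tuple (fun j => rho (Y j) \c y j).
exists ((dmap (dsum_in1 _ _) \c (z \c heart_retr hA)) \p (dmap (dsum_in2 _ _) \c v)) => j.
have i1 : dmap (hprod_idl Y j) \c dmap (dsum_in1 _ _) = dmap (idl_map (pc_proj Y j)).
  by rewrite -dmap_comp; exact: dmap_eq.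
have i2 : dmap (hprod_idl Y j) \c dmap (dsum_in2 _ _) = dzero _ _.
  by rewrite -dmap_comp; apply: dmap_eq => n c; apply: sub_val_inj.
have q1 : dmap (hprod_quo Y j) \c dmap (dsum_in1 _ _) = dzero _ _.
  by rewrite -dmap_comp; exact: dmap_eq.
have q2 : dmap (hprod_quo Y j) \c dmap (dsum_in2 _ _) = dmap (pc_proj _ j).
  by rewrite -dmap_comp; exact: dmap_eq.
apply: (heart_mono (hX := hY j)); rewrite dcompA ?retr_hprod_proj ?quo_hprod_proj dcompDr !dcompA.
  rewrite i1 i2 dcomp0r dadd0r; apply: (heart_epi (hX := hA)); last exact: quo_idl_vanish (hY j).1.
  rewrite -dcompA ri dcompm1.
  have [rj _ _ _] := heart_splitP (hY j).
  have -> : dmap (idl_map (pc_proj Y j)) \c z =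
      rY j \c (dmap (idl_in (Y j)) \c dmap (idl_map (pc_proj Y j))) \c z.
    by rewrite dcompA rj dcomp1m.
  have -> : dmap (idl_in (Y j)) \c dmap (idl_map (pc_proj Y j)) =
      dmap (pc_proj Y j) \c dmap (idl_in (prodc Y)).
    by rewrite -!dmap_comp; exact: dmap_eq.
  by rewrite -!dcompA zu uP.
by rewrite q1 q2 !dcomp0r dadd0 vP.
Qed.

Lemma hprod_shift_uniq (x y : dhom A (shift (hprod Y))) :
  (forall j, dshift (p j) \c x = dshift (p j) \c y) -> x = y.
Proof.
move=> pxy; apply: dsum_shift_dhom_uniq.
  exact: (heart_shift_idl_vanish hA _ _ (prodc_pre_heart hY)).
apply: pc_shift_dhom_uniq => j; rewrite !dcompA -dshift_comp -dmap_comp -/(hprod_quo Y j).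
by rewrite -quo_hprod_proj dshift_comp -!dcompA pxy.
Qed.

(** Only quotient coordinates matter for extensions, and those form a termwise product, with which
    the shift commutes. *)
Lemma hprod_shift_tuple (y : forall j, dhom A (shift (Y j))) :
  exists x : dhom A (shift (hprod Y)), forall j, dshift (p j) \c x = y j.
Proof.
have [v vP] := pc_shift_dhom_tuple (fun j => dshift (rho (Y j)) \c y j).
exists (dshift (dmap (dsum_in2 _ _)) \c v) => j.
apply: (heart_shift_mono (hX := hY j)).
  exact: (heart_shift_idl_vanish hA _ _ (hY j).1).
rewrite !dcompA -!dshift_comp quo_hprod_proj -dmap_comp -vP.
by congr (dshift _ \c _); exact: dmap_eq.
Qed.

End Projections.

Section Maps.
Variables (X Y : J -> cx) (f : forall j, chmap (X j) (Y j)).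
Variables (hX : forall j, in_heart (X j)) (hY : forall j, in_heart (Y j)).

Definition hprod_map : chmap (hprod X) (hprod Y) :=
  dsum_map (idl_map (pc_map f)) (pc_map (fun j => quo_map (f j))).

(** The retractions commute with [f j]: on IX_j by construction, and on the complement because maps
    from X_j/IX_j to IY_j vanish. *)
Lemma hprod_proj_natural j :
  hprod_proj hY j \c dmap hprod_map = dmap (f j) \c hprod_proj hX j.
Proof.
have [rX _ rsX _] := heart_splitP (hX j); have [rY _ _ _] := heart_splitP (hY j).
apply: (heart_mono (hX := hY j)); rewrite dcompA ?retr_hprod_proj ?quo_hprod_proj.
  have rf : heart_retr (hY j) \c dmap (f j) = dmap (idl_map (f j)) \c heart_retr (hX j).
    apply: (heart_epi (hX := hX j)); last exact: quo_idl_vanish (hX j) (hY j).1.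
    rewrite -!dcompA rX dcompm1 -dmap_comp.
    rewrite (_ : dmap _ = dmap (ch_comp (idl_in (Y j)) (idl_map (f j)))); last exact: dmap_eq.
    by rewrite dmap_comp dcompA rY dcomp1m.
  rewrite dcompA rf -dcompA retr_hprod_proj -!dmap_comp; apply: dmap_eq => n x.
  exact: sub_val_inj.
rewrite dcompA.
have -> : dmap (quo_in (Y j)) \c dmap (f j) = dmap (quo_map (f j)) \c dmap (quo_in (X j)).
  by rewrite -!dmap_comp; apply: dmap_eq => n x; congr pair; rewrite /= ?linear0;
    apply: sub_val_inj; rewrite /= linear0.
by rewrite -dcompA quo_hprod_proj -!dmap_comp; exact: dmap_eq.
Qed.

Definition hprod_cone : chmap (hprod (fun j => cone (f j))) (cone hprod_map) :=
  ch_comp (dsum_cone _ _)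
    (ch_comp (dsum_map (idl_cone _) (pc_cone _))
       (dsum_map (idl_map (pc_cone f)) (pc_map (fun j => quo_cone (f j))))).

Lemma hprod_cone_qis : qis hprod_cone.
Proof.
apply: qis_comp; first exact: dsum_cone_qis.
apply: qis_comp; apply: dsum_map_qis.
- exact: idl_cone_qis.
- exact: pc_cone_qis.
- by apply: idl_qis; exact: pc_cone_qis.
by apply: pc_map_qis => j; exact: quo_cone_qis.
Qed.

End Maps.

Section Triangles.
Variables (X Y : J -> cx) (f : forall j, chmap (X j) (Y j)).

Lemma hprod_cone_in : dmap (hprod_cone f) \c dmap (hprod_map (fun j => cone_in (f j))) =
  dmap (cone_in (hprod_map f)).
Proof.
rewrite -dmap_comp; apply: dmap_eq => n [u v].
congr pair; congr pair; try exact: sub_val_inj.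
apply/functional_extensionality_dep => j; congr pair.
by rewrite /= -[RHS]oppr0; congr (- _); exact: sub_val_inj.
apply/functional_extensionality_dep => j; rewrite [RHS]surjective_pairing.
by congr pair; exact: sub_val_inj.
Qed.

Variables (hX : forall j, in_heart (X j)) (hZ : forall j, in_heart (cone (f j))).

(** Maps from the heart into Sigma X_j are detected on Sigma(X_j/IX_j), where both sides are chain
    maps that agree termwise. *)
Lemma hprod_cone_out j : dshift (hprod_proj hX j) \c
    (dmap (cone_out (hprod_map f)) \c dmap (hprod_cone f)) =
  dmap (cone_out (f j)) \c hprod_proj hZ j.
Proof.
apply: (heart_shift_mono (hX := hX j)).
  exact: (heart_shift_idl_vanish (hprod_heart hZ) _ _ (hX j).1).
rewrite !dcompA -dshift_comp quo_hprod_proj.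
pose w := ch_comp (cone_out (quo_map (f j))) (quo_cone (f j)).
have -> : dshift (dmap (quo_in (X j))) \c dmap (cone_out (f j)) =
    dmap w \c dmap (quo_in (cone (f j))).
  rewrite dshift_dmap -!dmap_comp; apply: dmap_eq => n x.
  by congr pair; rewrite /= -[LHS]oppr0; congr (- _); exact: sub_val_inj.
rewrite -[dmap w \c _ \c _]dcompA quo_hprod_proj dshift_dmap -!dmap_comp.
exact: dmap_eq.
Qed.

End Triangles.
End HeartProduct.

(** * The heart of the tilted t-structure *)

Section CohomologyClasses.
Variables (X : cx) (n : int).

Lemma coh_class0 : coh_class (0 : cocycle X n) = 0.
Proof. by apply: (addrI (coh_class 0)); rewrite -coh_classD !addr0. Qed.

Lemma coh_class_eq0 (x : cocycle X n) : coh_class x = 0 <-> is_boundary (cocycle_val x).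
Proof. by rewrite -coh_class0 coh_classP /= subr0. Qed.

Lemma coh_zeroP : coh_zero n X <-> forall c : cohomology X n, c = 0.
Proof.
split=> [zX c|H c dc].
  by rewrite -[c]coh_reprK; apply/coh_class_eq0/zX/cocycleP.
exact/(coh_class_eq0 (mkcocycle dc))/H.
Qed.

Lemma ideal_mul_fixed (M : lmodType prodZ2) (x : M) :
  ideal_mul sumZ2 x <-> cutoff_fixed x.
Proof.
split=> [[m [a [y [Ia ->]]]]|[k kx]].
  elim/big_ind: _ => [|u v fu fv|i _]; first by exists 0; rewrite scaler0.
    by rewrite -[u]scale1r; exact: cutoff_fixedP.
  by have [k <-] := sumZ2_cutoff (Ia i); exists k; rewrite -scalerA cutoff_idem.
exists 1, (fun=> cutoff k), (fun=> x); split; first by move=> _; exact: cutoff_sumZ2.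
by rewrite big_ord1 kx.
Qed.

Lemma coh_torsP : coh_tors n X <-> torsion_class sumZ2 (cohomology X n).
Proof.
split=> [tX|H c dc].
  apply/seteqP; split=> // c _; apply/ideal_mul_fixed.
  have [k bk] := tX _ (cocycleP (coh_repr c)); exists k.
  rewrite -[c]coh_reprK -[_ *: _]/(coh_scale _ _) coh_scale_class; apply/coh_classP.
  by rewrite /= -opprB; exact: is_boundaryN.
have /ideal_mul_fixed[k kc] : ideal_mul sumZ2 (coh_class (mkcocycle dc)) by rewrite H.
exists k; rewrite -opprB; apply: is_boundaryN.
have := kc; rewrite -[_ *: _]/(coh_scale _ _) coh_scale_class => /coh_classP.
by [].
Qed.

Lemma coh_tfreeP : coh_tfree n X <-> torsionfree_class sumZ2 (cohomology X n).
Proof.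
split=> [fX|H c dc k].
  apply/seteqP; split=> c; last first.
    by move=> ->; apply/ideal_mul_fixed; exists 0; rewrite scaler0.
  move=> /ideal_mul_fixed[k <-]; rewrite -[c]coh_reprK.
  rewrite -[_ *: _]/(coh_scale _ _) coh_scale_class; apply/coh_class_eq0.
  exact: (fX _ (cocycleP (coh_repr c)) k).
have : ideal_mul sumZ2 (cutoff k *: coh_class (mkcocycle dc)).
  by apply/ideal_mul_fixed; exists k; rewrite cutoff_idem.
rewrite H -[_ *: _]/(coh_scale _ _) coh_scale_class => /coh_class_eq0.
by [].
Qed.

End CohomologyClasses.

(** * Isomorphism invariance and desuspension *)

Section Isomorphisms.
Implicit Types X Y : cx.

(** A split monomorphism of D(R) is injective on cohomology; the conclusion concerns the numerator,
    since [h] itself is not a chain map. *)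
Lemma retract_inj X Y (h : dhom X Y) (g : dhom Y X) : g \c h = did X ->
  exists Z (f : chmap X Z) (s : chmap Y Z), qis s /\
    forall n c, cx_d X n c = 0 -> is_boundary (f n c) -> is_boundary c.
Proof.
have [Z [f [s [qs ->]]]] := fracP h; have [V [a [t [qt ->]]]] := fracP g.
have [W [al [be [ab qb]]]] := homotopy_square a qs.
have qbt := qis_comp qb qt; rewrite (frac_comp _ qs qt qbt ab qb).
have -> : did X = frac (ch_comp be t) qbt.
  rewrite /did /dmap (frac_refine _ _ (qis_comp qbt (qis_id X))).
  by apply: frac_homotopic; exact: homotopic_eq.
move=> /frac_inj[W' [k [qk kP]]]; exists Z, f, s; split=> // n c dc bf.
have qkbt := qis_comp qk qbt.
apply: ((qisP _).1 qkbt n).1 => //.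
rewrite -[ch_comp k (ch_comp be t) n c](subrK (ch_comp k (ch_comp al f) n c)); apply: is_boundaryD.
  by rewrite -opprB; apply: is_boundaryN; exact: homotopic_boundary kP dc.
exact: (is_boundary_cmap (ch_comp k al) bf).
Qed.

Lemma iso_heart X Y (h : hom (X : derived prodZ2) Y) :
  isomorphism h -> in_heart Y -> in_heart X.
Proof.
move=> [g [gh _]] [pY tY]; have [Z [f [s [qs fI]]]] := retract_inj gh.
split=> [n|]; last exact: coh_tors_inj (fI 0) (coh_tors_qis qs tY).
have [zp zn tf] := pY n; split=> nn.
- exact: coh_zero_inj (fI n) (coh_zero_qis qs (zp nn)).
- exact: coh_zero_inj (fI n) (coh_zero_qis qs (zn nn)).
exact: coh_tfree_inj (fI n) (coh_tfree_qis qs (tf nn)).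
Qed.

Lemma isomorphic_coh_zero X Y n : isomorphic (X : derived prodZ2) Y ->
  coh_zero n Y -> coh_zero n X.
Proof.
move=> [h [g [gh _]]] zY; have [Z [f [s [qs fI]]]] := retract_inj gh.
exact: coh_zero_inj (fI n) (coh_zero_qis qs zY).
Qed.

End Isomorphisms.

Section Unshift.
Variable X : cx.

(** Desuspension has terms X^(n-1), and n + 1 - 1 is not convertible to n, so differentials need
    transport. *)
Definition cx_cast m n (e : m = n) : {linear X m -> X n} :=
  match e in _ = k return {linear X m -> X k} with erefl => idfun end.

Lemma cx_cast_d m n (e : m = n) (e' : m + 1 = n + 1) x :
  cx_cast e' (cx_d X m x) = cx_d X n (cx_cast e x).
Proof. by case: _ / e e' => e'; rewrite (eq_irrelevance e' erefl). Qed.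

Lemma cx_cast_inj m n (e : m = n) : injective (cx_cast e).
Proof. by case: _ / e. Qed.

Lemma cx_cast_surj m n (e : m = n) y : exists x, cx_cast e x = y.
Proof. by case: _ / e y => y; exists y. Qed.

Lemma unshift_deg (n : int) : n - 1 + 1 = n + 1 - 1.
Proof. by rewrite addrAC. Qed.

Definition unshift_d n : {linear X (n - 1) -> X (n + 1 - 1)} :=
  \- (cx_cast (unshift_deg n) \o cx_d X (n - 1))%FUN.

Lemma unshift_dd n x : unshift_d (n + 1) (unshift_d n x) = 0.
Proof.
rewrite /= !linearN opprK.
rewrite -(cx_cast_d _ (congr1 (+%R^~ 1) (unshift_deg n))) cx_dd !linear0 //.
Qed.

Definition unshift : cx := @Complex _ (fun n => X (n - 1)) unshift_d unshift_dd.

Lemma shift_unshift_deg (n : int) : n = n + 1 - 1. Proof. by rewrite addrK. Qed.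

Lemma shift_unshift_d n (x : X n) :
  cx_cast (shift_unshift_deg (n + 1)) (cx_d X n x) =
  cx_d (shift unshift) n (cx_cast (shift_unshift_deg n) x).
Proof.
rewrite /= opprK -(cx_cast_d _ (congr1 (+%R^~ 1) (shift_unshift_deg n))).
move: (unshift_deg _) (congr1 _ _) (shift_unshift_deg _) (cx_d X n x).
move: (n + 1) (n + 1 - 1 + 1) (n + 1 + 1 - 1) => i j k e1 e2 e3 y.
by case: _ / e1 in e2 e3 *; case: _ / e2 in e3 *; rewrite (eq_irrelevance e3 erefl).
Qed.

Definition shift_unshift : chmap X (shift unshift) :=
  @Chmap _ X (shift unshift) (fun n => cx_cast (shift_unshift_deg n)) shift_unshift_d.

Lemma shift_unshift_qis : qis shift_unshift.
Proof.
by apply: bijective_qis => n; [exact: cx_cast_inj|exact: cx_cast_surj].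
Qed.

End Unshift.

Lemma qis_isomorphism (R : pzRingType) (X Y : complex R) (s : chmap X Y) : qis s ->
  isomorphism (dmap s : hom (X : derived R) Y).
Proof. by move=> qs; exists (dinv qs); split; [exact: dinvK|exact: dmapK]. Qed.

Lemma in_heartP (X : derived prodZ2) : in_heart X <->
  aisle (HRS_tilt sumZ2) X /\ coaisle (HRS_tilt sumZ2) X.
Proof.
split=> [[pX tX]|[[zX tX] [[Y [zY XY]] fX]]].
  split; split.
  - by move=> m m0; apply/coh_zeroP; have [H _ _] := pX m; exact: H.
  - exact/coh_torsP.
  (* The coaisle asks for an object whose shift is isomorphic to [X]; the desuspension serves. *)
  - exists (unshift X); split; last first.
      by exists (dmap (shift_unshift X)); apply: qis_isomorphism; exact: shift_unshift_qis.
    apply: int_succP => m m0; apply/coh_zeroP/coh_zero_shift.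
    apply: (coh_zero_qis (shift_unshift_qis X)).
    by have [_ H _] := pX m; apply: H; lia.
  - by apply/coh_tfreeP; have [_ _ H] := pX (-1); exact: H.
split=> [n|]; last exact/coh_torsP.
split=> nn.
- exact/coh_zeroP/zX.
- apply: (isomorphic_coh_zero XY); apply/coh_zero_shift/coh_zeroP/zY; lia.
by rewrite nn; apply/coh_tfreeP.
Qed.

Local Notation tilted_heart := (heart (HRS_tilt sumZ2)).

(** * Products, extensions and Gamma in the heart *)

Section HeartExtensions.
Implicit Types A C : tilted_heart.

Lemma heartP (X : tilted_heart) : in_heart (sval X).
Proof. exact/in_heartP/(svalP X). Qed.

Definition heart_obj (X : cx) (hX : in_heart X) : tilted_heart :=
  exist _ (X : derived prodZ2) ((in_heartP X).1 hX).

Section HeartProducts.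
Variables (J : Type).

Section Existence.
Variable B : J -> tilted_heart.
Let hB j := heartP (B j).

Lemma heart_tuple_ex (X : tilted_heart) (f : forall j, hom X (B j)) :
  exists x : dhom (sval X) (hprod (fun j => sval (B j))),
    forall j, hprod_proj hB j \c x = f j.
Proof. exact: hprod_tuple (heartP X) f. Qed.

Definition heart_product : product B :=
  @Product tilted_heart J B (heart_obj (hprod_heart hB)) (hprod_proj hB)
    (fun X f => sval (cid (heart_tuple_ex f)))
    (fun X f => svalP (cid (heart_tuple_ex f)))
    (fun X h h' => @hprod_uniq J _ hB _ (heartP X) h h').

End Existence.

Section Comparison.
Variables (B : J -> tilted_heart) (Q : product B).
Variables (X : J -> cx) (hX : forall j, in_heart (X j)).
Variable a : forall j, hom (sval (B j)) (X j : derived prodZ2).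
Hypothesis ai : forall j, isomorphism (a j).

(** AET4* allows any choice of products, and a triangle is only isomorphic to a cone triangle.
    Allowing isomorphisms [a j] handles both: identities compare [Q] with F(B), others replace B_j
    by vertices of cone triangles. *)
Lemma product_hprod_iso : exists u : hom (sval (Q : tilted_heart)) (hprod X : derived prodZ2),
  isomorphism u /\ forall j, hprod_proj hX j \c u = a j \c proj Q j.
Proof.
pose PX := heart_obj (hprod_heart hX).
have [u uP] := hprod_tuple hX (heartP Q) (fun j => a j \c proj Q j).
pose b j := sval (cid (ai j)); have bP j := svalP (cid (ai j)).
pose v : hom PX Q := tuple_hom Q (X := PX) (fun j => b j \c hprod_proj hX j).
have vP j : proj Q j \c v = b j \c hprod_proj hX j.
  exact: (@proj_tuple tilted_heart J B Q PX _ j).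
exists u; split=> //; exists v; split.
  apply: (tuple_hom_uniq (p := Q) (h := (v \c u : hom (Q : tilted_heart) Q)) (h' := idm _)) => j.
  rewrite -[LHS]/(proj Q j \c (v \c u)) dcompA vP -dcompA uP dcompA.
  rewrite [b j \c a j](bP j).1 [RHS](dcompm1 (proj Q j : dhom _ _)).
  exact: (dcomp1m (proj Q j : dhom _ _)).
apply: (hprod_uniq (hY := hX) (hprod_heart hX)) => j.
rewrite -[LHS]/(hprod_proj hX j \c (u \c v)) dcompA uP -dcompA vP dcompA.
by rewrite [a j \c b j](bP j).2 [RHS]dcompm1; exact: dcomp1m.
Qed.

End Comparison.

Section ExtProduct.
Variables (B : J -> tilted_heart) (Q : product B) (A : tilted_heart).

Lemma product_hprod : exists (u : dhom (sval (Q : tilted_heart)) (hprod (fun j => sval (B j))))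
    (v : dhom (hprod (fun j => sval (B j))) (sval (Q : tilted_heart))),
  [/\ v \c u = did _, u \c v = did _ &
      forall j, hprod_proj (fun j => heartP (B j)) j \c u = proj Q j].
Proof.
have [u [[v [vu uv]] uP]] := @product_hprod_iso B Q _ (fun j => heartP (B j))
  (fun j => did (sval (B j))) (fun j => ex_intro _ (did _) (conj (dcomp1m _) (dcomp1m _))).
by exists u, v; split=> // j; rewrite uP dcomp1m.
Qed.

(** With [Ext_product_tuple] this is E(A, Q) = prod_j E(A, B_j); every law of Gamma will be checked
    after pushing along projections. *)
Lemma Ext_product_uniq (x y : Ext A Q) :
  (forall j, push (proj Q j) x = push (proj Q j) y) -> x = y.
Proof.
move=> xy; have [u [v [vu uv uP]]] := product_hprod.
have e : dshift u \c x = dshift u \c y.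
  apply: (hprod_shift_uniq (hY := fun j => heartP (B j)) (heartP A)) => j.
  by rewrite !dcompA -dshift_comp uP; exact: xy.
rewrite -[x]dcomp1m -[y]dcomp1m -dshift1 -vu dshift_comp -!dcompA.
by rewrite e.
Qed.

Lemma Ext_product_tuple (y : forall j, Ext A (B j)) :
  exists x : Ext A Q, forall j, push (proj Q j) x = y j.
Proof.
have [u [v [vu uv uP]]] := product_hprod.
have [x xP] := hprod_shift_tuple (fun j => heartP (B j)) (heartP A) y.
exists (dshift v \c x) => j; rewrite -[LHS]/(dshift (proj Q j) \c (dshift v \c x)).
by rewrite -uP dcompA -dshift_comp -dcompA uv dcompm1 xP.
Qed.

End ExtProduct.

Section Gamma.
Variable P : forall B : J -> tilted_heart, product B.
Local Notation power A := (P (fun=> A)).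

Lemma Gamma_ex A (B : J -> tilted_heart) (eta : forall i, Ext A (B i)) :
  exists x : Ext (power A) (P B),
    forall j, push (proj (P B) j) x = pull (eta j) (proj (power A) j).
Proof. exact: Ext_product_tuple. Qed.

Definition heart_Gamma A (B : J -> tilted_heart) (eta : forall i, Ext A (B i)) :
  Ext (power A) (P B) := sval (cid (Gamma_ex eta)).

Lemma heart_GammaP A (B : J -> tilted_heart) (eta : forall i, Ext A (B i)) j :
  push (proj (P B) j) (heart_Gamma eta) = pull (eta j) (proj (power A) j).
Proof. exact: (svalP (cid (Gamma_ex eta))). Qed.

(** Bundles the witnesses of [distinguished] so that a single choice over the index set produces
    them all. *)
Record cone_data (A : cx) (B Z : cx) := ConeData {
  cd_src : cx; cd_tgt : cx; cd_map : chmap cd_src cd_tgt;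
  cd_a : dhom B cd_src; cd_b : dhom Z cd_tgt; cd_c : dhom A (cone cd_map) }.

(** Each triangle is replaced by the cone triangle of a chain map h_j; applying F gives the triangle
    of F(h), compared with the given products by [product_hprod_iso]. *)
Lemma heart_Gamma_realizes A (B : J -> tilted_heart) (eta : forall i, Ext A (B i))
    (Z : J -> tilted_heart) (f : forall i, hom (B i) (Z i)) (g : forall i, hom (Z i) A) :
  (forall i, realizes (eta i) (f i) (g i)) ->
  realizes (heart_Gamma eta) (prod_map (P B) (P Z) f) (prod_map (P Z) (power A) g).
Proof.
move=> real.
pose D := derived prodZ2.
pose good j (d : cone_data (sval A) (sval (B j)) (sval (Z j))) :=
  [/\ @isomorphism D _ _ (cd_a d), @isomorphism D _ _ (cd_b d) & @isomorphism D _ _ (cd_c d)] /\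
  [/\ cd_b d \c f j = dmap (cd_map d) \c cd_a d,
      cd_c d \c g j = dmap (cone_in (cd_map d)) \c cd_b d &
      dshift (cd_a d) \c eta j = dmap (cone_out (cd_map d)) \c cd_c d].
have ex j : exists d, good j d.
  have [X [Y [h [a [b [c [isos eqs]]]]]]] := real j.
  by exists (@ConeData _ _ _ X Y h a b c).
pose d j := sval (cid (ex j)); have dP j : good j (d j) := svalP (cid (ex j)).
pose X j := cd_src (d j); pose Y j := cd_tgt (d j).
pose h j : chmap (X j) (Y j) := cd_map (d j).
have inv_heart (U V : cx) (x : @hom D U V) : isomorphism x -> in_heart U -> in_heart V.
  by move=> [y [yx xy]]; apply: (@iso_heart V U y); exists x.
have hX j : in_heart (X j).
  by have [[ia _ _] _] := dP j; exact: inv_heart ia (heartP _).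
have hY j : in_heart (Y j).
  by have [[_ ib _] _] := dP j; exact: inv_heart ib (heartP _).
have hC j : in_heart (cone (h j)).
  by have [[_ _ ic] _] := dP j; exact: inv_heart ic (heartP _).
have [u [iu uP]] := @product_hprod_iso B (P B) X hX (fun j => cd_a (d j))
  (fun j => let: conj (And3 ia _ _) _ := dP j in ia).
have [v [iv vP]] := @product_hprod_iso Z (P Z) Y hY (fun j => cd_b (d j))
  (fun j => let: conj (And3 _ ib _) _ := dP j in ib).
have [w [iw wP]] := @product_hprod_iso (fun=> A) (power A) _ hC (fun j => cd_c (d j))
  (fun j => let: conj (And3 _ _ ic) _ := dP j in ic).
have pf j : proj (P Z) j \c prod_map (P B) (P Z) f = f j \c proj (P B) j.
  exact: (proj_tuple (P Z) (fun j => compm (f j) (proj (P B) j)) j).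
have pg j : proj (power A) j \c prod_map (P Z) (power A) g = g j \c proj (P Z) j.
  exact: (proj_tuple (power A) (fun j => compm (g j) (proj (P Z) j)) j).
(* The third comparison runs from the power of [A] to F(cone h_j) and then to cone F(h). *)
exists (hprod X), (hprod Y), (hprod_map h), u, v, (dmap (hprod_cone h) \c w).
split; split=> //.
- have [s [sc cs]] := qis_isomorphism (hprod_cone_qis h); have [t [tw wt]] := iw.
  exists (t \c s); split.
    rewrite -[LHS]/((t \c s) \c (dmap (hprod_cone h) \c w)) dcompA -[t \c s \c _]dcompA.
    by rewrite [s \c _]sc dcompm1.
  rewrite -[LHS]/((dmap (hprod_cone h) \c w) \c (t \c s)) dcompA -[_ \c w \c t]dcompA.
  by rewrite [w \c _]wt dcompm1.
- apply: (hprod_uniq (hY := hY) (heartP (P B))) => j.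
  have [_ [e _ _]] := dP j.
  rewrite -[LHS]/(hprod_proj hY j \c (v \c prod_map (P B) (P Z) f)) dcompA vP -dcompA pf dcompA e.
  rewrite -[RHS]/(hprod_proj hY j \c (dmap (hprod_map h) \c u)) dcompA.
  by rewrite (hprod_proj_natural h hX) -!dcompA uP.
- rewrite -[LHS]/(dmap (hprod_cone h) \c w \c prod_map (P Z) (power A) g) -dcompA.
  rewrite -[RHS]/(dmap (cone_in (hprod_map h)) \c v) -hprod_cone_in -dcompA; congr (_ \c _).
  apply: (hprod_uniq (hY := hC) (heartP (P Z))) => j.
  have [_ [_ e _]] := dP j.
  rewrite !dcompA wP -dcompA pg dcompA e (hprod_proj_natural (fun j => cone_in (h j)) hY).
  by rewrite -!dcompA vP.
(* After projection to Sigma X_j, condition (2) turns Gamma into [eta j], and the square for the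
   index [j] finishes. *)
apply: (hprod_shift_uniq (hY := hX) (heartP (power A))) => j.
have [_ [_ _ e]] := dP j.
have q : dshift (proj (P B) j) \c heart_Gamma eta = eta j \c proj (power A) j.
  exact: heart_GammaP.
rewrite -[LHS]/(dshift (hprod_proj hX j) \c (dshift u \c heart_Gamma eta)).
rewrite dcompA -dshift_comp uP dshift_comp -dcompA q.
rewrite -[RHS]/(dshift (hprod_proj hX j) \c (dmap (cone_out (hprod_map h)) \c
  (dmap (hprod_cone h) \c w))).
rewrite [dmap _ \c (_ \c w)]dcompA [RHS]dcompA (hprod_cone_out hX hC) -dcompA wP.
by rewrite [RHS]dcompA -e -dcompA.
Qed.

Lemma heart_AET4star_for : AET4star_for (P := P) heart_Gamma.
Proof.
split.
- move=> A B eta eta'; apply: Ext_product_uniq => j.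
  by rewrite pushDr !heart_GammaP pullDl.
- move=> A A' a B eta; apply: Ext_product_uniq => j.
  by rewrite -push_pull !heart_GammaP -!pullM proj_tuple.
- move=> A B B' b eta; apply: Ext_product_uniq => j.
  by rewrite -pushM proj_tuple pushM !heart_GammaP push_pull.
- by move=> A B eta Z f g; exact: heart_Gamma_realizes.
by move=> A B eta j; exact: heart_GammaP.
Qed.

End Gamma.
End HeartProducts.
End HeartExtensions.

(** * Failure of co-smashing *)

Section NotCoSmashing.

Lemma const_dd (R : pzRingType) (M : lmodType R) (n : int) (x : M) :
  (\0 : {linear M -> M}) ((\0 : {linear M -> M}) x) = 0.
Proof. by []. Qed.

Definition const_cx : cx :=
  @Complex _ (fun=> (prodZ2^o : lmodType prodZ2)) (fun=> \0) (fun n => @const_dd _ _ n).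

Lemma const_boundary n (x : const_cx n) : is_boundary x -> x = 0.
Proof. by case. Qed.

(** The module I in every degree <= 0, with zero differential. The extra negative degrees are
    harmless in the aisle and spare a case distinction at degree 0. *)
Definition ideal0_pred n (x : const_cx n) := cutoff_fixed x /\ (0 < n -> x = 0).

Lemma ideal0_pred0 n : ideal0_pred (0 : const_cx n).
Proof. by split=> //; exists 0; rewrite scaler0. Qed.

Lemma ideal0_predP n a (u v : const_cx n) :
  ideal0_pred u -> ideal0_pred v -> ideal0_pred (a *: u + v).
Proof.
move=> [fu u0] [fv v0]; split=> [|n0]; first exact: cutoff_fixedP.
by rewrite u0 // v0 // scaler0 addr0.
Qed.

Lemma ideal0_pred_d n (x : const_cx n) : ideal0_pred x -> ideal0_pred (cx_d const_cx n x).
Proof. by move=> _; exact: ideal0_pred0. Qed.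

Definition ideal0_sub : subcx const_cx := Subcx ideal0_pred0 ideal0_predP ideal0_pred_d.
Definition ideal0 : cx := subc ideal0_sub.

Lemma ideal0_aisle : aisle (HRS_tilt sumZ2) ideal0.
Proof.
split=> [m m0|].
  apply/coh_zeroP => c _; have [_ c0] := sub_eltP c.
  have -> : c = 0 by apply: sub_val_inj; exact: c0.
  exact: is_boundary0.
apply/coh_torsP => c _; have [[k kc] _] := sub_eltP c; exists k.
have -> : cutoff k *: c = c by apply: sub_val_inj; exact: kc.
by rewrite subrr; exact: is_boundary0.
Qed.

Lemma not_co_smashing : ~ co_smashing (HRS_tilt sumZ2).
Proof.
pose X (j : nat) : derived prodZ2 := ideal0.
pose tuple A (x : forall j, hom A (X j)) := cid (@pc_dhom_tuple _ _ (fun=> ideal0) A x).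
pose P : product X := @Product (derived prodZ2) nat X (prodc (fun=> ideal0))
  (fun j => dmap (pc_proj _ j)) (fun A x => sval (tuple A x))
  (fun A x => svalP (tuple A x)) (fun A h h' => @pc_dhom_uniq _ _ _ A h h').
move=> /(_ nat X P (fun=> ideal0_aisle))[_ /coh_torsP].
have cP j : ideal0_pred (cutoff j : const_cx 0).
  by split=> //; exists j; exact: etrans (cutoffM j j) (congr1 cutoff (minnn j)).
(* The family of all cutoffs lies in the product of copies of I, but no single cutoff fixes it:
   [cutoff k] changes the component of index k + 1 at coordinate k. As differentials are zero, this
   already holds for its class. *)
pose c : prodc (fun _ : nat => ideal0) 0 := fun j => @mksub _ _ ideal0_sub 0 _ (cP j).
move=> /(_ c)[|k /pc_boundary/(_ k.+1)].
  by apply/functional_extensionality_dep => j; exact: sub_val_inj.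
move=> /(is_boundary_cmap (sub_in _))/const_boundary e.
have := congr1 (fun x : prodZ2 => x k) e.
rewrite -[LHS]/(cutoff k.+1 k - cutoff k k * cutoff k.+1 k).
by rewrite /cutoff ltnn ltnSn mul0r subr0.
Qed.

End NotCoSmashing.

Theorem proposition4p16 :
  AET4star (heart (HRS_tilt sumZ2)) /\ ~ co_smashing (HRS_tilt sumZ2).
Proof.
split; last exact: not_co_smashing.
split=> J _; first by move=> B; exists; exact: heart_product.
by move=> P; exists (@heart_Gamma J P); exact: heart_AET4star_for.
Qed.
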